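(* Let $R$ be a commutative Noetherian domain of Krull dimension $d$ and $I$ an ideal of $R$. Then for every $n\geq\max\{3,d+2\}$, the natural map $\mathrm{GL}_n(R[It])/\mathrm{E}_n(R[It])\to \mathrm{K}_1(R[It])$ is an isomorphism.
   Context: The Rees algebra is $R[It]=\bigoplus_{n\geq 0} I^n t^n\subset R[t]$ for an indeterminate $t$. For a ring $A$, $\mathrm{E}_n(A)$ is the subgroup of $\mathrm{GL}_n(A)$ generated by the elementary matrices, and $\mathrm{K}_1(A)=\mathrm{GL}(A)/\mathrm{E}(A)$; the natural map is induced by the stabilization $\mathrm{GL}_n(A)\to\mathrm{GL}(A)$. *)

(* Defs.v *)
From HB Require Import structures.
From mathcomp Require Import all_boot all_order all_algebra.
Set Implicit Arguments. Unset Strict Implicit. Unset Printing Implicit Defensive.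
Import GRing.Theory.
Local Open Scope ring_scope.

Definition is_ideal (R : comNzRingType) (I : R -> Prop) : Prop :=
  [/\ I 0, (forall x y, I x -> I y -> I (x + y)) & (forall a x, I x -> I (a * x))].

Definition is_prime_ideal (R : comNzRingType) (P : R -> Prop) : Prop :=
  [/\ is_ideal P, ~ P 1 & (forall a b, P (a * b) -> P a \/ P b)].

Definition noetherian (R : comNzRingType) : Prop :=
  forall Ik : nat -> R -> Prop,
    (forall k, is_ideal (Ik k)) ->
    (forall k x, Ik k x -> Ik k.+1 x) ->
    exists N, forall k, (N <= k)%N -> forall x, Ik k x <-> Ik N x.

Definition prime_chain (R : comNzRingType) (l : nat) (P : nat -> R -> Prop) : Prop :=
  (forall k, (k <= l)%N -> is_prime_ideal (P k)) /\
  (forall k, (k < l)%N ->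
     (forall x, P k x -> P k.+1 x) /\ exists x, P k.+1 x /\ ~ P k x).

Definition krull_dim (R : comNzRingType) (d : nat) : Prop :=
  (exists P : nat -> R -> Prop, prime_chain d P) /\ (forall l (P : nat -> R -> Prop), prime_chain l P -> (l <= d)%N).

Fixpoint ideal_pow (R : comNzRingType) (I : R -> Prop) (n : nat) : R -> Prop :=
  match n with
  | 0%N => fun _ => True
  | n'.+1 => fun x => exists s : seq (R * R),
      (forall p, p \in s -> I p.1 /\ ideal_pow I n' p.2) /\
      x = \sum_(p <- s) p.1 * p.2
  end.

Definition in_rees (R : comNzRingType) (I : R -> Prop) (p : {poly R}) : Prop :=
  forall i, ideal_pow I i p`_i.

Definition mx_over (R : comNzRingType) (I : R -> Prop) (m n : nat)
  (A : 'M[{poly R}]_(m, n)) : Prop :=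
  forall i j, in_rees I (A i j).

Definition rees_GL (R : comNzRingType) (I : R -> Prop) (n : nat)
  (A : 'M[{poly R}]_n) : Prop :=
  mx_over I A /\ exists B : 'M[{poly R}]_n,
    [/\ mx_over I B, A *m B = 1%:M & B *m A = 1%:M].

Definition rees_elementary (R : comNzRingType) (I : R -> Prop) (n : nat)
  (A : 'M[{poly R}]_n) : Prop :=
  exists (i j : 'I_n) (a : {poly R}),
    [/\ i != j, in_rees I a & A = 1%:M + a *: delta_mx i j].

(* E_n(R[It]) : subgroup generated by elementary matrices (inverses of
   elementary matrices are elementary, so products suffice). *)
Inductive rees_E (R : comNzRingType) (I : R -> Prop) (n : nat) :
  'M[{poly R}]_n -> Prop :=
| rees_E1 : rees_E I 1%:M
| rees_EM A e : rees_E I A -> rees_elementary I e -> rees_E I (A *m e).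

Definition stab (R : comNzRingType) (n m : nat) (g : 'M[{poly R}]_n)
  : 'M[{poly R}]_(n + m) := block_mx g 0 0 1%:M.

(* Main.v *)
(* Write A for the Rees algebra R[It], inside K[t] where K is the fraction field of R.  A is a
   quotient of an iterated polynomial ring over R in which every prime chain above the kernel has
   length at most d + 1 (Krull's principal ideal theorem), so A has stable range at most d + 2 and
   surjectivity follows from Bass' argument.

   For injectivity let g in GL_n(A) be stably elementary, with I nonzero (otherwise A = R and only the
   last step is needed).  The Bass--Vaserstein theorem over K[t] gives a nonzero u in I such that g is
   elementary over A[1/u].  Localize A at the multiplicative set 1 + uR.  The primes
   of this ring that contain u form chains of length at most d, because the zero ideal has been lost;
   those that do not contain u correspond to primes of R[t] whose contraction to R lies in a
   strictly larger maximal ideal, so they form chains of length at most d as well.  Hence the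
   localization has stable range at most d + 1, which is one better than A itself, and Bass--Vaserstein
   makes g elementary over A[1/v] for some v in 1 + uR.  Since u and v are comaximal, Quillen's
   patching along the dilations t -> at shows that g differs from the constant matrix g(0) by an
   elementary matrix over A, and g(0) is elementary by Bass--Vaserstein over R. *)

Require Import Defs.
From HB Require Import structures.
From mathcomp Require Import all_boot all_order all_algebra.
From mathcomp Require Import ring boolp zify.
From Stdlib Require List.
Set Implicit Arguments. Unset Strict Implicit. Unset Printing Implicit Defensive.
Import GRing.Theory.
Local Open Scope ring_scope.

(** Stable range at most [k] yields surjectivity from size [k] on, but injectivity only from size
    [k + 1] on. The bound [d + 2] for the Rees algebra thus leaves exactly the case n = d + 2 of
    injectivity open, and the two localizations exist to gain this one step. The bound n >= 3 enters
    twice: [n - 1] must reach the stable range 2 of K[t], and patching needs a third index to write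
    an elementary matrix as a commutator. Denominators are always taken in R, hence are constants in
    t: the localizations can be realized as subrings of K[t], and dilations do not affect
    denominators. The dilations by 0 and 1 are evaluation at 0 and the identity, which is why the
    dilation parameter is moved from 0 to 1. Dimension enters only through lengths of prime chains.
    For the Rees algebra they are counted in a presenting ring above the kernel; each further
    generator [a t] costs a variable, but the relation between [a0 (a t)] and [a (a0 t)] makes the
    kernel larger and cancels that cost. *)

Local Notation "x %:F" := (@tofrac _ x) : ring_scope.

(** * Ideals and primes of a Noetherian ring *)

Section NoetherianPrimes.
Variable B : comNzRingType.
Implicit Types (J P Q : B -> Prop) (x y a b : B).

Definition psub J J' := forall x, J x -> J' x.

Definition ssub J J' := psub J J' /\ exists x, J' x /\ ~ J x.

Definition adjoin J a : B -> Prop := fun x => exists j r, J j /\ x = j + r * a.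

Definition mult_closed (S : B -> Prop) := S 1 /\ forall x y, S x -> S y -> S (x * y).

Lemma psub_trans J1 J2 J3 : psub J1 J2 -> psub J2 J3 -> psub J1 J3.
Proof. by move=> h1 h2 x /h1/h2. Qed.

Lemma ideal_opp J x : is_ideal J -> J x -> J (- x).
Proof. by case=> _ _ hM /(hM (-1)); rewrite mulN1r. Qed.

Lemma ideal_sub J x y : is_ideal J -> J x -> J y -> J (x - y).
Proof. by move=> hJ hx hy; case: (hJ) => _ hD _; apply: hD => //; exact: ideal_opp. Qed.

Lemma ideal_mulr J x y : is_ideal J -> J x -> J (x * y).
Proof. by case=> _ _ hM; rewrite mulrC; exact: hM. Qed.

Lemma ideal_sum J (T : eqType) (s : seq T) (F : T -> B) : is_ideal J ->
  (forall t, t \in s -> J (F t)) -> J (\sum_(t <- s) F t).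
Proof.
move=> [h0 hD _]; elim: s => [|t s IH] h; first by rewrite big_nil.
rewrite big_cons; apply: hD; first by apply: h; rewrite inE eqxx.
by apply: IH => u hu; apply: h; rewrite inE hu orbT.
Qed.

Lemma ideal_bigsum J (T : finType) (D : pred T) (F : T -> B) : is_ideal J ->
  (forall t, D t -> J (F t)) -> J (\sum_(t | D t) F t).
Proof. by move=> [h0 hD _] h; elim/big_ind: _. Qed.

Lemma adjoin_ideal J a : is_ideal J -> is_ideal (adjoin J a).
Proof.
move=> [h0 hD hM]; split.
- by exists 0, 0; split => //; rewrite mul0r addr0.
- move=> x y [j [r [hj ->]]] [j' [r' [hj' ->]]]; exists (j + j'), (r + r').
  by split; [exact: hD | ring].
- move=> c x [j [r [hj ->]]]; exists (c * j), (c * r).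
  by split; [exact: hM | ring].
Qed.

Lemma adjoin_sub J a : psub J (adjoin J a).
Proof. by move=> x hx; exists x, 0; split=> //; rewrite mul0r addr0. Qed.

Lemma adjoin_in J a : is_ideal J -> adjoin J a a.
Proof. by case=> h0 _ _; exists 0, 1; split=> //; rewrite mul1r add0r. Qed.

Lemma adjoin_min J J' a : is_ideal J' -> psub J J' -> J' a -> psub (adjoin J a) J'.
Proof.
by move=> [_ hD hM] h ha x [j [r [hj ->]]]; apply: hD; [exact: h | exact: hM].
Qed.

Lemma prime_ideal P : is_prime_ideal P -> is_ideal P. Proof. by case. Qed.

Lemma prime_exp P x n : is_prime_ideal P -> P (x ^+ n) -> P x.
Proof.
case=> _ h1 hM; elim: n => [|n IH]; first by rewrite expr0 => /h1.
by rewrite exprS => /hM [].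
Qed.

Lemma prime_compl P : is_prime_ideal P -> mult_closed (fun x => ~ P x).
Proof. by case=> _ h1 hM; split=> // x y hx hy /hM []. Qed.

Hypothesis noethB : noetherian B.

(** Dependent choice: if no member above [J0] were maximal, [J0] could be enlarged inside [F]
    forever, against the ascending chain condition. This takes the place of Zorn's lemma
    throughout. *)
Lemma noetherian_max (F : (B -> Prop) -> Prop) J0 :
  (forall J, F J -> is_ideal J) -> F J0 ->
  exists J, [/\ F J, psub J0 J & forall J', F J' -> psub J J' -> psub J' J].
Proof.
move=> hF hJ0; apply: contrapT => hn.
(* Choice needs a successor for every member of [F]; one that does not contain [J0] is simply sent
   to itself. *)
have step (J : {J | F J}) : exists J' : {J | F J},
    psub J0 (sval J) -> psub (sval J) (sval J') /\ ~ psub (sval J') (sval J).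
  case: (EM (psub J0 (sval J))) => [h0|h0]; last by exists J.
  apply: contrapT => hJ; apply: hn; exists (sval J); split=> //; first exact: svalP J.
  move=> J' hJ' h; apply: contrapT => h'; apply: hJ.
  by exists (exist _ J' hJ').
have [f hf] := choice step.
pose C k := iter k f (exist _ J0 hJ0).
have hC k : psub J0 (sval (C k)).
  elim: k => [|k IH]; first by move=> x.
  by case: (hf (C k) IH) => h _; exact: psub_trans IH h.
have [||N hN] := noethB (Ik := fun k => sval (C k)).
- by move=> k; apply: hF; exact: svalP (C k).
- by move=> k x; case: (hf (C k) (hC k)) => h _; exact: h.
case: (hf (C N) (hC N)) => _; apply=> x hx.
by apply/(hN N.+1 (leqnSn N)).
Qed.

(** An ideal above [J] that is maximal among those disjoint from [S] is prime: enlarging it by [a]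
    or by [b] makes it meet [S], and the product of the two elements met would lie in it if [a * b]
    did. *)
Lemma prime_avoiding (S : B -> Prop) J : is_ideal J -> mult_closed S ->
  (forall x, S x -> ~ J x) ->
  exists P, [/\ is_prime_ideal P, psub J P & forall x, S x -> ~ P x].
Proof.
move=> hJ [S1 SM] hS.
have [P [[hP hPS] hJP hmax]] := noetherian_max
  (F := fun J => is_ideal J /\ forall x, S x -> ~ J x)
  (fun J h => proj1 h) (conj hJ hS).
have key a : ~ P a -> exists x, S x /\ adjoin P a x.
  move=> ha; apply: contrapT => hn; apply: ha.
  apply: (hmax (adjoin P a)); last exact: adjoin_in.
    by split; [exact: adjoin_ideal | move=> x hx hx'; apply: hn; exists x].
  exact: adjoin_sub.
exists P; split=> //; split=> //; first exact: hPS.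
move=> a b hab; apply: contrapT => /not_orP [/key [x [hx [j [r [hj e]]]]]].
move=> /key [y [hy [j' [r' [hj' e']]]]].
apply: (hPS (x * y)); first exact: SM.
rewrite e e'.
have -> : (j + r * a) * (j' + r' * b) = j * (j' + r' * b) + r * a * j' + r * r' * (a * b).
  by ring.
case: (hP) => _ hD hM; apply: (hD); last exact: hM.
by apply: hD; [exact: ideal_mulr | exact: hM].
Qed.

Lemma prime_above J : is_ideal J -> ~ J 1 -> exists P, is_prime_ideal P /\ psub J P.
Proof.
move=> hJ h1; have [||P [hP hJP _]] := @prime_avoiding (fun x => x = 1) J hJ.
- by split=> // x y -> ->; rewrite mulr1.
- by move=> x ->.
by exists P.
Qed.

(** Noetherian induction: an ideal maximal among the counterexamples is not prime, so it contains
    some [a * b] but neither factor, and the lists of its two enlargements together serve for it.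
    [List.In] is used because predicates have no decidable equality. *)
Lemma finitely_many_primes J : is_ideal J ->
  exists s : seq (B -> Prop),
    (forall Q, List.In Q s -> is_prime_ideal Q /\ psub J Q) /\
    (forall P, is_prime_ideal P -> psub J P -> exists Q, List.In Q s /\ psub Q P).
Proof.
move=> hJ; apply: contrapT => hn.
pose ok J := exists s : seq (B -> Prop),
    (forall Q, List.In Q s -> is_prime_ideal Q /\ psub J Q) /\
    (forall P, is_prime_ideal P -> psub J P -> exists Q, List.In Q s /\ psub Q P).
have [M [[hM hMn] _ hmax]] := noetherian_max (F := fun J => is_ideal J /\ ~ ok J)
  (fun J h => proj1 h) (conj hJ hn).
have h1 : ~ M 1.
  by move=> h1; apply: hMn; exists [::]; split=> // P [_ hP1 _] h; case: hP1; exact: h.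
have big a : ~ M a -> ok (adjoin M a).
  move=> ha; apply: contrapT => hk; apply: ha.
  apply: (hmax (adjoin M a)); last exact: adjoin_in.
    by split; first exact: adjoin_ideal.
  exact: adjoin_sub.
case: (EM (is_prime_ideal M)) => hMp.
  apply: hMn; exists [:: M]; split; first by move=> Q [<-|[]]; split=> // x.
  by move=> P hP hMP; exists M; split=> //; left.
have [a [b [ha [hb hab]]]] : exists a b, ~ M a /\ ~ M b /\ M (a * b).
  apply: contrapT => hno; apply: hMp; split=> // a b hab.
  by apply: contrapT => /not_orP [ha hb]; apply: hno; exists a, b.
have [s [hs hs']] := big a ha; have [t [ht ht']] := big b hb.
apply: hMn; exists (s ++ t); split.
  move=> Q /List.in_app_iff [/hs|/ht] [hQ h]; split=> //;
  exact: psub_trans (@adjoin_sub _ _) h.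
move=> P hP hMP; case: (hP) => hPi _ hPM.
have [hPa|hPb] := hPM _ _ (hMP _ hab).
  have [Q [hQ hQP]] := hs' P hP (adjoin_min hPi hMP hPa).
  by exists Q; split=> //; apply/List.in_app_iff; left.
have [Q [hQ hQP]] := ht' P hP (adjoin_min hPi hMP hPb).
by exists Q; split=> //; apply/List.in_app_iff; right.
Qed.

Lemma list_minimal (s : seq (B -> Prop)) (G : (B -> Prop) -> Prop) Q0 :
  List.In Q0 s -> G Q0 ->
  exists Q, [/\ List.In Q s, G Q &
    forall Q', List.In Q' s -> G Q' -> psub Q' Q -> psub Q Q'].
Proof.
elim: s Q0 => [|P s IH] Q0 //= hQ0 hG.
case: (EM (exists Q, List.In Q s /\ G Q)) => [[Q1 [h1 h2]]|hn].
  have [Q [hQ hGQ hQm]] := IH Q1 h1 h2.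
  case: (EM (G P /\ psub P Q)) => [[hGP hPQ]|hP].
    exists P; split=> //; first by left.
    move=> Q' [-> //|hQ'] hGQ' hQ'P.
    exact: psub_trans hPQ (hQm Q' hQ' hGQ' (psub_trans hQ'P hPQ)).
  exists Q; split=> //; first by right.
  by move=> Q' [<-|]; [move=> h h'; case: hP | exact: hQm].
case: hQ0 => [e|hQ0]; last by case: hn; exists Q0.
subst Q0; exists P; split=> //; first by left.
by move=> Q' [-> //|h1 h2]; case: hn; exists Q'.
Qed.

(** Every prime over [J] lies above a member of one finite list, so a member minimal within the list
    is minimal among all primes over [J]. *)
Lemma minimal_prime J P : is_ideal J -> is_prime_ideal P -> psub J P ->
  exists Q, [/\ is_prime_ideal Q, psub J Q, psub Q P &
    forall Q', is_prime_ideal Q' -> psub J Q' -> psub Q' Q -> psub Q Q'].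
Proof.
move=> hJ hP hJP; have [s [hs hs']] := finitely_many_primes hJ.
have [Q0 [h0 h0P]] := hs' P hP hJP.
have [Q [hQ hQP hmin]] := list_minimal (G := fun Q => psub Q P) h0 h0P.
have [hQp hJQ] := hs _ hQ.
exists Q; split=> // Q' hQ' hJQ' hQ'Q.
have [Q1 [h1 h1Q']] := hs' Q' hQ' hJQ'.
refine (psub_trans _ h1Q'); apply: hmin => //.
  exact: psub_trans h1Q' (psub_trans hQ'Q hQP).
exact: psub_trans h1Q' hQ'Q.
Qed.

End NoetherianPrimes.

(** * Krull's principal ideal theorem *)

Section KrullHauptidealsatz.
Variable B : comNzRingType.
Hypothesis noethB : noetherian B.
Implicit Types (J P Q C Z : B -> Prop) (x y a b : B).

(** For a prime [P], the contraction to [B] of the extension of [J] to the localization at [P]. The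
    localization itself is never formed. *)
Definition satur P J : B -> Prop := fun x => exists w, ~ P w /\ J (w * x).

Definition saturated P J := forall w x, ~ P w -> J (w * x) -> J x.

(** The ideal [P C + Z], as an intersection of ideals so that no finite sums have to be handled. *)
Definition mul_add_ideal P C Z : B -> Prop := fun x =>
  forall D, is_ideal D -> psub Z D -> (forall p c, P p -> C c -> D (p * c)) -> D x.

Lemma satur_ideal P J : is_prime_ideal P -> is_ideal J -> is_ideal (satur P J).
Proof.
move=> hP; have [hP1 hPM] := prime_compl hP; case=> h0 hD hM; split.
- by exists 1; split=> //; rewrite mulr0.
- move=> x y [w [hw hx]] [w' [hw' hy]]; exists (w * w'); split; first exact: hPM.
  have -> : w * w' * (x + y) = w' * (w * x) + w * (w' * y) by ring.
  by apply: hD; exact: hM.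
- move=> c x [w [hw hx]]; exists w; split=> //.
  by rewrite mulrCA; exact: hM.
Qed.

Lemma satur_saturated P J : is_prime_ideal P -> saturated P (satur P J).
Proof.
move=> hP; have [hP1 hPM] := prime_compl hP.
move=> w x hw [w' [hw' h]]; exists (w' * w); split; first exact: hPM.
by rewrite -mulrA.
Qed.

Lemma satur_sub P J : is_prime_ideal P -> psub J (satur P J).
Proof.
by move=> hP x hx; exists 1; rewrite mul1r; split=> //; case: (prime_compl hP).
Qed.

Lemma satur_min P J J' : saturated P J' -> psub J J' -> psub (satur P J) J'.
Proof. by move=> hs h x [w [hw /h]]; exact: hs. Qed.

Lemma prime_saturated P Q : is_prime_ideal P -> psub P Q -> saturated Q P.
Proof. by case=> _ _ hM h w x hw /hM [/h|]. Qed.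

Lemma mul_add_is_ideal P C Z : is_ideal (mul_add_ideal P C Z).
Proof.
split.
- by move=> D [].
- move=> x y hx hy D hD hZ hm; case: (hD) => _ h _.
  by apply: h; [exact: hx | exact: hy].
- move=> c x hx D hD hZ hm; case: (hD) => _ _; apply; exact: hx.
Qed.

(** Needs no generators of [C]: let [D] be maximal among the saturated ideals above [Z] that do not
    contain [C]. If [q * c] were outside [D], enlarging [D] by it would capture [c], so
    [w c = d + r q c] with [w] outside [Q]; as [w - r q] is outside [Q] too, [c] is in [D] after
    all. So [D] contains [Q C + Z], hence [C]. *)
Lemma nakayama Q C Z : is_prime_ideal Q -> is_ideal Z -> saturated Q Z ->
  psub C (satur Q (mul_add_ideal Q C Z)) -> psub C Z.
Proof.
move=> hQ hZ hZs hC; apply: contrapT => hn.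
have [D [[hD hDs hCD] hZD hmax]] := noetherian_max noethB
  (F := fun D => [/\ is_ideal D, saturated Q D & ~ psub C D])
  (fun D h => let: And3 h' _ _ := h in h') (And3 hZ hZs hn).
have big c : ~ D c -> psub C (satur Q (adjoin D c)).
  move=> hc; apply: contrapT => hn'; apply: hc.
  have hA := adjoin_ideal c hD.
  apply: (hmax (satur Q (adjoin D c))).
  - split=> //; [exact: satur_ideal | exact: satur_saturated].
  - exact: psub_trans (@adjoin_sub _ _ _) (satur_sub hQ).
  - by apply: satur_sub => //; exact: adjoin_in.
apply: hCD => x hx; apply: (satur_min hDs _ (hC x hx)) => y; apply=> //.
move=> q c hq hc; apply: contrapT => hqc.
have [w [hw [d [r [hd e]]]]] := big _ hqc c hc.
apply: hqc; case: (hD) => _ _; apply; apply: (hDs (w - r * q)).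
  move=> h; apply: hw; have -> : w = (w - r * q) + r * q by ring.
  by case: (hQ) => -[_ hDq hMq] _ _; apply: hDq => //; exact: hMq.
by have -> : (w - r * q) * c = d by rewrite mulrBl e; ring.
Qed.

(* [Q / J0] is the only prime of the localisation of [B / J0] at [Q], so this localisation is Artinian. *)
Lemma descending_chain Q J0 (C : nat -> B -> Prop) :
  is_prime_ideal Q -> is_ideal J0 ->
  (forall Q', is_prime_ideal Q' -> psub J0 Q' -> psub Q' Q -> psub Q Q') ->
  (forall n, is_ideal (C n)) -> (forall n, psub (C n.+1) (C n)) ->
  exists n0, forall n, (n0 <= n)%N -> forall x, C n x ->
    exists w c j, [/\ ~ Q w, C n.+1 c, J0 j & w * x = c + j].
Proof.
move=> hQ hJ0 hmin hC hCd.
have hCm m n : (m <= n)%N -> psub (C n) (C m).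
  elim: n => [|n IH]; first by rewrite leqn0 => /eqP -> x.
  rewrite leq_eqVlt => /predU1P [-> x //|]; rewrite ltnS => /IH.
  exact: psub_trans (hCd n).
pose ok J := exists n0, forall n, (n0 <= n)%N -> forall x, C n x ->
    exists w c j, [/\ ~ Q w, C n.+1 c, J j & w * x = c + j].
apply: contrapT => hn.
have [J [[hJ hJn] hJ0J hmax]] := noetherian_max noethB
  (F := fun J => is_ideal J /\ ~ ok J) (fun J h => proj1 h) (conj hJ0 hn).
have [hQ1 hQM] := prime_compl hQ.
have hJs : saturated Q J.
  move=> w x hw hwx; apply: contrapT => hx; apply: hx.
  have hS : is_ideal (satur Q J) by exact: satur_ideal.
  apply: (hmax (satur Q J)); last by exists w.
    split=> // -[n0 hn0]; apply: hJn; exists n0 => n /hn0 h y /h.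
    move=> [w1 [c [j [h1 h2 [w2 [h3 h4]] e]]]].
    exists (w2 * w1), (w2 * c), (w2 * j); split=> //; first exact: hQM.
      by case: (hC n.+1) => _ _; apply.
    by rewrite -mulrA e mulrDr.
  exact: satur_sub.
(* If [J] contains [Q], the local quotient is a field or zero, and modulo [J] the chain is locally
   either zero from some index on or everything. *)
have [hQJ|hQJ] := EM (psub Q J).
  case: (EM (exists n, psub (C n) Q)) => [[n0 h0]|h0].
    apply: hJn; exists n0 => n hn' x hx; exists 1, 0, x.
    split=> //; last by rewrite mul1r add0r.
      by case: (hC n.+1).
    by apply: hQJ; apply: h0; exact: hCm hn' _ hx.
  apply: hJn; exists 0%N => n _ x _.
  have [w [hw hwQ]] : exists w, C n.+1 w /\ ~ Q w.
    apply: contrapT => hn'; apply: h0; exists n.+1 => w hw.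
    by apply: contrapT => hwQ; apply: hn'; exists w.
  exists w, (w * x), 0; split=> //; first exact: ideal_mulr.
    by case: hJ.
  by rewrite addr0.
(* A socle element: a maximal one among the annihilators modulo [J] of elements outside [J] is
   prime, lies in [Q] because [J] is saturated, and therefore contains [Q] by minimality. *)
have [x [hx hxQ]] : exists x, ~ J x /\ forall q, Q q -> J (q * x).
  have [z [hz hzJ]] : exists z, Q z /\ ~ J z.
    apply: contrapT => hno; apply: hQJ => z hz; apply: contrapT => hzJ.
    by apply: hno; exists z.
  have ann_ideal y : is_ideal (fun t => J (t * y)).
    case: (hJ) => h0 hD hM; split.
    - by rewrite mul0r.
    - by move=> s t; rewrite mulrDl; exact: hD.
    - by move=> s t; rewrite -mulrA; exact: hM.
  have [A [[y [hy ->]] _ hAmax]] := noetherian_max noethB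
    (F := fun A => exists y, ~ J y /\ A = (fun t => J (t * y)))
    (J0 := fun t => J (t * z))
    (fun A h => let: ex_intro y (conj _ e) := h in
       eq_ind_r _ (ann_ideal y) e) (ex_intro _ z (conj hzJ erefl)).
  have hAp : is_prime_ideal (fun t => J (t * y)).
    split; first exact: ann_ideal; first by rewrite mul1r.
    move=> s t hst; apply: contrapT => /not_orP [hs ht]; apply: ht.
    apply: (hAmax (fun u => J (u * (s * y)))).
    - by exists (s * y).
    - by move=> u hu; rewrite mulrCA; case: (hJ) => _ _; apply.
    - by rewrite mulrA (mulrC t).
  exists y; split=> // q hq.
  apply: (hmin _ hAp) => //.
  - by move=> u /hJ0J hu; exact: ideal_mulr.
  - by move=> u hu; apply: contrapT => huQ; apply: hy; exact: hJs huQ hu.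
have [n0 hn0] : ok (adjoin J x).
  apply: contrapT => hk; apply: hx; apply: (hmax (adjoin J x)).
  - by split=> //; exact: adjoin_ideal.
  - exact: adjoin_sub.
  - exact: adjoin_in.
(* Locally [x] spans a line over [J]. If every [C n] reaches it, the [x]-component left over by the
   induction can be corrected inside the next [C n]; otherwise, from some index on, its coefficient
   lies in [Q] and the component vanishes modulo [J]. *)
pose reach n := exists w c j, [/\ ~ Q w, C n c, J j & w * x = c + j].
case: (EM (exists n, ~ reach n)) => [[n1 hn1]|hr]; last first.
  apply: hJn; exists n0 => n /hn0 h y /h [w [c [_ [hw hc [j [r [hj ->]]] e]]]].
  have [w' [c' [j' [hw' hc' hj' e']]]] : reach n.+1.
    by apply: contrapT => hk; apply: hr; exists n.+1.
  case: (hC n.+1) => _ hD hM; case: (hJ) => _ hDJ hMJ.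
  exists (w' * w), (w' * c + r * c'), (w' * j + r * j'); split.
  - exact: hQM.
  - by apply: hD; exact: hM.
  - by apply: hDJ; exact: hMJ.
  - rewrite -mulrA e; transitivity (w' * c + w' * j + r * (w' * x)); first by ring.
    by rewrite e'; ring.
apply: hJn; exists (maxn n0 n1) => n; rewrite geq_max => /andP [h0 h1] y hy.
have [w [c [_ [hw hc [j [r [hj ->]]] e]]]] := hn0 n h0 y hy.
case: (EM (Q r)) => hr.
  exists w, c, (j + r * x); split=> //; case: (hJ) => _ hD _; apply: hD => //.
  exact: hxQ.
case: hn1; exists r, (w * y - c), (- j); split=> //; last by rewrite e; ring.
  apply: ideal_sub => //.
    by case: (hC n1) => _ _; apply; exact: hCm h1 _ hy.
  exact: hCm h1 _ (hCd _ _ hc).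
exact: ideal_opp.
Qed.

(** The symbolic powers of [P / Z], saturated anew after each multiplication by [P]. *)
Fixpoint symbolic_power P Z n : B -> Prop :=
  if n is n'.+1 then satur P (mul_add_ideal P (symbolic_power P Z n') Z)
  else fun=> True.

(* The theorem for the domain [B / P0], phrased with ideals of [B]. *)
Lemma principal_ideal_theorem P0 P Q a :
  is_prime_ideal P0 -> is_prime_ideal P -> is_prime_ideal Q ->
  ssub P0 P -> ssub P Q -> Q a ->
  ~ (forall Q', is_prime_ideal Q' -> psub (adjoin P0 a) Q' -> psub Q' Q -> psub Q Q').
Proof.
move=> hP0 hP hQ [hP0P [b [hb hb0]]] [hPQ [q [hq hqP]]] ha hmin.
have hP0i := prime_ideal hP0.
have haP : ~ P a.
  move=> haP; apply: hqP; apply: (hmin P) hq => //.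
  by apply: adjoin_min => //; exact: prime_ideal.
pose C := symbolic_power P P0.
have hC n : is_ideal (C n).
  by case: n => [|n]; [split | apply: satur_ideal => //; exact: mul_add_is_ideal].
have hCd n : psub (C n.+1) (C n).
  elim: n => [|n IH] x //= [w [hw h]]; exists w; split=> // D hD hZ hm.
  apply: h => // p c hp hc; apply: hm => //; exact: IH.
have hCP n : saturated P (C n).
  by case: n => [|n] //; exact: satur_saturated.
have hCP0 n : psub P0 (C n).
  case: n => [|n] // x hx; exists 1; rewrite mul1r; split; first by case: hP.
  by move=> D _ h _; exact: h.
have [n hn] := descending_chain hQ (adjoin_ideal a hP0i) hmin hC hCd.
(* In [w x = c + j + r a] the coefficient [r] lies in [C n], because [a] is outside [P] and [C n] is
   saturated at [P]. So locally at [Q] the ideal [C n] is [C n.+1 + Q C n], and Nakayama applies. *)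
have h1 : psub (C n) (C n.+1).
  apply: (nakayama hQ) => //.
    by move=> w x hw; apply: hCP => /hPQ.
  move=> x /[dup] hx /(hn n (leqnn n)) [w [c [_ [hw hc [j [r [hj ->]]] e]]]].
  exists w; split=> //; rewrite e => D hD hZ hm; case: (hD) => _ hDD _.
  apply: (hDD); first exact: hZ.
  apply: hDD; first by apply: hZ; exact: hCP0.
  rewrite mulrC; apply: hm => //.
  apply: (hCP n a) => //; have -> : a * r = w * x - c - j by rewrite e; ring.
  apply: ideal_sub => //; last exact: hCP0.
  apply: ideal_sub => //; last exact: hCd.
  by case: (hC n) => _ _; apply.
(* Two equal consecutive symbolic powers are the hypothesis of Nakayama at [P], so [C n] vanishes
   modulo [P0]; but it contains [b ^+ n] for an element [b] of [P] outside [P0]. *)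
have h2 : psub (C n) P0.
  by apply: (nakayama hP) => //; apply: prime_saturated.
apply: hb0; apply: (@prime_exp _ P0 b n) => //; apply: h2.
elim: (n) => [|m IH] //=; exists 1; rewrite mul1r; split; first by case: hP.
by move=> D _ _ h; rewrite exprS; exact: h.
Qed.

(** A prime minimal over [P0 + (a)] below [P2] cannot be [P2] itself, by the principal ideal
    theorem: [P1] lies strictly between [P0] and [P2]. *)
Lemma prime_insertion P0 P1 P2 a :
  is_prime_ideal P0 -> is_prime_ideal P1 -> is_prime_ideal P2 ->
  ssub P0 P1 -> ssub P1 P2 -> P2 a ->
  exists P, [/\ is_prime_ideal P, P a, ssub P0 P & ssub P P2].
Proof.
move=> h0 h1 h2 h01 h12 ha.
case: (EM (P0 a)) => ha0.
  by exists P1; split=> //; case: h01 => h _; exact: h.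
have hA := adjoin_ideal a (prime_ideal h0).
have h02 : psub P0 P2 := psub_trans (proj1 h01) (proj1 h12).
have hA2 := adjoin_min (prime_ideal h2) h02 ha.
have [Q [hQ hAQ hQ2 hmin]] := minimal_prime noethB hA h2 hA2.
have hQa : Q a by apply: hAQ; apply: adjoin_in; exact: prime_ideal.
exists Q; split=> //.
  by split; [exact: psub_trans (@adjoin_sub _ _ _) hAQ | exists a].
split=> //; apply: contrapT => hn.
have h2Q : psub P2 Q.
  by move=> x hx; apply: contrapT => hxQ; apply: hn; exists x.
apply: (principal_ideal_theorem h0 h1 h2 h01 h12 ha) => Q' hQ' hAQ' hQ'2.
by apply: (psub_trans h2Q); apply: hmin => //; exact: psub_trans hQ'2 h2Q.
Qed.

End KrullHauptidealsatz.

(** * Prime chains in a polynomial ring *)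

Section Chains.
Variable B : comNzRingType.
Implicit Types (P Q : B -> Prop).

(** Unlike [prime_chain] this exposes both ends: the later bounds are conditions on the first or the
    last prime, and chains get prolonged at either end. *)
Inductive pchain : nat -> (B -> Prop) -> (B -> Prop) -> Prop :=
| pchain0 P : is_prime_ideal P -> pchain 0 P P
| pchainS l P P' Q : is_prime_ideal P -> ssub P P' -> pchain l P' Q -> pchain l.+1 P Q.

Lemma pchain_first l P Q : pchain l P Q -> is_prime_ideal P. Proof. by case. Qed.

Lemma pchain_last l P Q : pchain l P Q -> is_prime_ideal Q. Proof. by elim. Qed.

Lemma pchain_sub l P Q : pchain l P Q -> psub P Q.
Proof.
by elim=> [?? ? //|l' P1 P' Q' _ [h _] _ h']; exact: psub_trans h h'.
Qed.

Lemma pchain_rcons l P Q Q' : pchain l P Q -> is_prime_ideal Q' -> ssub Q Q' ->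
  pchain l.+1 P Q'.
Proof.
elim=> [P1 h1 hQ' h|l' P1 P' Q1 h1 h2 _ IH hQ' h].
  by apply: (pchainS h1 h); exact: pchain0.
by apply: (pchainS h1 h2); exact: IH.
Qed.

Lemma pchain_prime_chain l P Q : pchain l P Q -> exists C, prime_chain l C /\ C 0%N = P.
Proof.
elim=> [P1 h1|l' P1 P' Q1 h1 h2 _ [C [[hC hC'] e]]].
  by exists (fun=> P1); split=> //; split.
exists (fun k => if k is k'.+1 then C k' else P1); split=> //; split.
  by case=> [|k] //; exact: hC.
by case=> [|k] /=; [rewrite e | exact: hC'].
Qed.

Lemma psub_ssub P Q : psub P Q -> P <> Q -> ssub P Q.
Proof.
move=> h hn; split=> //; apply: contrapT => hno; apply: hn.
apply/funext => x; apply/propext; split; first exact: h.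
by move=> hx; apply: contrapT => hx'; apply: hno; exists x.
Qed.

End Chains.

(** [G] passes to smaller primes, so it has to be checked only at the top of the chain. *)
Lemma pchain_map (B B' : comNzRingType) (F : (B -> Prop) -> (B' -> Prop))
    (G : (B -> Prop) -> Prop) l P Q :
  (forall P, is_prime_ideal P -> G P -> is_prime_ideal (F P)) ->
  (forall P P', is_prime_ideal P -> is_prime_ideal P' -> G P -> G P' ->
    ssub P P' -> ssub (F P) (F P')) ->
  (forall P P', psub P P' -> G P' -> G P) ->
  pchain l P Q -> G Q -> pchain l (F P) (F Q).
Proof.
move=> hF hs hG; elim=> [P1 h1 hg|l' P1 P' Q1 h1 h2 hc IH hg].
  by apply: pchain0; exact: hF.
have hg' : G P' := hG _ _ (pchain_sub hc) hg.
have hg1 : G P1 := hG _ _ (proj1 h2) hg'.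
apply: (pchainS (hF _ h1 hg1)); last exact: IH.
by apply: hs => //; exact: pchain_first hc.
Qed.

Section Comap.
Variables (B C : comNzRingType) (f : B -> C).
Hypotheses (f0 : f 0 = 0) (f1 : f 1 = 1) (fD : {morph f : x y / x + y}).
Hypothesis fM : {morph f : x y / x * y}.

(** [f] is a bare function with the four laws rather than a packaged morphism, because it will be a
    composite through [to_rees_loc], whose laws are available for Rees elements only. *)
Lemma comap_ideal (J : C -> Prop) : is_ideal J -> is_ideal (fun x => J (f x)).
Proof.
case=> h0 hD hM; split; first by rewrite f0.
  by move=> x y; rewrite fD; exact: hD.
by move=> x y; rewrite fM; exact: hM.
Qed.

Lemma comap_prime (P : C -> Prop) : is_prime_ideal P -> is_prime_ideal (fun x => P (f x)).
Proof.
case=> hP h1 hp; split; [exact: comap_ideal | by rewrite f1 |].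
by move=> x y; rewrite fM; exact: hp.
Qed.

End Comap.

Lemma zero_prime (D : idomainType) : is_prime_ideal (fun x : D => x = 0).
Proof.
split; first split=> //.
- by move=> x y -> ->; rewrite addr0.
- by move=> a x ->; rewrite mulr0.
- by apply/eqP; exact: oner_neq0.
- by move=> a b /eqP; rewrite mulf_eq0 => /orP [] /eqP; [left | right].
Qed.

Section PolynomialRing.
Variable C : comNzRingType.
Implicit Types (f g h r : {poly C}) (q : C -> Prop) (Q : {poly C} -> Prop).

Lemma size_cancel_top f g n : (size f <= n.+1)%N -> (size g <= n.+1)%N ->
  f`_n = g`_n -> (size (f - g)%R <= n)%N.
Proof.
move=> hf hg e; apply/leq_sizeP => j; rewrite leq_eqVlt => /predU1P [<-|hj].
  by rewrite coefB e subrr.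
by rewrite coefB !nth_default ?subrr ?(leq_trans hf hj) ?(leq_trans hg hj).
Qed.

(** * Hilbert's basis theorem for the ascending chain condition *)

Section HilbertBasis.
Hypothesis noethC : noetherian C.

Theorem hilbert_basis : noetherian {poly C}.
Proof.
move=> J hJ hJS.
(* Leading coefficients in degree [n] of members of [J k], zero included; this ideal grows with [k]
   and with [n]. *)
pose L k n c := exists f, [/\ J k f, (size f <= n.+1)%N & f`_n = c].
have hJm k k' : (k <= k')%N -> psub (J k) (J k').
  elim: k' => [|k' IH]; first by rewrite leqn0 => /eqP -> x.
  rewrite leq_eqVlt => /predU1P [-> x //|]; rewrite ltnS => /IH h x /h.
  exact: hJS.
have hL k n : is_ideal (L k n).
  case: (hJ k) => h0 hD hM; split.
  - by exists 0; rewrite size_poly0 coef0.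
  - move=> x y [f [hf hs <-]] [g [hg hs' <-]]; exists (f + g); split.
    + exact: hD.
    + by apply: (leq_trans (size_polyD _ _)); rewrite geq_max hs.
    + by rewrite coefD.
  - move=> a x [f [hf hs <-]]; exists (a%:P * f); split; first exact: hM.
      by rewrite mul_polyC; apply: leq_trans (size_scale_leq _ _) hs.
    by rewrite mul_polyC coefZ.
have hLk k k' n c : (k <= k')%N -> L k n c -> L k' n c.
  by move=> hk [f [hf hs e]]; exists f; split=> //; exact: hJm hk _ hf.
have hLn k n n' c : (n <= n')%N -> L k n c -> L k n' c.
  move=> /subnKC <- [f [hf hs <-]]; exists ('X^(n' - n) * f); split.
  - by case: (hJ k) => _ _; apply.
  - apply: (leq_trans (size_polyMleq _ _)); rewrite size_polyXn; lia.
  - rewrite coefXnM ifN; first by congr (f`_ _); lia.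
    by rewrite -leqNgt leq_addl.
have [||N0 hN0] := noethC (Ik := fun k => L k k).
- by move=> k.
- by move=> k c /(hLk k k.+1 k c (leqnSn _)); exact: hLn.
have stab n : exists m, forall k, (m <= k)%N -> forall c, L k n c <-> L m n c.
  by apply: noethC => // k c; exact: hLk.
have [N hN] := choice stab.
(* Once the diagonal [L k k] is constant, from [N0] on, all degrees [n >= N0] are settled at once;
   only the finitely many smaller degrees need a bound of their own. *)
pose M := maxn N0 (\max_(n < N0) N n).
have hM k n c : (M <= k)%N -> L k n c -> L M n c.
  rewrite /M => hk hc; have [hn|hn] := ltnP n N0.
    have hNM : (N n <= M)%N.
      by apply: leq_trans (leq_maxr _ _); rewrite (bigD1 (Ordinal hn)) //= leq_maxl.
    by apply/(hN n M hNM)/(hN n k (leq_trans hNM hk)).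
  apply: (hLn _ _ _ _ hn); apply: (hLk _ _ _ _ (leq_maxl _ _)).
  apply/(hN0 (maxn k n)); first by lia.
  by apply: (hLn _ n); [exact: leq_maxr | apply: (hLk k) => //; exact: leq_maxl].
exists M => k hk x; split; last exact: hJm hk x.
have [s] := ubnP (size x); elim: s => // s IH in x *; rewrite ltnS => hs hx.
case: s => [|s] in IH hs *.
  by move: hs; rewrite leqn0 size_poly_eq0 => /eqP ->; case: (hJ M).
have [f [hf hfs e]] : L M s x`_s by apply: (hM k) => //; exists x.
have -> : x = (x - f) + f by rewrite subrK.
case: (hJ M) => _ hD _; apply: hD => //.
apply: IH; first by rewrite ltnS; exact: size_cancel_top.
by apply: ideal_sub => //; exact: hJm hk _ hf.
Qed.

End HilbertBasis.

(** The bound on the size of the quotient is what [no_three_primes_over] exploits: a long quotient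
    forces a constant divisor. The alternative [h = 0] covers a dividend shorter than the
    divisor. *)
Lemma pseudo_division f g : f != 0 -> exists k h r,
  [/\ (lead_coef f) ^+ k *: g = h * f + r, (size r < size f)%N
    & h = 0 \/ (size h + size f <= (size g).+1)%N].
Proof.
move=> hf; have [s] := ubnP (size g); elim: s => // s IH in g *; rewrite ltnS => hs.
have [hlt|hge] := ltnP (size g) (size f).
  by exists 0%N, 0, g; rewrite expr0 scale1r mul0r add0r; split=> //; left.
have hf0 : (0 < size f)%N by rewrite size_poly_gt0.
set c := lead_coef f; pose d := (size g - size f)%N.
pose m := (lead_coef g)%:P * 'X^d : {poly C}.
have sm : (size m <= d.+1)%N.
  by rewrite /m mul_polyC; apply: leq_trans (size_scale_leq _ _) _; rewrite size_polyXn.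
have hsz : (size (c *: g - m * f)%R <= (size g).-1)%N.
  apply: size_cancel_top.
  - by rewrite (leq_trans (size_scale_leq _ _)) //; lia.
  - by rewrite (leq_trans (size_polyMleq _ _)) // ; rewrite /d in sm; lia.
  - rewrite coefZ /m -mulrA coefCM coefXnM ifN; last by rewrite /d -leqNgt; lia.
    rewrite mulrC; congr (_ * _); rewrite /c lead_coefE; congr (f`_ _).
    by rewrite /d; lia.
have [|k [h [r [e hr hh]]]] := IH (c *: g - m * f); first by lia.
exists k.+1, (h + c ^+ k *: m), r; split=> //.
  rewrite exprS mulrC -scalerA -(subrK (m * f) (c *: g)) scalerDr e mulrDl scalerAl.
  by rewrite addrAC.
right; have hd : (d.+1 + size f <= (size g).+1)%N by rewrite /d; lia.
have hm : (size (c ^+ k *: m)%R <= d.+1)%N := leq_trans (size_scale_leq _ _) sm.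
case: hh => [->|hh]; first by rewrite add0r; lia.
have : (size (h + c ^+ k *: m)%R <= maxn (size h) (size (c ^+ k *: m)%R))%N.
  exact: size_polyD.
by lia.
Qed.

Definition extension q : {poly C} -> Prop := fun f => forall i, q f`_i.

Definition contraction Q : C -> Prop := fun c => Q c%:P.

Lemma contraction_prime Q : is_prime_ideal Q -> is_prime_ideal (contraction Q).
Proof.
apply: (comap_prime (f := polyC)); [by [] | by [] | exact: polyCD | exact: polyCM].
Qed.

Lemma extension_contraction Q : is_ideal Q -> psub (extension (contraction Q)) Q.
Proof.
move=> hQ f hf; rewrite -[f]coefK poly_def; apply: ideal_bigsum => // i _.
by rewrite -mul_polyC; apply: ideal_mulr => //; exact: hf.
Qed.

Lemma extension_ideal q : is_ideal q -> is_ideal (extension q).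
Proof.
move=> hq; case: (hq) => h0 hD hM; split.
- by move=> i; rewrite coef0.
- by move=> f g hf hg i; rewrite coefD; exact: hD.
- move=> f g hg i; rewrite coefM; apply: ideal_bigsum => // j _; exact: hM.
Qed.

Lemma extension_scale q c f : is_prime_ideal q -> ~ q c -> extension q (c *: f) ->
  extension q f.
Proof.
by move=> [_ _ hM] hc h i; move: (h i); rewrite coefZ => /hM [].
Qed.

(** Substitute for a generator of [Q] over the fraction field of [C / q]. If its leading coefficient
    were in [q], dropping the leading term would give a shorter element outside the extension. *)
Lemma least_size_outside_extension Q q : is_ideal Q -> is_ideal q ->
  (forall c, q c -> Q c%:P) ->
  (exists f, Q f /\ ~ extension q f) ->
  exists f, [/\ Q f, ~ extension q f, ~ q (lead_coef f) &
    forall g, Q g -> (size g < size f)%N -> extension q g].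
Proof.
move=> hQ hq hqQ [f0 [h0 h0']].
pose p n := `[< exists f, [/\ Q f, ~ extension q f & size f = n] >].
have ex : exists n, p n by exists (size f0); apply/asboolP; exists f0.
case: (ex_minnP ex) => n /asboolP [f [hf hfq hn]] hmin.
have hm g : Q g -> (size g < size f)%N -> extension q g.
  move=> hg hs; apply: contrapT => hgq.
  suff: (n <= size g)%N by rewrite leqNgt -hn hs.
  by apply: hmin; apply/asboolP; exists g.
have f0n : f != 0.
  by apply/eqP => e; apply: hfq => i; rewrite e coef0; case: hq.
exists f; split=> // hl; apply: hfq.
pose m := (lead_coef f)%:P * 'X^((size f).-1) : {poly C}.
have hmq : extension q m.
  by move=> i; rewrite /m coefCM; exact: ideal_mulr.
have hsz : (size (f - m)%R < size f)%N.
  rewrite -[X in (_ < X)%N]prednK ?size_poly_gt0 // ltnS; apply: size_cancel_top.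
  - by rewrite prednK // size_poly_gt0.
  - rewrite /m mul_polyC; apply: leq_trans (size_scale_leq _ _) _.
    by rewrite size_polyXn.
  - by rewrite /m coefCM coefXn eqxx mulr1 lead_coefE.
have -> : f = (f - m) + m by rewrite subrK.
case: (extension_ideal hq) => _ hD _; apply: hD => //; apply: hm => //.
by apply: ideal_sub => //; apply: ideal_mulr => //; exact: hqQ.
Qed.

(** The fibre over [q] is the spectrum of a polynomial ring in one variable over a field.
    Concretely, [f2] of least size in [Q2] pseudo-divides [Q2] modulo [q], so dividing [f] in [Q1]
    puts [h * f2] into [Q1]: [h] in [Q1] contradicts the choice of [f] unless [f2] is constant, and
    [f2] in [Q1] forces [Q2] into [Q1]. *)
Lemma no_three_primes_over Q0 Q1 Q2 :
  is_prime_ideal Q0 -> is_prime_ideal Q1 -> is_prime_ideal Q2 ->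
  ssub Q0 Q1 -> ssub Q1 Q2 -> psub (contraction Q2) (contraction Q0) -> False.
Proof.
move=> h0 h1 h2 [h01 [x [hx1 hx0]]] [h12 [y [hy2 hy1]]] hc.
pose q := contraction Q0.
have hq : is_prime_ideal q by exact: contraction_prime.
have hqi := prime_ideal hq.
have qexp c k : ~ q c -> ~ q (c ^+ k) by move=> h /(prime_exp hq).
have hqQ0 : psub (extension q) Q0 by exact: extension_contraction (prime_ideal h0).
have [|f [hf hfq hfl hfm]] := least_size_outside_extension (prime_ideal h1) hqi
  (fun c hc => h01 _ hc).
  by exists x; split=> // /hqQ0.
have [|f2 [hf2 hf2q hf2l hf2m]] := least_size_outside_extension (prime_ideal h2) hqi
  (fun c hc => h12 _ (h01 _ hc)).
  by exists y; split=> // /hqQ0 /h01.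
have f2n : f2 != 0.
  by apply/eqP => e; apply: hf2l; rewrite e lead_coef0; case: hqi.
have Q2r g k h r : Q2 g -> lead_coef f2 ^+ k *: g = h * f2 + r ->
    (size r < size f2)%N -> extension q r.
  move=> hg e hr; apply: hf2m => //.
  have -> : r = lead_coef f2 ^+ k *: g - h * f2 by rewrite e addrC addKr.
  apply: ideal_sub; first exact: prime_ideal.
    by rewrite -mul_polyC; case: h2 => -[_ _ hM] _ _; exact: hM.
  by case: h2 => -[_ _ hM] _ _; exact: hM.
have lead1 : ~ Q1 (lead_coef f2)%:P by move=> /h12 /hc.
have [k [h [r [e hr hh]]]] := pseudo_division f f2n.
have hrq := Q2r f k h r (h12 _ hf) e hr.
have hhf : Q1 (h * f2).
  have -> : h * f2 = lead_coef f2 ^+ k *: f - r by rewrite e addrK.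
  apply: ideal_sub; first exact: prime_ideal.
    by rewrite -mul_polyC; case: h1 => -[_ _ hM] _ _; exact: hM.
  by apply: h01; exact: hqQ0.
case: (h1) => _ _ hM; case: (hM _ _ hhf) => [hh1|hf21].
- have hhq : ~ extension q h.
    move=> hhq; apply: hfq; apply: (extension_scale hq (qexp _ k hf2l)).
    rewrite e; case: (extension_ideal hqi) => _ hD _; apply: hD => //.
    exact: (ideal_mulr f2 (extension_ideal hqi) hhq).
  have hge : (size f <= size h)%N by rewrite leqNgt; apply/negP => /(hfm _ hh1).
  case: hh => [hh0|hh].
    by apply: hhq; rewrite hh0; case: (extension_ideal hqi).
  have hs : (size f2 <= 1)%N by lia.
  apply: hf2q => i; move: hf2; rewrite (size1_polyC hs) coefC => /hc hf2c.
  by case: ifP => _ //; case: hqi.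
- apply: hy1; have [k' [h' [r' [e' hr' _]]]] := pseudo_division y f2n.
  have : Q1 (lead_coef f2 ^+ k' *: y).
    rewrite e'; case: (h1) => -[_ hD hM1] _ _; apply: hD; first exact: hM1.
    by apply: h01; apply: hqQ0; exact: Q2r hy2 e' hr'.
  rewrite -mul_polyC => /hM [|//]; rewrite rmorphXn => h'1.
  by case: lead1; exact: prime_exp h'1.
Qed.

(** [prime_insertion] pushes [a] down the chain one prime at a time. *)
Lemma pchain_insertion Q0 Q l a : noetherian {poly C} -> pchain l.+1 Q0 Q -> Q a ->
  exists Q1, [/\ ssub Q0 Q1, Q1 a & pchain l Q1 Q].
Proof.
move=> noeth; elim: l Q0 => [|l IH] Q0 hc ha.
  inversion hc as [|l' P P' Q' h1 h2 h3 e1 e2 e3]; subst.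
  by inversion h3; subst; exists Q.
inversion hc as [|l' P P' Q' h1 h2 h3 e1 e2 e3]; subst.
have [Q2 [h12 hQ2 hcQ]] := IH _ h3 ha.
have [Q1 [hp h4 h5 h6]] := prime_insertion noeth h1 (pchain_first h3)
  (pchain_first hcQ) h2 h12 hQ2.
by exists Q1; split=> //; exact: pchainS hp h6 hcQ.
Qed.

(* Whenever the chain moves off the contraction [q0] of its first prime, the insertion lemma makes
   it do so at its very first step. *)
Lemma pchain_contraction l Q0 Q : noetherian C -> pchain l Q0 Q ->
  exists l', (l <= l'.+1)%N /\ pchain l' (contraction Q0) (contraction Q).
Proof.
move=> noeth; have noethX := hilbert_basis noeth.
elim: l Q0 => [|l IH] Q0 hc.
  exists 0%N; split=> //; inversion hc; subst.
  by apply: pchain0; exact: contraction_prime.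
have hp0 := pchain_first hc.
have hsub : psub (contraction Q0) (contraction Q) by move=> c; exact: pchain_sub hc _.
(* If both ends have the same contraction, the whole chain lies over one prime and has length at
   most one; only here is a step lost. *)
case: (EM (contraction Q0 = contraction Q)) => heq.
  case: l => [|l] in IH hc *.
    exists 0%N; split=> //; rewrite -heq.
    by apply: pchain0; exact: contraction_prime.
  exfalso; inversion hc as [|l1 P P' Q' h1 h2 h3 e1 e2 e3]; subst.
  inversion h3 as [|l2 P2 P2' Q2' h4 h5 h6 e1 e2 e3]; subst.
  apply: (no_three_primes_over h1 h4 (pchain_first h6) h2 h5).
  by rewrite heq => c; exact: pchain_sub h6 _.
have [_ [a [ha ha0]]] := psub_ssub hsub heq.
have [Q1 [h01 hQ1 hc1]] := pchain_insertion noethX hc ha.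
have [l' [hl hc']] := IH _ hc1.
exists l'.+1; split=> //.
apply: (pchainS (contraction_prime hp0) _ hc').
by split; [move=> c; case: h01 => h _; exact: h | exists a].
Qed.

End PolynomialRing.

(** * Stable range from prime chains *)

Section StableRange.
Variable B : comNzRingType.
Implicit Types (J P Q : B -> Prop).

Definition unimodular (T : finType) (D : pred T) (v : T -> B) :=
  exists b : T -> B, \sum_(i | D i) b i * v i = 1.

(** Bass' condition: a unimodular row with more than [k] entries can be shortened by adding
    multiples of its last entry [y] to the others. Indexing by a subset [D] lets it apply to rows
    and columns of a matrix with some positions left out. *)
Definition stable_range (k : nat) := forall (T : finType) (D : pred T) (v : T -> B) (y : B),
  (k <= #|D|)%N -> (exists b c, \sum_(i | D i) b i * v i + c * y = 1) ->
  exists t : T -> B, unimodular D (fun i => v i + t i * y).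

Lemma common_element_outside (s : seq (B -> Prop)) Q : is_prime_ideal Q ->
  (forall P, List.In P s -> is_prime_ideal P /\ ~ psub P Q) ->
  exists z, ~ Q z /\ forall P, List.In P s -> P z.
Proof.
move=> hQ; elim: s => [|P s IH] hs; first by exists 1; split=> //; case: hQ.
have [|z [hz hzs]] := IH; first by move=> P' hP'; apply: hs; right.
have [hP hPQ] : is_prime_ideal P /\ ~ psub P Q by apply: hs; left.
have [x [hx hxQ]] : exists x, P x /\ ~ Q x.
  apply: contrapT => hn; apply: hPQ => x hx; apply: contrapT => hxQ.
  by apply: hn; exists x.
exists (x * z); split; first by have [_ h] := prime_compl hQ; exact: h.
move=> P' [<-|hP']; first exact: (ideal_mulr z (prime_ideal hP) hx).
have [hP'p _] := hs P' (or_intror hP').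
by case: hP'p => -[_ _ hM] _ _; apply: hM; exact: hzs.
Qed.

(** A prime that contains another member of the list takes care of that member, so no other member
    may be assumed to lie in [Q]. Then some [z] outside [Q] lies in all the others, and adding
    [z * y] repairs [Q] without disturbing them. *)
Lemma prime_avoidance (s : seq (B -> Prop)) x y :
  (forall P, List.In P s -> is_prime_ideal P) ->
  exists t, forall P, List.In P s -> ~ P y -> ~ P (x + t * y).
Proof.
have [n] := ubnP (size s); elim: n s => // n IH [|Q L] hn hs.
  by exists 0 => P [].
have hQ : is_prime_ideal Q by apply: hs; left.
have hL P : List.In P L -> is_prime_ideal P by move=> h; apply: hs; right.
case: (EM (Q y)) => hQy.
  have [|t ht] := IH L _ hL; first by move: hn => /=; lia.
  by exists t => P [<- //|]; exact: ht.
case: (EM (exists Q', List.In Q' L /\ psub Q' Q)) => [[Q' [hQ' hQ'Q]]|hno].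
  have [L1 [L2 eL]] := List.in_split Q' L hQ'.
  have [||t ht] := IH (Q :: L1 ++ L2).
  - by move: hn; rewrite /= eL !size_cat /=; lia.
  - move=> P [<- //|/List.in_app_iff h]; apply: hL; rewrite eL.
    by apply/List.in_app_iff; case: h => h; [left | right; right].
  exists t => P [<-|]; first by apply: ht; left.
  rewrite eL => /List.in_app_iff [h|[<-|h]] hy.
  - by apply: ht => //; right; apply/List.in_app_iff; left.
  - by move=> /hQ'Q; apply: ht => //; left.
  - by apply: ht => //; right; apply/List.in_app_iff; right.
have [|t0 ht0] := IH L _ hL; first by move: hn => /=; lia.
case: (EM (Q (x + t0 * y))) => hQ0; last by exists t0 => P [<- //|]; exact: ht0.
have [|z [hz hzL]] := @common_element_outside L Q hQ.
  by move=> P hP; split; [exact: hL | move=> h; apply: hno; exists P].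
exists (t0 + z) => P [<- hy|hP hy].
  move=> h; have [_ hM] := prime_compl hQ; apply: (hM z y) => //.
  have -> : z * y = (x + (t0 + z) * y) - (x + t0 * y) by ring.
  by apply: ideal_sub => //; exact: prime_ideal.
move=> h; apply: (ht0 P hP hy); have hPi := prime_ideal (hL P hP).
have -> : x + t0 * y = (x + (t0 + z) * y) - z * y by ring.
by apply: ideal_sub => //; apply: ideal_mulr => //; exact: hzL.
Qed.

Variables (u : B) (e : nat).
Hypothesis noethB : noetherian B.
Hypothesis chains_closed : forall l P Q, pchain l P Q -> P u -> (l <= e)%N.
Hypothesis chains_open : forall l P Q, pchain l P Q -> ~ Q u -> (l <= e)%N.

(** General position: [t j] is chosen so that [v j + t j * y] avoids finitely many primes over the
    earlier entries, so a prime containing it lies strictly above one of these and the chain can be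
    prolonged downwards. The primes over [J + (u)] are avoided as well, so that a chain starting at
    a prime with [u] can be prolonged by another prime with [u]. *)
Lemma shorten_chains (T : finType) (v : T -> B) (y : B) (s : seq T) : uniq s ->
  exists t : T -> B, forall l P Q, pchain l P Q -> ~ Q y ->
    (forall j, j \in s -> P (v j + t j * y)) -> P u \/ ~ Q u -> (l + size s <= e)%N.
Proof.
elim: s => [_|j s IH /= /andP [hj /IH [t ht]]].
  exists (fun=> 0) => l P Q hc _ _ [hu|hu]; rewrite addn0.
    exact: chains_closed hc hu.
  exact: chains_open hc hu.
pose J x := forall D, is_ideal D -> (forall i, i \in s -> D (v i + t i * y)) -> D x.
have hJ : is_ideal J.
  split.
  - by move=> D [].
  - move=> a b ha hb D hD hi; case: (hD) => _ hDD _.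
    by apply: hDD; [exact: ha | exact: hb].
  - by move=> a b hb D hD hi; case: (hD) => _ _; apply; exact: hb.
have [s1 [hs1 hs1']] := finitely_many_primes noethB hJ.
have [s2 [hs2 hs2']] := finitely_many_primes noethB (adjoin_ideal u hJ).
have [|t1 ht1] := @prime_avoidance (s1 ++ s2) (v j) y.
  by move=> P /List.in_app_iff [/hs1|/hs2] [].
exists (fun i => if i == j then t1 else t i) => l P Q hc hQy hv hu.
have hP := pchain_first hc; have hPi := prime_ideal hP; have hPQ := pchain_sub hc.
have hJP : psub J P.
  move=> x; apply=> // i hi.
  have := hv i; rewrite inE hi orbT => /(_ isT); case: eqP => // e'.
  by move: hj; rewrite -e' hi.
have hvj := hv j; rewrite eqxx in hvj; have {}hvj := hvj (mem_head _ _).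
suff [Q1 [hQ1 hQ1P hJQ1 hQ1in hu']] : exists Q1, [/\ is_prime_ideal Q1, psub Q1 P,
    psub J Q1, List.In Q1 (s1 ++ s2) & Q1 u \/ ~ Q u].
  rewrite addnS -addSn; apply: (ht _ Q1 Q) => //.
    apply: (pchainS hQ1 _ hc); split=> //; exists (v j + t1 * y); split=> //.
    by apply: ht1 => // /hQ1P /hPQ.
  by move=> i hi; apply: hJQ1 => D hD; apply.
case: hu => hu.
  have [Q1 [hQ1 hQ1P]] := hs2' P hP (adjoin_min hPi hJP hu).
  have [h1 h2] := hs2 _ hQ1; exists Q1; split=> //.
  - exact: psub_trans (@adjoin_sub _ _ _) h2.
  - by apply/List.in_app_iff; right.
  - by left; apply: h2; exact: adjoin_in.
have [Q1 [hQ1 hQ1P]] := hs1' P hP hJP.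
have [h1 h2] := hs1 _ hQ1; exists Q1; split=> //; last by right.
by apply/List.in_app_iff; left.
Qed.

(** Only chains inside one of the two parts of the spectrum, [u] in all primes or [u] in none, are
    bounded. This is enough because a failure of unimodularity is witnessed by a single prime
    without [y], a chain of length 0, which belongs to one part. *)
Theorem stable_range_of_chains : stable_range e.+1.
Proof.
move=> T D v y hD [b [c hb]].
have [t ht] := shorten_chains v y (enum_uniq D).
exists t; pose w i := v i + t i * y.
pose K x := exists b' : T -> B, \sum_(i | D i) b' i * w i = x.
have hK : is_ideal K.
  split.
  - by exists (fun=> 0); rewrite big1 // => i _; rewrite mul0r.
  - move=> x x' [b1 <-] [b2 <-]; exists (fun i => b1 i + b2 i).
    by rewrite -big_split; apply: eq_bigr => i _; rewrite mulrDl.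
  - move=> a x [b1 <-]; exists (fun i => a * b1 i).
    by rewrite big_distrr; apply: eq_bigr => i _ /=; rewrite mulrA.
have hKw i : D i -> K (w i).
  move=> hi; exists (fun j => if j == i then 1 else 0).
  rewrite (bigD1 i) //= eqxx mul1r big1 ?addr0 // => j /andP [_ /negbTE ->].
  by rewrite mul0r.
apply: contrapT => h1.
have [P [hP hKP]] := prime_above noethB hK h1.
have hPi := prime_ideal hP.
case: (EM (P y)) => hy.
  case: hP => _ hP1 _; apply: hP1; rewrite -hb.
  case: (hPi) => _ hPD hPM; apply: hPD; last exact: hPM.
  apply: ideal_bigsum => // i hi; apply: (hPM).
  have -> : v i = w i - t i * y by rewrite /w; ring.
  by apply: ideal_sub => //; [apply: hKP; exact: hKw | exact: hPM].
have hle : (size (enum D) <= e)%N.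
  apply: (ht 0%N P P (pchain0 hP) hy _ (EM (P u))) => j; rewrite mem_enum => hj.
  by apply: hKP; exact: hKw.
by move: hD; rewrite cardE leqNgt ltnS hle.
Qed.

End StableRange.

(** * Groups generated by elementary matrices *)

Section ElementaryGroups.
Variables (T : comNzRingType) (N : nat).
Implicit Types (S : 'I_N -> 'I_N -> T -> Prop) (A : 'M[T]_N) (i j k : 'I_N)
  (c : 'cV[T]_N) (r : 'rV[T]_N).

Definition elm i j (a : T) : 'M[T]_N := 1%:M + a *: delta_mx i j.

(** [S] restricts positions and entries, so one definition covers the full elementary groups, the
    block and affine subgroups, and generators with prescribed denominators or divisors. *)
Inductive Egen S : 'M[T]_N -> Prop :=
| Egen1 : Egen S 1%:M
| EgenM A i j a : Egen S A -> i != j -> S i j a -> Egen S (A *m elm i j a).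

Lemma Egen_elm S i j a : i != j -> S i j a -> Egen S (elm i j a).
Proof. by move=> h h'; rewrite -[elm _ _ _]mul1mx; apply: EgenM => //; exact: Egen1. Qed.

Lemma Egen_mul S A A' : Egen S A -> Egen S A' -> Egen S (A *m A').
Proof.
move=> hA; elim=> [|A1 i j a _ IH h h']; first by rewrite mulmx1.
by rewrite mulmxA; exact: EgenM.
Qed.

Lemma Egen_mono S S' A : (forall i j a, i != j -> S i j a -> S' i j a) ->
  Egen S A -> Egen S' A.
Proof.
move=> h; elim=> [|A1 i j a _ IH h1 h2]; first exact: Egen1.
by apply: EgenM => //; exact: h.
Qed.

Lemma Egen_ind_left S (P : 'M[T]_N -> Prop) : P 1%:M ->
  (forall A i j a, i != j -> S i j a -> P A -> P (elm i j a *m A)) ->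
  forall A, Egen S A -> P A.
Proof.
move=> h1 hM A hA; suff: forall A', P A' -> P (A *m A').
  by move=> /(_ _ h1); rewrite mulmx1.
elim: hA => [A'|A1 i j a _ IH h h' A' hA']; first by rewrite mul1mx.
by rewrite -mulmxA; apply: IH; exact: hM.
Qed.

Lemma elmE i j a : elm i j a = 1%:M + delta_mx i 0 *m (a *: delta_mx 0 j : 'rV_N).
Proof. by rewrite /elm -scalemxAr mul_delta_mx. Qed.

Lemma elm_add i j a b : i != j -> elm i j a *m elm i j b = elm i j (a + b).
Proof.
move=> hij; rewrite /elm mulmxDl mul1mx mulmxDr mulmx1 -scalemxAr -scalemxAl.
by rewrite mul_delta_mx_0 1?eq_sym // !scaler0 addr0 scalerDl -addrA (addrC (b *: _)).
Qed.

Lemma elm0 i j : elm i j 0 = 1%:M. Proof. by rewrite /elm scale0r addr0. Qed.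

Lemma Egen_inv S A : (forall i j a, S i j a -> S i j (- a)) -> Egen S A ->
  exists A', [/\ Egen S A', A *m A' = 1%:M & A' *m A = 1%:M].
Proof.
move=> hS; elim=> [|A1 i j a _ [A' [h1 h2 h3]] hij ha].
  by exists 1%:M; rewrite mulmx1; split=> //; exact: Egen1.
exists (elm i j (- a) *m A'); split.
- by apply: Egen_mul => //; apply: Egen_elm => //; exact: hS.
- by rewrite mulmxA -(mulmxA A1) elm_add // subrr elm0 mulmx1.
- by rewrite mulmxA -(mulmxA _ A') h3 mulmx1 elm_add // addNr elm0.
Qed.

Lemma Egen_row_fix S A k : (forall i j a, S i j a -> i != k) -> Egen S A ->
  delta_mx (0 : 'I_1) k *m A = delta_mx 0 k.
Proof.
move=> hS; elim=> [|A1 i j a _ IH hij /hS hi]; first by rewrite mulmx1.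
rewrite mulmxA IH /elm mulmxDr mulmx1 -scalemxAr mul_delta_mx_0 1?eq_sym //.
by rewrite scaler0 addr0.
Qed.

Lemma Egen_col_fix S A k : (forall i j a, S i j a -> j != k) -> Egen S A ->
  A *m delta_mx k (0 : 'I_1) = delta_mx k 0.
Proof.
move=> hS; elim=> [|A1 i j a _ IH hij /hS hj]; first by rewrite mul1mx.
rewrite -mulmxA /elm mulmxDl mul1mx -scalemxAl mul_delta_mx_0 //.
by rewrite scaler0 addr0.
Qed.

Lemma row_dot_delta r k : r *m delta_mx k (0 : 'I_1) = (r 0 k)%:M.
Proof. by rewrite -colE [LHS]mx11_scalar mxE. Qed.

Lemma delta_dot_col c k : delta_mx (0 : 'I_1) k *m c = (c k 0)%:M.
Proof. by rewrite -rowE [LHS]mx11_scalar mxE. Qed.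

Lemma rank_one_mul c r c' r' : (1%:M + c *m r) *m (1%:M + c' *m r') =
  1%:M + c *m r + c' *m r' + c *m (r *m c') *m r'.
Proof. by rewrite mulmxDl mul1mx mulmxDr mulmx1 addrACA addrA !mulmxA. Qed.

Lemma row_transvection_add i r r' : r 0 i = 0 ->
  (1%:M + delta_mx i 0 *m r) *m (1%:M + delta_mx i 0 *m r') =
  1%:M + delta_mx i 0 *m (r + r').
Proof.
move=> h; rewrite rank_one_mul row_dot_delta h.
by rewrite raddf0 mulmx0 mul0mx addr0 mulmxDr addrA.
Qed.

Lemma col_transvection_add j c c' : c' j 0 = 0 ->
  (1%:M + c *m delta_mx 0 j) *m (1%:M + c' *m delta_mx 0 j) =
  1%:M + (c + c') *m delta_mx 0 j.
Proof.
move=> h; rewrite rank_one_mul delta_dot_col h.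
by rewrite raddf0 mulmx0 mul0mx addr0 mulmxDl addrA.
Qed.

Lemma Egen_row S i r : r 0 i = 0 -> (forall j, r 0 j != 0 -> S i j (r 0 j)) ->
  Egen S (1%:M + delta_mx i 0 *m r).
Proof.
move=> hi hS; rewrite [r]row_sum_delta.
elim: (index_enum _) => [|j s IH]; first by rewrite big_nil mulmx0 addr0; exact: Egen1.
rewrite big_cons; case: (eqVneq (r 0 j) 0) => [->|hj].
  by rewrite scale0r add0r.
rewrite -row_transvection_add.
  apply: Egen_mul => //; rewrite -elmE; apply: Egen_elm; last exact: hS.
  by apply: contraNneq hj => <-; rewrite hi.
rewrite !mxE eqxx /=; case: eqP => [e|]; last by rewrite mulr0.
by rewrite -e hi mul0r.
Qed.

Lemma Egen_col S j c : c j 0 = 0 -> (forall i, c i 0 != 0 -> S i j (c i 0)) ->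
  Egen S (1%:M + c *m delta_mx 0 j).
Proof.
move=> hj hS.
have -> : c = \sum_i c i 0 *: delta_mx i 0.
  by rewrite {1}[c]matrix_sum_delta; apply: eq_bigr => i _; rewrite big_ord1.
elim: (index_enum _) => [|i s IH]; first by rewrite big_nil mul0mx addr0; exact: Egen1.
rewrite big_cons; case: (eqVneq (c i 0) 0) => [->|hi].
  by rewrite scale0r add0r.
rewrite [_ *: _ + _]addrC -col_transvection_add.
  apply: Egen_mul => //.
  have -> : 1%:M + (c i 0 *: delta_mx i 0 : 'cV_N) *m delta_mx 0 j = elm i j (c i 0).
    by rewrite /elm -scalemxAl mul_delta_mx.
  by apply: Egen_elm; [apply: contraNneq hi => ->; rewrite hj | exact: hS].
rewrite !mxE eqxx andbT; case: eqP => [e|]; last by rewrite mulr0.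
by rewrite -e hj mul0r.
Qed.

End ElementaryGroups.

(** * Bass--Vaserstein injective stability *)

Section Stabilization.
Variables (T : comNzRingType) (N : nat) (f l : 'I_N).
Hypothesis fl : (f < l)%N.
Implicit Types (A M h : 'M[T]_N) (i j k : 'I_N) (c v : 'cV[T]_N) (r : 'rV[T]_N).

Local Notation ef := (delta_mx f (0 : 'I_1) : 'cV[T]_N).
Local Notation el := (delta_mx l (0 : 'I_1) : 'cV[T]_N).
Local Notation rf := (delta_mx (0 : 'I_1) f : 'rV[T]_N).
Local Notation rl := (delta_mx (0 : 'I_1) l : 'rV[T]_N).

(** All groups live in matrices of one size [N], so that no change of size is needed when the block
    shrinks: indices below [l] form the small block, [l] is the added row and column. The affine
    matrices leave column [l] alone and so fix [el]. *)
Definition small_elementary : 'M[T]_N -> Prop := Egen (fun i j _ => (i < l) && (j < l))%N.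

Definition affine_elementary : 'M[T]_N -> Prop := Egen (fun i j _ => (i <= l) && (j < l))%N.

Definition big_elementary : 'M[T]_N -> Prop := Egen (fun i j _ => (i <= l) && (j <= l))%N.

Local Notation E := small_elementary.
Local Notation H := affine_elementary.
Local Notation G := big_elementary.

(** The Weyl element that sends [el] to [ef] and [ef] to [- el]; [swap_lf] is its inverse. *)
Definition swap_fl : 'M[T]_N := 1%:M + ef *m (rl - rf) - el *m (rf + rl).

Definition swap_lf : 'M[T]_N := 1%:M - ef *m (rf + rl) + el *m (rf - rl).

Local Notation sig := swap_fl.
Local Notation siV := swap_lf.

(** Two facts make this set useful: a member is determined, up to an affine factor on the right, by
    its last column ([double_coset_unique]), and every big elementary matrix enters it after one
    column transvection ([coset_cover_all]). *)
Definition double_coset M := exists h h', [/\ H h, H h' & M = h *m sig *m h'].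

Local Notation HsH := double_coset.

Lemma f_neq_l : f != l. Proof. by rewrite neq_ltn fl. Qed.

Lemma rf_ef : rf *m ef = 1%:M.
Proof. by rewrite row_dot_delta mxE !eqxx. Qed.
Lemma rl_el : rl *m el = 1%:M.
Proof. by rewrite row_dot_delta mxE !eqxx. Qed.
Lemma rf_el : rf *m el = 0.
Proof. by rewrite mul_delta_mx_0 // f_neq_l. Qed.
Lemma rl_ef : rl *m ef = 0.
Proof. by rewrite mul_delta_mx_0 // eq_sym f_neq_l. Qed.

Definition basisE := (rf_ef, rl_el, rf_el, rl_ef).

Local Notation mxE0 := (mulmxDl, mulmxDr, mulmxBl, mulmxBr, mulmx1, mul1mx, mulmx0, mul0mx,
  subr0, addr0, add0r, sub0r, oppr0, mulmxN, mulNmx, opprK).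

Lemma sig_el : sig *m el = ef.
Proof. by rewrite /sig ?mxE0 -?mulmxA ?mxE0 ?basisE ?mxE0 addrAC subrr add0r. Qed.

Lemma sig_ef : sig *m ef = - el.
Proof. by rewrite /sig ?mxE0 -?mulmxA ?mxE0 ?basisE ?mxE0 subrr add0r. Qed.

Lemma rl_sig : rl *m sig = - rf.
Proof.
by rewrite /sig ?mxE0 ?mulmxA ?basisE ?mxE0 opprD addrCA subrr addr0.
Qed.

Lemma rf_sig : rf *m sig = rl.
Proof.
by rewrite /sig ?mxE0 ?mulmxA ?basisE ?mxE0 addrC subrK.
Qed.

Lemma siV_sig : siV *m sig = 1%:M.
Proof.
rewrite /siV mulmxDl mulmxBl mul1mx -!mulmxA [in X in _ - X]mulmxDl [in X in _ + X]mulmxBl.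
rewrite rl_sig rf_sig /sig opprK [rf + rl]addrC.
by rewrite addrAC subrK addrK.
Qed.

Lemma siV_ef : siV *m ef = el.
Proof. by rewrite -sig_el mulmxA siV_sig mul1mx. Qed.

Lemma siV_el : siV *m el = - ef.
Proof. by rewrite -[el]opprK -sig_ef mulmxN mulmxA siV_sig mul1mx. Qed.

Lemma sig_siV : sig *m siV = 1%:M.
Proof. exact: mulmx1C siV_sig. Qed.

Lemma row_sig r : r 0 f = 0 -> r 0 l = 0 -> r *m sig = r.
Proof.
by move=> hf hl; rewrite /sig ?mxE0 ?mulmxA !row_dot_delta hf hl raddf0 ?mxE0.
Qed.

Lemma siV_col c : c f 0 = 0 -> c l 0 = 0 -> siV *m c = c.
Proof.
by move=> hf hl; rewrite /siV ?mxE0 -?mulmxA ?mxE0 !delta_dot_col hf hl raddf0 ?mxE0.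
Qed.

Lemma conj_sig c r : siV *m (1%:M + c *m r) *m sig = 1%:M + (siV *m c) *m (r *m sig).
Proof. by rewrite mulmxDr mulmx1 mulmxDl siV_sig ?mulmxA. Qed.


Lemma small_row_fix e k : E e -> (l <= k)%N ->
  delta_mx (0 : 'I_1) k *m e = delta_mx 0 k.
Proof.
move=> he hk; apply: Egen_row_fix he => i j _ /andP [hi _].
by rewrite neq_ltn (leq_trans hi hk).
Qed.

Lemma small_col_fix e k : E e -> (l <= k)%N ->
  e *m delta_mx k (0 : 'I_1) = delta_mx k 0.
Proof.
move=> he hk; apply: Egen_col_fix he => i j _ /andP [_ hj].
by rewrite neq_ltn (leq_trans hj hk).
Qed.

Lemma affine_el h : H h -> h *m el = el.
Proof.
move=> hh; apply: Egen_col_fix hh => i j _ /andP [_ hj].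
by rewrite neq_ltn hj.
Qed.

Lemma affine_row_fix h k : H h -> (l < k)%N ->
  delta_mx (0 : 'I_1) k *m h = delta_mx 0 k.
Proof.
move=> hh hk; apply: Egen_row_fix hh => i j _ /andP [hi _].
by rewrite neq_ltn (leq_ltn_trans hi hk).
Qed.

Lemma small_affine e : E e -> H e.
Proof. by apply: Egen_mono => i j _ _ /andP [/ltnW -> ->]. Qed.

Lemma scalar_mx11_inj : injective (fun a : T => a%:M : 'M_1).
Proof. by move=> a b /matrixP /(_ 0 0); rewrite !mxE eqxx !mulr1n. Qed.

Lemma small_col_support e c : E e -> (forall i, (l <= i)%N -> c i 0 = 0) ->
  forall i, (l <= i)%N -> (e *m c) i 0 = 0.
Proof.
move=> he hc i hi; apply: scalar_mx11_inj.
by rewrite -delta_dot_col mulmxA small_row_fix // delta_dot_col hc.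
Qed.

Lemma small_row_support e r : E e -> (forall i, (l <= i)%N -> r 0 i = 0) ->
  forall i, (l <= i)%N -> (r *m e) 0 i = 0.
Proof.
move=> he hr i hi; apply: scalar_mx11_inj.
by rewrite -row_dot_delta -mulmxA small_col_fix // row_dot_delta hr.
Qed.

Lemma affine_row i r : (i <= l)%N -> r 0 i = 0 -> (forall j, (l <= j)%N -> r 0 j = 0) ->
  H (1%:M + delta_mx i 0 *m r).
Proof.
move=> hi hri hr; apply: Egen_row => // j hj; rewrite hi ltnNge.
by apply: contraNN hj => /hr ->.
Qed.

Lemma affine_col j c : (j < l)%N -> c j 0 = 0 -> (forall i, (l < i)%N -> c i 0 = 0) ->
  H (1%:M + c *m delta_mx 0 j).
Proof.
move=> hj hcj hc; apply: Egen_col => // i hi; rewrite hj andbT leqNgt.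
by apply: contraNN hi => /hc ->.
Qed.

Lemma affine_decomposition h : H h ->
  exists e r, [/\ E e, forall j, (l <= j)%N -> r 0 j = 0 & h = e *m (1%:M + el *m r)].
Proof.
elim=> [|A i j a _ [e [r [he hr ->]]] hij /andP [hi hj]].
  exists 1%:M, 0; rewrite mulmx0 addr0 mulmx1; split=> //; first exact: Egen1.
  by move=> j; rewrite mxE.
move: hi; rewrite leq_eqVlt => /predU1P [hi|hi].
  have -> : i = l by apply: val_inj.
  exists e, (r + a *: delta_mx 0 j); split=> //.
    move=> k hk; rewrite !mxE hr // eqxx /= add0r; case: eqP => [e'|]; last by rewrite mulr0.
    by move: hk; rewrite e' leqNgt hj.
  by rewrite elmE -mulmxA row_transvection_add // hr.
have hE : E (elm i j a) by apply: Egen_elm => //; rewrite hi hj.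
exists (e *m elm i j a), (r *m elm i j a); split.
- exact: Egen_mul.
- exact: small_row_support.
- rewrite -!mulmxA; congr (e *m _); rewrite mulmxDl mulmxDr mul1mx mulmx1 !mulmxA.
  by rewrite small_col_fix.
Qed.

Lemma affine_inv h : H h -> exists h', [/\ H h', h *m h' = 1%:M & h' *m h = 1%:M].
Proof. exact: Egen_inv. Qed.

Lemma small_inv e : E e -> exists e', [/\ E e', e *m e' = 1%:M & e' *m e = 1%:M].
Proof. exact: Egen_inv. Qed.

(* The middle factor [d] of [h] involves neither [f] nor [l], so it commutes with the swap: this is
   why no information is lost when passing from one corner of the matrix to the other. *)
Lemma affine_conj_sig h : H h -> h *m ef = ef -> H (siV *m h *m sig).
Proof.
move=> /affine_decomposition [e [r [he hr ->]]] hef.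
have hrf : r 0 f = 0.
  apply: scalar_mx11_inj; rewrite -row_dot_delta.
  have := congr1 (fun x => rl *m x) hef.
  rewrite /= !mulmxA small_row_fix // mulmxDr mulmx1 mulmxA rl_el mul1mx.
  by rewrite mulmxDl rl_ef add0r => ->; rewrite raddf0.
have hrl : r 0 l = 0 by exact: hr.
have hee : e *m ef = ef.
  move: hef; rewrite -mulmxA mulmxDl mul1mx -mulmxA row_dot_delta hrf.
  by rewrite raddf0 mulmx0 addr0.
(* [y] is the deviation of row [f] of [e] from the unit row; dividing it out leaves [d], which fixes
   [rf] as well as [ef]. *)
pose y := rf *m e - rf.
have hyf : y 0 f = 0.
  apply: scalar_mx11_inj; rewrite -row_dot_delta /y mulmxBl -mulmxA hee subrr.
  by rewrite raddf0.
have hy j : (l <= j)%N -> y 0 j = 0.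
  move=> hj; apply: scalar_mx11_inj; rewrite -row_dot_delta /y mulmxBl -mulmxA.
  by rewrite small_col_fix // subrr raddf0.
have hyl : y 0 l = 0 by exact: hy.
have Hy : E (1%:M + ef *m (- y)).
  apply: Egen_row; first by rewrite mxE hyf oppr0.
  by move=> j; rewrite mxE oppr_eq0 fl ltnNge => hj; apply: contraNN hj => /hy ->.
pose d := e *m (1%:M + ef *m (- y)).
have Ed : E d by exact: Egen_mul.
have def : d *m ef = ef.
  rewrite /d -mulmxA mulmxDl mul1mx -mulmxA mulNmx row_dot_delta hyf raddf0.
  by rewrite oppr0 mulmx0 addr0.
have dfd : rf *m d = rf.
  rewrite /d mulmxA mulmxDr mulmx1 mulmxA -(mulmxA rf) hee rf_ef mul1mx /y.
  by rewrite opprB addrC subrK.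
have -> : e = d *m (1%:M + ef *m y).
  have hyN : (- y) 0 f = 0 by rewrite mxE hyf oppr0.
  by rewrite /d -mulmxA row_transvection_add // addNr mulmx0 addr0 mulmx1.
clearbody d.
have comm : siV *m d = d *m siV.
  have hl : rl *m d = rl by exact: small_row_fix.
  have hl' : d *m el = el by exact: small_col_fix.
  have key (a b : 'rV_N) : a *m d = a -> b *m d = b ->
      (1%:M - ef *m a + el *m b) *m d = d *m (1%:M - ef *m a + el *m b).
    move=> ha hb; rewrite mulmxDl mulmxBl mul1mx mulmxDr mulmxBr mulmx1 !mulmxA def hl'.
    by rewrite -!mulmxA ha hb.
  by apply: key; [rewrite mulmxDl dfd hl | rewrite mulmxBl dfd hl].
have -> : siV *m (d *m (1%:M + ef *m y) *m (1%:M + el *m r)) *m sig =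
    d *m (siV *m (1%:M + ef *m y) *m sig) *m (siV *m (1%:M + el *m r) *m sig).
  rewrite !mulmxA comm -!mulmxA; do 3 congr (_ *m _).
  by rewrite [sig *m _]mulmxA sig_siV mul1mx.
apply: Egen_mul.
  apply: Egen_mul; first exact: small_affine.
  by rewrite conj_sig siV_ef row_sig //; apply: affine_row.
rewrite conj_sig siV_el row_sig // mulNmx -mulmxN.
apply: affine_row; first exact: ltnW; first by rewrite mxE hrf oppr0.
by move=> j hj; rewrite mxE hr // oppr0.
Qed.

Lemma double_coset_mull h M : H h -> HsH M -> HsH (h *m M).
Proof.
move=> hh [h1 [h2 [H1 H2 ->]]]; exists (h *m h1), h2.
by split=> //; [exact: Egen_mul | rewrite !mulmxA].
Qed.

Lemma double_coset_mulr h M : H h -> HsH M -> HsH (M *m h).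
Proof.
move=> hh [h1 [h2 [H1 H2 ->]]]; exists h1, (h2 *m h).
by split=> //; [exact: Egen_mul | rewrite !mulmxA].
Qed.

Lemma double_coset_rep h : H h -> HsH (h *m sig).
Proof. by move=> hh; exists h, 1%:M; rewrite mulmx1; split=> //; exact: Egen1. Qed.

(** With equal last columns, the quotient of the two left factors fixes [ef], so [affine_conj_sig]
    carries it through the swap. *)
Lemma double_coset_unique M M' : HsH M -> HsH M' -> M *m el = M' *m el ->
  exists h, H h /\ M' = M *m h.
Proof.
move=> [h1 [h1' [H1 H1' ->]]] [h2 [h2' [H2 H2' ->]]].
rewrite -!mulmxA (affine_el H1') (affine_el H2') sig_el => e.
have [k [Hk hk hk']] := affine_inv H1; have [k' [Hk' hkk hkk']] := affine_inv H1'.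
exists (k' *m (siV *m (k *m h2) *m sig) *m h2'); split.
  apply: Egen_mul => //; apply: Egen_mul => //; apply: affine_conj_sig.
    exact: Egen_mul.
  by rewrite -mulmxA -e mulmxA hk' mul1mx.
rewrite -!mulmxA (mulmxA h1' k') hkk mul1mx (mulmxA sig siV) sig_siV mul1mx.
by rewrite (mulmxA h1 k) hk mul1mx.
Qed.

Lemma double_coset_lift M h : HsH M -> H h -> M *m el = h *m ef ->
  exists h', H h' /\ M = h *m sig *m h'.
Proof.
move=> hM hh e; have [|h' [Hh' ->]] := double_coset_unique (double_coset_rep hh) hM.
  by rewrite -mulmxA sig_el.
by exists h'.
Qed.

Lemma double_coset_support M : HsH M -> forall i, (l < i)%N -> (M *m el) i 0 = 0.
Proof.
move=> [h [h' [Hh Hh' ->]]] i hi; apply: scalar_mx11_inj.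
rewrite -delta_dot_col -!mulmxA (affine_el Hh') sig_el mulmxA affine_row_fix //.
by rewrite mul_delta_mx_0 ?raddf0 // neq_ltn (ltn_trans fl hi) orbT.
Qed.


(** The matrices that, standing to the left of the swap, can be absorbed into the affine factor on
    its right. *)
Definition conj_affine A := H (siV *m A *m sig).

Lemma conj_affine_mul A A' : conj_affine A -> conj_affine A' -> conj_affine (A *m A').
Proof.
move=> h h'; rewrite /conj_affine.
have -> : siV *m (A *m A') *m sig = siV *m A *m sig *m (siV *m A' *m sig).
  by rewrite !mulmxA -(mulmxA _ sig siV) sig_siV mulmx1.
exact: Egen_mul.
Qed.

Lemma double_coset_conj h A h' : H h -> H h' -> conj_affine A ->
  HsH (h *m A *m sig *m h').
Proof.
move=> hh hh' hA; exists h, (siV *m A *m sig *m h'); split=> //; first exact: Egen_mul.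
by rewrite !mulmxA -(mulmxA h sig siV) sig_siV mulmx1.
Qed.

Lemma row_conj_affine i r : i = f \/ i = l -> r 0 f = 0 -> r 0 l = 0 ->
  (forall j, (l <= j)%N -> r 0 j = 0) -> conj_affine (1%:M + delta_mx i 0 *m r).
Proof.
move=> hi hf hl hr; rewrite /conj_affine conj_sig row_sig //.
case: hi => ->; [rewrite siV_ef | rewrite siV_el mulNmx -mulmxN].
  exact: affine_row.
apply: affine_row; [exact: ltnW | by rewrite mxE hf oppr0 |].
by move=> j hj; rewrite mxE hr // oppr0.
Qed.

Lemma col_conj_affine c : c f 0 = 0 -> (forall i, (l <= i)%N -> c i 0 = 0) ->
  conj_affine (1%:M + c *m rl).
Proof.
move=> hf hc; rewrite /conj_affine conj_sig (siV_col hf (hc l (leqnn l))) rl_sig mulmxN -mulNmx.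
apply: affine_col => //; first by rewrite mxE hf oppr0.
by move=> i hi; rewrite mxE hc ?oppr0 // ltnW.
Qed.

Lemma minus_first_support v i : (l < i)%N -> v i 0 = 0 -> (v - v f 0 *: ef) i 0 = 0.
Proof.
move=> hi hv; rewrite !mxE hv; case: eqP => [e|]; last by rewrite mulr0 subr0.
by move: hi; rewrite e ltnNge ltnW.
Qed.

Lemma minus_first_f v : (v - v f 0 *: ef) f 0 = 0.
Proof. by rewrite !mxE !eqxx mulr1 subrr. Qed.

Lemma minus_first_neq v i : i != f -> (v - v f 0 *: ef) i 0 = v i 0.
Proof. by rewrite !mxE => /negbTE ->; rewrite mulr0 subr0. Qed.

(** The entry 1 at [f] allows the left factor of [M] to be taken as [1 + v' rf] with [v' = v - ef].
    The transvection passes it, changing [v'] into [v' + a c], and is then absorbed through the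
    swap. *)
Lemma double_coset_move M c : HsH M -> (M *m el) f 0 = 1 ->
  (forall i, (l <= i)%N -> c i 0 = 0) -> c f 0 = 0 -> HsH ((1%:M + c *m rl) *m M).
Proof.
move=> hM hv hc hcf; set v := M *m el in hv.
pose v' := v - ef.
have ev' : v' = v - v f 0 *: ef by rewrite hv scale1r.
have hv'f : v' f 0 = 0 by rewrite ev' minus_first_f.
have hv' i : (l < i)%N -> v' i 0 = 0.
  by move=> hi; rewrite ev' minus_first_support //; exact: double_coset_support.
have hh : H (1%:M + v' *m rf) by exact: affine_col.
have [h' [hh' eM]] : exists h', H h' /\ M = (1%:M + v' *m rf) *m sig *m h'.
  apply: double_coset_lift => //; rewrite mulmxDl mul1mx -mulmxA rf_ef mulmx1.
  by rewrite addrC subrK.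
pose a := v l 0.
have ha : rl *m v' = a%:M.
  by rewrite delta_dot_col ev' minus_first_neq // eq_sym f_neq_l.
have e1 : (1%:M + c *m rl) *m (1%:M + v' *m rf) =
    (1%:M + (v' + a *: c) *m rf) *m (1%:M + c *m rl).
  rewrite !rank_one_mul ha delta_dot_col hcf raddf0 !mulmx0 mul0mx addr0.
  by rewrite mul_mx_scalar mulmxDl -!addrA; congr (_ + _); rewrite addrC -addrA.
rewrite eM !mulmxA e1; apply: double_coset_conj => //; last exact: col_conj_affine.
apply: affine_col => //; first by rewrite [LHS]mxE hv'f add0r mxE hcf mulr0.
by move=> i hi; rewrite [LHS]mxE hv' // add0r mxE (hc _ (ltnW hi)) mulr0.
Qed.

(** The row [z rl] is a multiple of [q] plus a row [rho] orthogonal to [v']. The first part is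
    affine; the second passes the left factor of [M] up to the commutator [1 - v' rho], which is
    again absorbed through the swap. *)
Lemma double_coset_move_first M (z : T) (q : 'rV[T]_N) : HsH M ->
  (forall j, ~~ ((j < l)%N && (j != f)) -> q 0 j = 0) -> q *m (M *m el) = 1%:M ->
  HsH ((1%:M + ef *m (z *: rl)) *m M).
Proof.
move=> hM hq hqv; set v := M *m el in hqv.
have hqf : q 0 f = 0 by apply: hq; rewrite eqxx andbF.
have hql j : (l <= j)%N -> q 0 j = 0 by move=> hj; apply: hq; rewrite ltnNge hj.
have hqll : q 0 l = 0 by exact: hql.
have qef : q *m ef = 0 by rewrite row_dot_delta hqf raddf0.
have qel : q *m el = 0 by rewrite row_dot_delta hqll raddf0.
pose v' := v - v f 0 *: ef.
have hv'f : v' f 0 = 0 by exact: minus_first_f.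
have hv' i : (l < i)%N -> v' i 0 = 0.
  by move=> hi; apply: minus_first_support => //; exact: double_coset_support.
have rfv' : rf *m v' = 0 by rewrite delta_dot_col hv'f raddf0.
pose a := v l 0.
have hv'l : v' l 0 = a by rewrite minus_first_neq // eq_sym f_neq_l.
have ha : rl *m v' = a%:M by rewrite delta_dot_col hv'l.
have qv' : q *m v' = 1%:M.
  by rewrite mulmxBr hqv -scalemxAr qef scaler0 subr0.
have ev : v = v' + v f 0 *: ef by rewrite subrK.
clearbody v'; clearbody a.
(* Chosen so that the affine product below sends [ef] to [v]: since [q v' = 1], it changes the entry
   1 of [ef + v'] at [f] into [v f 0]. *)
pose q' := - ((1 - v f 0) *: q).
have hq'f : q' 0 f = 0 by rewrite !mxE hqf mulr0 oppr0.
have hq' j : (l <= j)%N -> q' 0 j = 0 by move=> hj; rewrite !mxE hql // mulr0 oppr0.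
have hh2 : H (1%:M + v' *m rf) by exact: affine_col.
have hh : H ((1%:M + ef *m q') *m (1%:M + v' *m rf)).
  by apply: Egen_mul => //; apply: affine_row => //; exact: ltnW.
have [|h' [hh' eM]] := double_coset_lift hM hh.
  have -> : (1%:M + ef *m q') *m (1%:M + v' *m rf) *m ef = (1%:M + ef *m q') *m (ef + v').
    by rewrite -mulmxA; congr (_ *m _); rewrite mulmxDl mul1mx -mulmxA rf_ef mulmx1.
  rewrite mulmxDl mul1mx -mulmxA [q' *m _]mulmxDr row_dot_delta hq'f raddf0 add0r.
  rewrite mulNmx -scalemxAl qv' scalemx1 mulmxN mul_mx_scalar scalerBl scale1r.
  by rewrite opprB [ef + v']addrC -addrA [ef + (_ - _)]addrC subrK -ev.
pose rho : 'rV[T]_N := z *: rl - (z * a) *: q.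
have rhof : rho 0 f = 0.
  by rewrite !mxE hqf mulr0 subr0 (negbTE f_neq_l) andbF mulr0.
have rhoef : rho *m ef = 0 by rewrite row_dot_delta rhof raddf0.
have erho : rho = z *: rl - (z * a) *: q by [].
have rhov' : rho *m v' = 0.
  by rewrite mulmxBl -!scalemxAl ha qv' !scale_scalar_mx mulr1 subrr.
have e1 : 1%:M + ef *m (z *: rl) =
    (1%:M + ef *m ((z * a) *: q)) *m (1%:M + ef *m rho).
  rewrite row_transvection_add; first by rewrite [_ + rho]addrC erho subrK.
  by rewrite mxE hqf mulr0.
clearbody rho.
have e2 : (1%:M + ef *m rho) *m (1%:M + ef *m q') =
    (1%:M + ef *m q') *m (1%:M + ef *m rho).
  by rewrite !row_transvection_add // [rho + _]addrC.
have e3 : (1%:M + ef *m rho) *m (1%:M + v' *m rf) =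
    (1%:M + v' *m rf) *m (1%:M + (- v') *m rho) *m (1%:M + ef *m rho).
  rewrite !rank_one_mul rhov' mulmxN rfv' oppr0 !mulmx0 !mul0mx !addr0.
  rewrite mulmxDr mulmx1 [X in _ = _ + X]mulmxA.
  have -> : (1%:M + v' *m rf + - v' *m rho) *m ef = ef + v'.
    by rewrite !mulmxDl mul1mx -!mulmxA rf_ef rhoef mulmx1 mulmx0 addr0.
  by rewrite mulmxDl mulNmx addrACA addNr addr0 addrAC.
(* Conjugation by [1 + a el q] turns the column [v' - a el], whose entry at [l] vanishes, into [v'],
   and the row [rl] into [rl - a q]. Each of the three factors can be absorbed through the swap. *)
have e4 : 1%:M + (- v') *m rho =
    (1%:M + el *m (a *: q)) *m (1%:M + (- (z *: (v' - a *: el))) *m rl)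
      *m (1%:M + el *m (- (a *: q))).
  have -> : (1%:M + el *m (a *: q)) *m (1%:M + (- (z *: (v' - a *: el))) *m rl) =
      1%:M + el *m (a *: q) - (z *: v') *m rl.
    have hw : (a *: q) *m (z *: (v' - a *: el)) = (a * z)%:M.
      rewrite -scalemxAl -scalemxAr mulmxBr qv' -scalemxAr qel scaler0 subr0.
      by rewrite !scale_scalar_mx mulr1.
    rewrite rank_one_mul mulmxN hw mulmxN mul_mx_scalar !mulNmx.
    rewrite -addrA -opprD -mulmxDl; congr (_ - _ *m _).
    by rewrite scalerBr scalerA [z * a]mulrC subrK.
  rewrite [RHS]mulmxDr mulmx1 [X in _ = _ + X]mulmxA.
  have -> : (1%:M + el *m (a *: q) - z *: v' *m rl) *m el = el - z *: v'.
    rewrite mulmxBl mulmxDl mul1mx -!mulmxA -scalemxAl qel scaler0 mulmx0 addr0.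
    by rewrite rl_el mulmx1.
  rewrite mulmxN mulmxBl opprB [RHS]addrAC addrA.
  rewrite erho mulNmx mulmxBr opprB -!scalemxAl -!scalemxAr !scalerA.
  by rewrite [z * a]mulrC [1%:M + _ + _ - _]addrAC addrK addrA.
have hsup : forall i, (l <= i)%N -> (- (z *: (v' - a *: el))) i 0 = 0.
  move=> i; rewrite leq_eqVlt => /predU1P [hi|hi].
    have -> : i = l by apply: val_inj.
    by rewrite !mxE !eqxx mulr1 hv'l subrr mulr0 oppr0.
  rewrite !mxE hv' //; case: eqP => [e|_]; first by move: hi; rewrite e ltnn.
  by rewrite !mulr0 subr0 mulr0 oppr0.
have -> : (1%:M + ef *m (z *: rl)) *m M =
    (1%:M + ef *m ((z * a) *: q)) *m
    (((1%:M + ef *m q') *m (1%:M + v' *m rf)) *m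
     ((1%:M + el *m (a *: q)) *m (1%:M + (- (z *: (v' - a *: el))) *m rl)
      *m (1%:M + el *m (- (a *: q))) *m (1%:M + ef *m rho)) *m sig *m h').
  rewrite eM e1 -e4 !mulmxA; do 2 congr (_ *m _).
  rewrite -!mulmxA; congr (_ *m _); rewrite !mulmxA e2 -!mulmxA; congr (_ *m _).
  by rewrite e3 !mulmxA.
apply: double_coset_mull.
  apply: affine_row; [exact: ltnW | by rewrite mxE hqf mulr0 |].
  by move=> j hj; rewrite mxE hql // mulr0.
apply: double_coset_conj => //.
have haq j : (l <= j)%N -> (a *: q) 0 j = 0 by move=> hj; rewrite mxE hql // mulr0.
apply: conj_affine_mul; first apply: conj_affine_mul; first apply: conj_affine_mul.
- by apply: row_conj_affine; [right | rewrite mxE hqf mulr0 | exact: haq | exact: haq].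
- apply: col_conj_affine => //.
  by rewrite !mxE hv'f (negbTE f_neq_l) /= mulr0 subr0 mulr0 oppr0.
- apply: row_conj_affine; [by right | by rewrite !mxE hqf mulr0 oppr0 | |].
    by rewrite mxE haq // oppr0.
  by move=> j hj; rewrite mxE haq // oppr0.
rewrite /conj_affine conj_sig siV_ef; apply: affine_row => //.
  rewrite erho mulmxBl -!scalemxAl rl_sig row_sig // !mxE hqll.
  by rewrite [l == f]eq_sym (negbTE f_neq_l) andbF oppr0 !mulr0 subr0.
move=> j hj; rewrite erho mulmxBl -!scalemxAl rl_sig row_sig // !mxE (hql j hj).
have /negbTE -> : j != f by rewrite neq_ltn (leq_trans fl hj) orbT.
by rewrite andbF oppr0 !mulr0 subr0.
Qed.

(** * Covering the elementary group by translates of the double coset *)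

Section StableRangeHypothesis.
Hypothesis sr : stable_range T l.-1.

Lemma card_below_but i : (i < l)%N -> (l.-1 <= #|[pred j : 'I_N | (j < l)%N && (j != i)]|)%N.
Proof.
move=> hi; have := cardD1 i [pred j : 'I_N | (j < l)%N].
rewrite inE hi /= => e.
have -> : #|[pred j : 'I_N | (j < l)%N && (j != i)]| = #|[predD1 [pred j : 'I_N | (j < l)%N] & i]|.
  by apply: eq_card => j; rewrite !inE andbC.
have hc : #|[pred j : 'I_N | (j < l)%N]| = l.
  have hl : (l <= N)%N by exact: ltnW.
  rewrite -[RHS]card_ord -(card_image (f := widen_ord hl)).
    apply: eq_card => j; rewrite inE; apply/idP/imageP => [hj|[k _ ->]].
      by exists (Ordinal hj) => //; exact: val_inj.
    exact: (ltn_ord k).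
  by move=> x y /(congr1 val) /= h; exact: val_inj.
by rewrite -[X in (X.-1 <= _)%N]hc e.
Qed.

Lemma col_op_vector c k v : (1%:M + c *m delta_mx 0 k) *m v = v + v k 0 *: c.
Proof. by rewrite mulmxDl mul1mx -mulmxA delta_dot_col mul_mx_scalar. Qed.

Lemma basis_entries : ((ef f 0 = 1) * (ef l 0 = 0) * (el f 0 = 0) * (el l 0 = 1))%type.
Proof. by rewrite !mxE !eqxx [l == f]eq_sym (negbTE f_neq_l). Qed.

(* By the stable range hypothesis the move by [c] factors into moves of two kinds: those for which the
   last column has entry [1] at [f], and one in direction [f] for which the other entries above [l]
   are unimodular. *)
Lemma double_coset_good M c : HsH M -> (forall i, (l <= i)%N -> c i 0 = 0) ->
  (exists q : 'rV[T]_N, (forall j, (l <= j)%N -> q 0 j = 0) /\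
    q *m ((1%:M + c *m rl) *m (M *m el)) = 1%:M) ->
  HsH ((1%:M + c *m rl) *m M).
Proof.
move=> [h [h' [hh hh' ->]]] hc [q [hq hqv]].
(* The block part [e] of [h] passes the transvection and only changes [c]; afterwards the last
   column is [ef + a el]. *)
have [e [r [he hr eh]]] := affine_decomposition hh.
have [e' [he' hee' he'e]] := small_inv he.
pose c1 := e' *m c; have hc1 : forall i, (l <= i)%N -> c1 i 0 = 0 by exact: small_col_support.
have rle : rl *m e = rl by exact: small_row_fix.
have ece : (1%:M + c *m rl) *m e = e *m (1%:M + c1 *m rl).
  by rewrite mulmxDl mulmxDr mul1mx mulmx1 /c1 !mulmxA hee' mul1mx -mulmxA rle.
clearbody c1.
pose M1 := (1%:M + el *m r) *m sig.
have hrl : r 0 l = 0 by exact: hr.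
have hM1 : HsH M1 by apply: double_coset_rep; apply: affine_row.
suff h1 : HsH ((1%:M + c1 *m rl) *m M1).
  have -> : (1%:M + c *m rl) *m (h *m sig *m h') = e *m ((1%:M + c1 *m rl) *m M1 *m h').
    by rewrite eh /M1 !mulmxA ece.
  by apply: double_coset_mull; [exact: small_affine | exact: double_coset_mulr].
pose a := r 0 f; pose q1 := q *m e.
have hq1 : forall j, (l <= j)%N -> q1 0 j = 0 by exact: small_row_support.
have hv1 : M1 *m el = ef + a *: el.
  by rewrite /M1 -mulmxA sig_el mulmxDl mul1mx -mulmxA row_dot_delta mul_mx_scalar.
have hw : q1 *m (ef + a *: el + a *: c1) = 1%:M.
  have hMe : h *m sig *m h' *m el = e *m (ef + a *: el).
    by rewrite -hv1 eh /M1 -!mulmxA (affine_el hh').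
  rewrite -hqv hMe [(1%:M + c *m rl) *m _]mulmxA ece /q1 -!mulmxA.
  congr (_ *m (_ *m _)); symmetry.
  by rewrite col_op_vector [X in _ + X *: _]mxE [X in _ + (_ + X) *: _]mxE !basis_entries mulr1 add0r.
pose cf := c1 f 0; pose c' := c1 - cf *: ef.
have hc'f : c' f 0 = 0 by exact: minus_first_f.
have ec1 : c1 = c' + cf *: ef by rewrite subrK.
have hc' i : (l <= i)%N -> c' i 0 = 0.
  move=> hi; rewrite minus_first_neq ?hc1 //.
  by rewrite neq_ltn (leq_trans fl hi) orbT.
clearbody c'.
have hD (x y : 'cV[T]_N) i : (x + y) i 0 = x i 0 + y i 0 by rewrite mxE.
have hZ b (x : 'cV[T]_N) i : (b *: x) i 0 = b * x i 0 by rewrite mxE.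
pose w := ef + a *: el + a *: c1.
pose D := [pred j : 'I_N | (j < l)%N && (j != f)].
(* Applied to the last column [w] after the full move, with the entry at [f] as the one to be
   removed; there are [l - 1] positions below [l] other than [f]. *)
have [||t [b hb]] := sr (D := D) (v := fun j => w j 0) (y := w f 0).
- exact: card_below_but.
- exists (fun j => q1 0 j), (q1 0 f).
  have := congr1 (fun M : 'M_1 => M 0 0) hw; rewrite [RHS]mxE eqxx mulr1n => <-.
  rewrite [RHS]mxE [RHS](bigD1 f) //= addrC; congr (_ + _).
  rewrite big_mkcond [RHS]big_mkcond; apply: eq_bigr => j _.
  rewrite /=; case: (ltnP j l) => hj //=; case: ifP => // _.
  by rewrite hq1 // mul0r.
pose s : 'cV[T]_N := \col_j if D j then t j else 0.
have es j : s j 0 = if D j then t j else 0 by rewrite mxE.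
have hsf : s f 0 = 0 by rewrite mxE /= eqxx andbF.
have hs i : (l <= i)%N -> s i 0 = 0 by move=> hi; rewrite mxE /= ltnNge hi.
have Hs : H (1%:M + s *m rf) by apply: affine_col => // i /ltnW; exact: hs.
clearbody s.
have rls : rl *m s = 0 by rewrite delta_dot_col hs // raddf0.
have rfc' : rf *m c' = 0 by rewrite delta_dot_col hc'f raddf0.
have rlc' : rl *m c' = 0 by rewrite delta_dot_col hc' // raddf0.
pose M2 := (1%:M + c' *m rl) *m M1.
have hM2 : HsH M2.
  apply: double_coset_move => //.
  by rewrite hv1 !mxE !eqxx (negbTE f_neq_l) mulr0 addr0.
have hv2 : M2 *m el = ef + a *: el + a *: c'.
  rewrite /M2 -mulmxA hv1 col_op_vector [X in _ + X *: _]mxE [X in _ + (_ + X) *: _]mxE.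
  by rewrite !basis_entries mulr1 add0r.
pose M3 := (1%:M + s *m rf) *m M2.
have hM3 : HsH M3 by exact: double_coset_mull.
have hv3 : M3 *m el = ef + a *: el + a *: c' + s.
  have hf : (ef + a *: el + a *: c') f 0 = 1.
    by rewrite !(hD, hZ, basis_entries, hc'f); ring.
  by rewrite /M3 -mulmxA hv2 col_op_vector hf scale1r.
pose M4 := (1%:M + (cf *: s) *m rl) *m M3.
have hM4 : HsH M4.
  apply: double_coset_move => //.
  - by rewrite hv3 !(hD, hZ, basis_entries, hc'f, hsf); ring.
  - by move=> i hi; rewrite mxE hs // mulr0.
  - by rewrite mxE hsf mulr0.
have hv4 : M4 *m el = ef + a *: el + a *: c' + s + (a * cf) *: s.
  have hl : (ef + a *: el + a *: c' + s) l 0 = a.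
    by rewrite !(hD, hZ, basis_entries, hc' _ (leqnn l), hs _ (leqnn l)); ring.
  by rewrite /M4 -mulmxA hv3 col_op_vector hl scalerA.
have hM5 : HsH ((1%:M + ef *m (cf *: rl)) *m M4).
  apply: (@double_coset_move_first _ _ (\row_j if D j then b j else 0)) => //.
    by move=> j hj; rewrite mxE ifN.
  rewrite [LHS]mx11_scalar -hb mxE [in RHS]big_mkcond; congr (_%:M).
  apply: eq_bigr => j _; rewrite mxE; case: ifP => hDj; last by rewrite mul0r.
  congr (_ * _); rewrite hv4.
  have /negbTE jf : j != f by case/andP: hDj.
  have /negbTE jl : j != l by case/andP: hDj => hj _; rewrite neq_ltn hj.
  have efj : ef j 0 = 0 by rewrite mxE jf.
  have elj : el j 0 = 0 by rewrite mxE jl.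
  rewrite !(hD, hZ) ec1 !(hD, hZ) !(basis_entries, efj, elj) es hDj hc'f; ring.
have [s' [hs' hss' hs's]] := affine_inv Hs.
have -> : (1%:M + c1 *m rl) *m M1 = s' *m ((1%:M + ef *m (cf *: rl)) *m M4).
  (* After multiples [s] of row [f] are added to other rows, the move by [c1] splits into the moves
     justified above. *)
  have Eq : (1%:M + s *m rf) *m (1%:M + c1 *m rl) =
     (1%:M + ef *m (cf *: rl)) *m (1%:M + (cf *: s) *m rl) *m (1%:M + s *m rf)
       *m (1%:M + c' *m rl).
    rewrite rank_one_mul delta_dot_col -/cf mul_mx_scalar.
    have -> : ef *m (cf *: rl) = (cf *: ef) *m rl by rewrite -scalemxAl -scalemxAr.
    rewrite col_transvection_add; last by rewrite hZ hs // mulr0.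
    rewrite rank_one_mul rls mulmx0 mul0mx addr0.
    rewrite mulmxDr mulmx1 [X in _ = _ + X]mulmxA.
    have -> : (1%:M + (cf *: ef + cf *: s) *m rl + s *m rf) *m c' = c'.
      by rewrite !mulmxDl mul1mx -!mulmxA rlc' rfc' !mulmx0 !addr0.
    rewrite ec1 !mulmxDl -!addrA; congr (_ + _).
    by rewrite addrA addrC -addrA.
  rewrite -[LHS]mul1mx -[X in X *m _ = _]hs's -mulmxA; congr (s' *m _).
  transitivity ((1%:M + s *m rf) *m (1%:M + c1 *m rl) *m M1); first by rewrite mulmxA.
  by rewrite Eq /M4 /M3 /M2 !mulmxA.
exact: double_coset_mull.
Qed.

Definition coset_cover M := exists c, (forall i, (l <= i)%N -> c i 0 = 0) /\
  HsH ((1%:M + c *m rl) *m M).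

Lemma big_inv M : G M -> exists M', [/\ G M', M *m M' = 1%:M & M' *m M = 1%:M].
Proof. exact: Egen_inv. Qed.

Lemma big_col_fix M k : G M -> (l < k)%N -> M *m delta_mx k (0 : 'I_1) = delta_mx k 0.
Proof.
move=> hM hk; apply: Egen_col_fix hM => i j _ /andP [_ hj].
by rewrite neq_ltn (leq_ltn_trans hj hk).
Qed.

(** The identity in SL2 writing an upper transvection as lower transvection, Weyl element, lower
    transvection. *)
Lemma double_coset_upper : HsH (1%:M + ef *m rl).
Proof.
have hH : H (1%:M + el *m rf).
  apply: affine_row => //; first by rewrite mxE [l == f]eq_sym (negbTE f_neq_l) andbF.
  by move=> j hj; rewrite mxE [j == f]gtn_eqF // (leq_trans fl hj).
exists (1%:M + el *m rf), (1%:M + el *m rf); split=> //.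
have e1 : (1%:M + el *m rf) *m sig = sig + el *m rl.
  by rewrite mulmxDl mul1mx -mulmxA rf_sig.
have e2 : (sig + el *m rl) *m el = ef + el.
  by rewrite mulmxDl sig_el -mulmxA rl_el mulmx1.
rewrite e1 mulmxDr mulmx1 mulmxA e2 /sig !mulmxDl mulmxBr mulmxDr opprD !addrA.
by rewrite subrK -[_ + _ + el *m rf]addrA [ef *m rf + _]addrC addrA subrK subrK.
Qed.

(** By induction on generators multiplied on the left. The only difficult one adds a multiple of row
    [j] to row [l]: it passes the transvection [1 + c rl] only if [c] vanishes at [j], and stable
    range is used to exchange [c] for such a column. *)
Lemma coset_cover_all M : G M -> coset_cover M.
Proof.
move=> hM; suff: G M /\ coset_cover M by case.
refine (Egen_ind_left (P := fun M => G M /\ coset_cover M) _ _ hM) =>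
  [|{hM} {}M i j a hij /andP [hi hj] [hM [c [hc hcM]]]].
  split; first exact: Egen1.
  exists ef; split; last by rewrite mulmx1; exact: double_coset_upper.
  by move=> i hi; rewrite mxE [i == f]gtn_eqF // (leq_trans fl hi).
split; first by apply: Egen_mul => //; apply: Egen_elm => //; rewrite hi hj.
move: hi hj; rewrite [(i <= l)%N]leq_eqVlt [(j <= l)%N]leq_eqVlt.
case/predU1P => [il|hi]; case/predU1P => [jl|hj].
- by move: hij; rewrite -val_eqE /= il jl eqxx.
- have {il} il : i = l by apply: val_inj.
  subst i; have [M' [hM' hMM' hM'M]] := big_inv hM.
  pose v := M *m el; pose q := rl *m M'.
  have hqv : q *m v = 1%:M by rewrite /q /v mulmxA -(mulmxA rl) hM'M mulmx1 rl_el.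
  have hq k : (l < k)%N -> q 0 k = 0.
    move=> hk; apply: scalar_mx11_inj; rewrite -row_dot_delta /q -mulmxA big_col_fix //.
    by rewrite mul_delta_mx_0 ?raddf0 // neq_ltn hk.
  pose D := [pred k : 'I_N | (k < l)%N && (k != j)].
  have [||t [b hb]] := sr (D := D) (v := fun k => v k 0) (y := q 0 j * v j 0 + q 0 l * v l 0).
  + exact: card_below_but.
  + exists (fun k => q 0 k), 1; rewrite mul1r.
    have := congr1 (fun M : 'M_1 => M 0 0) hqv; rewrite [RHS]mxE eqxx mulr1n => <-.
    rewrite [RHS]mxE [RHS](bigD1 j) //= [in RHS](bigD1 l) //= 1?eq_sym //.
    rewrite [RHS]addrA [RHS]addrC; congr (_ + _).
    rewrite big_mkcond [RHS]big_mkcond; apply: eq_bigr => k _ /=.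
    case: (ltngtP k l) => hk /=.
    * by rewrite [k != l]neq_ltn hk andbT.
    * by rewrite hq // mul0r; case: ifP.
    * by rewrite (_ : k = l) ?eqxx ?andbF //; exact: val_inj.
  (* The removed entry is [q_j v_j + q_l v_l]. Its [q_l] part is realized by the column [c']; its
     [q_j] part goes into the entry at [j] of the row proving unimodularity, so [c'] may vanish at
     [j]. *)
  pose c' : 'cV[T]_N := \col_k if D k then t k * q 0 l else 0.
  have ec' k : c' k 0 = if D k then t k * q 0 l else 0 by rewrite mxE.
  have hc'l k : (l <= k)%N -> c' k 0 = 0 by move=> hk; rewrite ec' /= ltnNge hk.
  have hc'j : c' j 0 = 0 by rewrite ec' /= eqxx andbF.
  clearbody c' q.
  have h1 : HsH ((1%:M + c' *m rl) *m M).
    have -> : (1%:M + c' *m rl) *m M = (1%:M + (c' - c) *m rl) *m ((1%:M + c *m rl) *m M).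
      by rewrite mulmxA col_transvection_add ?hc // subrK.
    apply: double_coset_good => //.
      by move=> k hk; rewrite !mxE hc // hc'l // subrr.
    exists (\row_k if D k then b k else if k == j then \sum_(k | D k) b k * t k * q 0 j else 0).
    split.
      move=> k hk; rewrite mxE /= ltnNge hk /=; case: eqP => // e.
      by move: hk; rewrite e leqNgt hj.
    have -> : (1%:M + (c' - c) *m rl) *m ((1%:M + c *m rl) *m M *m el) = v + v l 0 *: c'.
      by rewrite !mulmxA col_transvection_add ?hc // subrK -mulmxA col_op_vector.
    rewrite [LHS]mx11_scalar -hb; congr (_%:M).
    pose qj k := if D k then b k else if k == j then \sum_(k | D k) b k * t k * q 0 j else 0.
    transitivity (\sum_k qj k * (v k 0 + v l 0 * c' k 0)).
      rewrite mxE; apply: eq_bigr => k _; rewrite mxE -/(qj k).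
      by congr (_ * _); rewrite [LHS]mxE [X in _ + X]mxE.
    rewrite (bigD1 j) //= {1}/qj /= !eqxx andbF hc'j mulr0 addr0 big_distrl /=.
    rewrite [X in X + _]big_mkcond [X in _ + X]big_mkcond [RHS]big_mkcond -big_split /=.
    apply: eq_bigr => k _; rewrite /qj ec' /=.
    by case: (k < l)%N; case: (k == j); rewrite /= ?addr0 ?add0r ?mul0r //; ring.
  exists c'; split=> //.
  have -> : (1%:M + c' *m rl) *m (elm l j a *m M) =
      elm l j a *m (1%:M + (a *: c') *m delta_mx 0 j) *m ((1%:M + c' *m rl) *m M).
    rewrite !mulmxA; congr (_ *m M).
    have -> : elm l j a = 1%:M + (a *: el) *m delta_mx 0 j.
      by rewrite /elm -scalemxAl mul_delta_mx.
    rewrite col_transvection_add; last by rewrite mxE hc'j mulr0.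
    have rjc' : delta_mx (0 : 'I_1) j *m c' = 0 by rewrite delta_dot_col hc'j raddf0.
    have rla : rl *m (a *: el) = a%:M by rewrite -scalemxAr rl_el scalemx1.
    rewrite !rank_one_mul rjc' rla mulmx0 mul0mx addr0 mul_mx_scalar mulmxDl.
    by rewrite -!addrA; congr (_ + _); rewrite addrC -addrA.
  apply: double_coset_mull => //; apply: Egen_mul.
    by apply: Egen_elm; rewrite // leqnn hj.
  apply: affine_col => //; first by rewrite mxE hc'j mulr0.
  by move=> k hk; rewrite mxE hc'l ?mulr0 // ltnW.
- have {jl} jl : j = l by apply: val_inj.
  subst j; exists (c - a *: delta_mx i 0); split.
    move=> k hk; rewrite !mxE hc // [k == i]gtn_eqF ?(leq_trans hi hk) //=.
    by rewrite mulr0 subr0.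
  rewrite mulmxA elmE.
  have -> : delta_mx i 0 *m (a *: delta_mx 0 l : 'rV_N) = (a *: delta_mx i 0 : 'cV_N) *m rl.
    by rewrite -scalemxAl -scalemxAr.
  rewrite col_transvection_add ?subrK //.
  by rewrite !mxE [l == i]gtn_eqF // mulr0.
have hE : E (elm i j a) by apply: Egen_elm => //; rewrite hi hj.
exists (elm i j a *m c); split; first exact: small_col_support.
rewrite mulmxA; have -> : (1%:M + elm i j a *m c *m rl) *m elm i j a =
   elm i j a *m (1%:M + c *m rl).
  rewrite mulmxDl mulmxDr mul1mx mulmx1 -!mulmxA; congr (_ + _ *m (_ *m _)).
  exact: small_row_fix.
by rewrite -mulmxA; apply: double_coset_mull => //; exact: small_affine.
Qed.

(** [1 + ef rl] and its product with [M] lie in the double coset and have the same last column, so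
    they differ by an affine factor, which can only be [M]. *)
Theorem big_affine M : G M -> M *m el = el -> H M.
Proof.
move=> hM hMl; have [c [hc hcM]] := coset_cover_all hM.
have h1 : HsH ((1%:M + ef *m rl) *m M).
  have -> : (1%:M + ef *m rl) *m M = (1%:M + (ef - c) *m rl) *m ((1%:M + c *m rl) *m M).
    by rewrite mulmxA col_transvection_add ?hc // subrK.
  apply: double_coset_good => //.
    move=> k hk; rewrite !mxE hc // [k == f]gtn_eqF ?(leq_trans fl hk) //=.
    by rewrite subr0.
  exists rf; split; first by move=> j hj; rewrite mxE [j == f]gtn_eqF // (leq_trans fl hj).
  rewrite -mulmxA hMl [(1%:M + (ef - c) *m rl) *m _]mulmxA.
  rewrite col_transvection_add ?hc // subrK mulmxDl mul1mx -mulmxA rl_el mulmx1.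
  by rewrite mulmxDr rf_el rf_ef add0r.
have [|h [hh e]] := double_coset_unique double_coset_upper h1.
  by rewrite -mulmxA hMl.
suff -> : M = h by [].
have hV : (1%:M + (- ef) *m rl) *m (1%:M + ef *m rl) = 1%:M.
  rewrite col_transvection_add; first by rewrite addNr mul0mx addr0.
  by rewrite mxE [l == f]eq_sym (negbTE f_neq_l).
by rewrite -[M]mul1mx -[h]mul1mx -hV -!mulmxA e.
Qed.

Theorem big_small M : G M -> M *m el = el -> rl *m M = rl -> E M.
Proof.
move=> hM hMl hlM; have [e [r [he hr eM]]] := affine_decomposition (big_affine hM hMl).
suff r0 : r = 0 by rewrite eM r0 mulmx0 addr0 mulmx1.
move: hlM; rewrite eM mulmxA small_row_fix // mulmxDr mulmx1 mulmxA rl_el mul1mx.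
by move/(congr1 (fun x => x - rl)); rewrite subrr addrC addKr.
Qed.

End StableRangeHypothesis.
End Stabilization.

(** * Stability of GL/E under the stable range condition *)

Definition full_elementary (T : comNzRingType) N : 'M[T]_N -> Prop :=
  Egen (fun _ _ _ => True).

Section StableIsomorphism.
Variable T : comNzRingType.

Lemma stable_range_leq k k' : (k <= k')%N -> stable_range T k -> stable_range T k'.
Proof. by move=> h hs F D v y hD; apply: hs; exact: leq_trans hD. Qed.

Section Level.
Variable N : nat.
Implicit Types (M : 'M[T]_N).

Definition fixes M (k : 'I_N) :=
  M *m delta_mx k (0 : 'I_1) = delta_mx k 0 /\ delta_mx (0 : 'I_1) k *m M = delta_mx 0 k.

(** The step from [k + 1] to [k] is [big_small] with [l = k], which asks for stable range [k - 1];
    the bound [n - 1] covers every step. *)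
Lemma stable_descent n k M : (1 < n)%N -> stable_range T n.-1 -> (n <= k)%N -> (k <= N)%N ->
  (forall i : 'I_N, (n <= i)%N -> fixes M i) ->
  Egen (fun i j _ => (i < k) && (j < k))%N M -> Egen (fun i j _ => (i < n) && (j < n))%N M.
Proof.
move=> hn hs; elim: k => [|k IH]; first by rewrite leqn0 => /eqP e; rewrite e in hn.
rewrite leq_eqVlt => /predU1P [->|]; first by [].
rewrite ltnS => hnk hkN hM hE; apply: IH => //; first exact: ltnW.
pose l := Ordinal hkN; pose f := Ordinal (leq_ltn_trans (leq0n k) hkN).
have fl : (f < l)%N by rewrite /=; lia.
have [h1 h2] := hM l hnk.
apply: (big_small fl _ _ h1 h2); last exact: hE.
by apply: (stable_range_leq _ hs); rewrite /=; lia.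
Qed.

(** Bass' argument on row [l]: stable range makes the entries before [l] unimodular ([e1]), these
    turn the entry at [l] into 1 ([e2]), that 1 clears the row ([e3]), and [e4] clears the column.
    Stable range [l] suffices here, where injectivity asks for [l - 1]. *)
Lemma surjective_step (l : 'I_N) M M' : stable_range T l ->
  M *m M' = 1%:M -> M' *m M = 1%:M -> (forall k : 'I_N, (l < k)%N -> fixes M k) ->
  exists e, full_elementary e /\ forall k : 'I_N, (l <= k)%N -> fixes (M *m e) k.
Proof.
move=> hs hMM' hM'M hM.
pose el : 'cV[T]_N := delta_mx l 0; pose rl : 'rV[T]_N := delta_mx 0 l.
have rlel : rl *m el = 1%:M by rewrite row_dot_delta mxE !eqxx.
pose D := [pred j : 'I_N | (j < l)%N].
have hDc : (l <= #|D|)%N.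
  have hl : (l <= N)%N by exact: ltnW.
  rewrite -[X in (X <= _)%N]card_ord -(card_image (f := widen_ord hl)).
    by apply: subset_leq_card; apply/subsetP => _ /imageP [j _ ->]; exact: (ltn_ord j).
  by move=> x y /(congr1 val) /= h; exact: val_inj.
pose a := rl *m M.
have ha (k : 'I_N) : (l < k)%N -> a 0 k = 0.
  move=> hk; apply: scalar_mx11_inj; rewrite -row_dot_delta /a -mulmxA.
  by have [-> _] := hM k hk; rewrite mul_delta_mx_0 ?raddf0 // neq_ltn hk.
have hab : a *m (M' *m el) = 1%:M.
  by rewrite /a mulmxA -(mulmxA rl) hMM' mulmx1.
have [||t [b hb]] := hs _ D (fun j => a 0 j) (a 0 l).
- exact: hDc.
- exists (fun j => (M' *m el) j 0), ((M' *m el) l 0).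
  have := congr1 (fun M : 'M_1 => M 0 0) hab; rewrite [RHS]mxE eqxx mulr1n => <-.
  rewrite [RHS]mxE [RHS](bigD1 l) //= [RHS]addrC mulrC; congr (_ + _).
  rewrite big_mkcond [RHS]big_mkcond; apply: eq_bigr => k _ /=.
  case: (ltngtP k l) => hk /=.
  + by rewrite neq_ltn hk mulrC.
  + by rewrite ha // mul0r; case: ifP.
  + by rewrite (_ : k = l) ?eqxx //; exact: val_inj.
pose tr : 'rV[T]_N := \row_j if D j then t j else 0.
have htr (k : 'I_N) : (l <= k)%N -> tr 0 k = 0 by move=> hk; rewrite mxE /= ltnNge hk.
pose bc : 'cV[T]_N := \col_j if D j then b j else 0.
have hbc (k : 'I_N) : (l <= k)%N -> bc k 0 = 0 by move=> hk; rewrite mxE /= ltnNge hk.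
pose a1 := a + a 0 l *: tr.
have ha1 : a1 *m bc = 1%:M.
  rewrite [LHS]mx11_scalar -hb mxE [in RHS]big_mkcond; congr (_%:M).
  apply: eq_bigr => j _; rewrite !mxE; case: ifP => _; last by rewrite mulr0.
  by rewrite mulrC [t j * _]mulrC.
have ha1l : a1 0 l = a 0 l by rewrite [LHS]mxE [X in _ + X]mxE htr // mulr0 addr0.
have ea : rl *m M = a by [].
clearbody a tr bc.
pose e1 : 'M[T]_N := 1%:M + el *m tr.
pose c2 := (1 - a 0 l) *: bc.
pose e2 : 'M[T]_N := 1%:M + c2 *m rl.
pose a2 := a1 + (1 - a 0 l) *: rl.
have ha2l : a2 0 l = 1 by rewrite [LHS]mxE ha1l !mxE !eqxx mulr1 addrC subrK.
pose e3 : 'M[T]_N := 1%:M + el *m (rl - a2).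
have hr1 : rl *m M *m e1 = a1.
  by rewrite ea /e1 mulmxDr mulmx1 mulmxA row_dot_delta mul_scalar_mx.
have hr2 : a1 *m e2 = a2.
  by rewrite /e2 mulmxDr mulmx1 mulmxA /c2 -scalemxAr ha1 scalemx1 mul_scalar_mx.
have hr3 : a2 *m e3 = rl.
  by rewrite /e3 mulmxDr mulmx1 mulmxA row_dot_delta ha2l mul1mx addrC subrK.
have ha2 (k : 'I_N) : (l < k)%N -> (rl - a2) 0 k = 0.
  move=> hk; have hkl : (k == l) = false by apply: gtn_eqF.
  have a1k : a1 0 k = 0 by rewrite [LHS]mxE [X in _ + X]mxE (ha k hk) (htr k (ltnW hk)) mulr0 addr0.
  have rlk : rl 0 k = 0 by rewrite mxE hkl andbF.
  have a2k : a2 0 k = 0 by rewrite [LHS]mxE [X in _ + X]mxE a1k rlk mulr0 addr0.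
  by rewrite [LHS]mxE [X in _ + X]mxE a2k rlk subr0.
pose e123 := e1 *m e2 *m e3.
have E1 : full_elementary e1 by apply: Egen_row => //; exact: htr.
have E2 : full_elementary e2 by apply: Egen_col => //; rewrite mxE hbc // mulr0.
have E3 : full_elementary e3.
  apply: Egen_row => //; rewrite mxE [X in _ + X]mxE ha2l mxE !eqxx subrr //.
have E123 : full_elementary e123 by apply: Egen_mul => //; exact: Egen_mul.
have F123 (k : 'I_N) : (l < k)%N -> fixes e123 k.
  move=> hk; have hkl : k != l by rewrite neq_ltn hk orbT.
  have rkel : delta_mx (0 : 'I_1) k *m el = 0 by rewrite mul_delta_mx_0.
  have rlek : rl *m delta_mx k (0 : 'I_1) = 0 by rewrite mul_delta_mx_0 // eq_sym.
  have c1 : e1 *m delta_mx k (0 : 'I_1) = delta_mx k 0.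
    by rewrite mulmxDl mul1mx -mulmxA row_dot_delta htr ?(ltnW hk) // raddf0 mulmx0 addr0.
  have c2' : e2 *m delta_mx k (0 : 'I_1) = delta_mx k 0.
    by rewrite mulmxDl mul1mx -mulmxA rlek mulmx0 addr0.
  have c3 : e3 *m delta_mx k (0 : 'I_1) = delta_mx k 0.
    by rewrite mulmxDl mul1mx -mulmxA row_dot_delta ha2 // raddf0 mulmx0 addr0.
  have r1 : delta_mx (0 : 'I_1) k *m e1 = delta_mx 0 k.
    by rewrite mulmxDr mulmx1 mulmxA rkel mul0mx addr0.
  have r2 : delta_mx (0 : 'I_1) k *m e2 = delta_mx 0 k.
    by rewrite mulmxDr mulmx1 mulmxA delta_dot_col mxE hbc ?(ltnW hk) // mulr0 raddf0 mul0mx addr0.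
  have r3 : delta_mx (0 : 'I_1) k *m e3 = delta_mx 0 k.
    by rewrite mulmxDr mulmx1 mulmxA rkel mul0mx addr0.
  by split; rewrite /e123; [rewrite -!mulmxA c3 c2' c1 | rewrite !mulmxA r1 r2 r3].
have [e' [Ee' hee' he'e]] : exists e', [/\ full_elementary e', e123 *m e' = 1%:M & e' *m e123 = 1%:M].
  exact: Egen_inv E123.
pose M3 := M *m e123; pose M3' := e' *m M'.
have hMM3 : M3 *m M3' = 1%:M by rewrite /M3 /M3' mulmxA -(mulmxA M) hee' mulmx1.
have hrl3 : rl *m M3 = rl by rewrite /M3 /e123 !mulmxA hr1 hr2 hr3.
have F3 (k : 'I_N) : (l < k)%N -> fixes M3 k.
  move=> hk; have [h1 h2] := F123 k hk; have [h3 h4] := hM k hk.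
  by split; [rewrite -mulmxA h1 | rewrite mulmxA h4].
(* [e4] sends [el] to [M3' el], so [M3 e4] fixes [el]; since [M3'] also has unit row [l], [c4]
   vanishes at [l] and [e4] is elementary. *)
pose c4 := M3' *m el - el.
have hc4l : c4 l 0 = 0.
  apply: scalar_mx11_inj; rewrite -delta_dot_col /c4 mulmxBr mulmxA -/rl.
  have -> : rl *m M3' = rl by rewrite -{1}hrl3 -mulmxA hMM3 mulmx1.
  by rewrite subrr raddf0.
have hc4 (k : 'I_N) : (l < k)%N -> c4 k 0 = 0.
  move=> hk; have [_ h] := F3 k hk.
  apply: scalar_mx11_inj; rewrite -delta_dot_col /c4 mulmxBr mulmxA.
  have -> : delta_mx 0 k *m M3' = delta_mx (0 : 'I_1) k by rewrite -{1}h -mulmxA hMM3 mulmx1.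
  by rewrite subrr raddf0.
pose e4 : 'M[T]_N := 1%:M + c4 *m rl.
exists (e123 *m e4); split.
  by apply: Egen_mul => //; apply: Egen_col.
move=> k; rewrite leq_eqVlt => /predU1P [hk|hk].
  have -> : k = l by apply: val_inj.
  rewrite mulmxA -/M3 /e4; split.
    rewrite -mulmxA mulmxDl mul1mx -mulmxA rlel mulmx1 /c4 addrC subrK mulmxA.
    by rewrite hMM3 mul1mx.
  by rewrite mulmxA hrl3 mulmxDr mulmx1 mulmxA delta_dot_col hc4l raddf0 mul0mx addr0.
have [h1 h2] := F3 k hk; rewrite mulmxA -/M3 /e4; split.
  rewrite -mulmxA mulmxDl mul1mx -mulmxA [rl *m _]mul_delta_mx_0 ?mulmx0 ?addr0 //.
  by rewrite neq_ltn hk.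
by rewrite mulmxA h2 mulmxDr mulmx1 mulmxA delta_dot_col hc4 // raddf0 mul0mx addr0.
Qed.

Lemma surjective_descent n k M M' : stable_range T n -> (k <= N)%N ->
  M *m M' = 1%:M -> M' *m M = 1%:M -> (forall i : 'I_N, (k <= i)%N -> fixes M i) ->
  exists e, full_elementary e /\ forall i : 'I_N, (n <= i)%N -> fixes (M *m e) i.
Proof.
move=> hs; elim: k M M' => [|k IH] M M' hkN h1 h2 hM.
  exists 1%:M; split; first exact: Egen1.
  by move=> i _; rewrite mulmx1; exact: hM.
have [hnk|hkn] := leqP n k; last first.
  exists 1%:M; split; first exact: Egen1.
  by move=> i hi; rewrite mulmx1; apply: hM; exact: leq_trans hkn hi.
have [|e [he hMe]] := @surjective_step (Ordinal hkN) M M' _ h1 h2 hM.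
  exact: stable_range_leq hs.
have [e' [he' hee' he'e]] : exists e', [/\ full_elementary e', e *m e' = 1%:M & e' *m e = 1%:M].
  exact: Egen_inv he.
have [|||e2 [he2 hMe2]] := IH (M *m e) (e' *m M') (ltnW hkN).
- by rewrite mulmxA -(mulmxA M) hee' mulmx1.
- by rewrite mulmxA -(mulmxA e') h2 mulmx1.
- exact: hMe.
exists (e *m e2); split; first exact: Egen_mul.
by move=> i; rewrite mulmxA; exact: hMe2.
Qed.

End Level.

Variables n m : nat.

Lemma elm_lshift (i j : 'I_n) (a : T) :
  elm (lshift m i) (lshift m j) a = block_mx (elm i j a) 0 0 1%:M.
Proof.
rewrite /elm; have -> : delta_mx (lshift m i) (lshift m j) = block_mx (delta_mx i j) 0 0 0 :> 'M[T]_(n + m).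
  apply/matrixP => x y; rewrite !mxE; case: splitP => x' hx; rewrite !mxE;
    case: splitP => y' hy; rewrite !mxE -!val_eqE /= hx hy //=.
  - by rewrite [(n + y')%N == _]gtn_eqF ?andbF // ltn_addr.
  - by rewrite [(n + x')%N == _]gtn_eqF // ltn_addr.
  - by rewrite [(n + x')%N == _]gtn_eqF // ltn_addr.
by rewrite scalar_mx_block scale_block_mx add_block_mx !scaler0 !addr0.
Qed.

Lemma upper_left_elementary (A : 'M[T]_(n + m)) :
  Egen (fun i j _ => (i < n) && (j < n))%N A ->
  exists A0 : 'M[T]_n, full_elementary A0 /\ A = block_mx A0 0 0 1%:M.
Proof.
elim=> [|A1 i j a _ [A0 [hA0 ->]] hij /andP [hi hj]].
  by exists 1%:M; rewrite -scalar_mx_block; split=> //; exact: Egen1.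
have ei : i = lshift m (Ordinal hi) by apply: val_inj.
have ej : j = lshift m (Ordinal hj) by apply: val_inj.
exists (A0 *m elm (Ordinal hi) (Ordinal hj) a); split; first exact: EgenM.
rewrite {1}ei {1}ej elm_lshift mulmx_block.
by rewrite !mulmx0 !mul0mx !addr0 !add0r mulmx1.
Qed.

Lemma fixes_rshift (g : 'M[T]_n) (i : 'I_(n + m)) : (n <= i)%N ->
  fixes (block_mx g 0 0 1%:M) i.
Proof.
move=> hi; have [j ->] : exists j, i = rshift n j.
  by move: hi; case: (splitP i) => j e; [rewrite e leqNgt ltn_ord | exists j; apply: val_inj].
rewrite /fixes.
have -> : delta_mx (rshift n j) (0 : 'I_1) = col_mx 0 (delta_mx j 0) :> 'cV[T]_(n + m).
  apply/matrixP => x y; rewrite !mxE; case: splitP => x' hx; rewrite !mxE -val_eqE /= hx.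
    by rewrite ltn_eqF // ltn_addr.
  by rewrite eqn_add2l.
have -> : delta_mx (0 : 'I_1) (rshift n j) = row_mx 0 (delta_mx 0 j) :> 'rV[T]_(n + m).
  apply/matrixP => x y; rewrite !mxE; case: splitP => y' hy; rewrite !mxE -!val_eqE /= hy.
    by rewrite andbC ltn_eqF ?ltn_addr.
  by rewrite eqn_add2l.
split; first by rewrite mul_block_col !mulmx0 !mul0mx !add0r mul1mx.
by rewrite mul_row_block !mulmx0 !mul0mx !add0r mulmx1.
Qed.

Theorem stable_injectivity (g : 'M[T]_n) : (1 < n)%N -> stable_range T n.-1 ->
  full_elementary (block_mx g 0 0 1%:M : 'M[T]_(n + m)) -> full_elementary g.
Proof.
move=> hn hs hg.
have h1 : Egen (fun i j _ => (i < n + m) && (j < n + m))%N (block_mx g 0 0 1%:M : 'M[T]_(n + m)).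
  by apply: Egen_mono hg => i j a _ _; rewrite !ltn_ord.
have h2 := stable_descent hn hs (leq_addr _ _) (leqnn _) (fixes_rshift g) h1.
have [A0 [hA0 /eq_block_mx [-> _ _ _]]] := upper_left_elementary h2.
exact: hA0.
Qed.

Lemma fixes_block (M : 'M[T]_(n + m)) : (forall i : 'I_(n + m), (n <= i)%N -> fixes M i) ->
  M = block_mx (ulsubmx M) 0 0 1%:M.
Proof.
move=> hM; rewrite -[LHS]submxK.
have hc j : forall i, M i (rshift n j) = (i == rshift n j)%:R.
  move=> i; have [h _] := hM (rshift n j) (leq_addr _ _).
  by move: h; rewrite -colE => /matrixP /(_ i 0); rewrite !mxE eqxx andbT.
have hr j : forall i, M (rshift n j) i = (i == rshift n j)%:R.
  move=> i; have [_ h] := hM (rshift n j) (leq_addr _ _).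
  by move: h; rewrite -rowE => /matrixP /(_ 0 i); rewrite !mxE eqxx.
congr block_mx; apply/matrixP => i j; rewrite !mxE ?hc ?hr -?val_eqE /=.
- by rewrite ltn_eqF // ltn_addr.
- by rewrite ltn_eqF // ltn_addr.
- by rewrite eqn_add2l.
Qed.

Theorem stable_surjectivity (h h' : 'M[T]_(n + m)) : stable_range T n ->
  h *m h' = 1%:M -> h' *m h = 1%:M ->
  exists g g' e, [/\ g *m g' = 1%:M, g' *m g = 1%:M, full_elementary e &
    h = (block_mx g 0 0 1%:M : 'M[T]_(n + m)) *m e].
Proof.
move=> hs h1 h2.
have [|e [he hfix]] := surjective_descent hs (leqnn _) h1 h2.
  by move=> i; rewrite leqNgt ltn_ord.
have [e' [he' hee' he'e]] : exists e', [/\ full_elementary e', e *m e' = 1%:M & e' *m e = 1%:M].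
  exact: Egen_inv he.
have eb := fixes_block hfix; set g := ulsubmx _ in eb.
pose k := e' *m h'.
have hk1 : (h *m e) *m k = 1%:M by rewrite /k mulmxA -(mulmxA h) hee' mulmx1.
have hk2 : k *m (h *m e) = 1%:M by rewrite /k mulmxA -(mulmxA e') h2 mulmx1.
exists g, (ulsubmx k), e'; split=> //.
- move: hk1; rewrite eb -[k]submxK mulmx_block !mul0mx !mul1mx !addr0 !add0r block_mxKul.
  by rewrite scalar_mx_block => /eq_block_mx [].
- move: hk2; rewrite eb -[k]submxK mulmx_block !mulmx0 !addr0 block_mxKul.
  by rewrite scalar_mx_block => /eq_block_mx [].
- by rewrite -eb -mulmxA hee' mulmx1.
Qed.

End StableIsomorphism.

(** * The Rees algebra as a quotient of a polynomial ring *)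

Section ReesAlgebra.
Variables (R : comNzRingType) (I : R -> Prop).
Hypothesis hI : is_ideal I.
Implicit Types (p q : {poly R}).

Lemma ideal_pow_ideal n : is_ideal (ideal_pow I n).
Proof.
elim: n => [|n IH] /=; first by split.
split.
- by exists [::]; rewrite big_nil.
- move=> x y [s [hs ->]] [t [ht ->]]; exists (s ++ t); split; last by rewrite big_cat.
  by move=> z; rewrite mem_cat => /orP [/hs|/ht].
- move=> a x [s [hs ->]]; exists [seq (z.1, a * z.2) | z <- s]; split.
    move=> _ /mapP [z /hs [h1 h2] ->] /=; split=> //.
    by case: IH => _ _; apply.
  by rewrite big_map big_distrr; apply: eq_bigr => z _ /=; rewrite mulrCA.
Qed.

Lemma ideal_pow_add i j x y : ideal_pow I i x -> ideal_pow I j y ->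
  ideal_pow I (i + j) (x * y).
Proof.
elim: i x => [|i IH] x hx hy; first by case: (ideal_pow_ideal j) => _ _; apply.
case: hx => s [hs ->]; rewrite big_distrl /=.
apply: (ideal_sum (ideal_pow_ideal (i + j).+1)) => z /hs [h1 h2].
exists [:: (z.1, z.2 * y)]; rewrite big_seq1 mulrA; split=> // z'.
by rewrite inE => /eqP ->; split=> //; exact: IH.
Qed.

Lemma ideal_pow1 x : I x -> ideal_pow I 1 x.
Proof.
move=> hx; exists [:: (x, 1)]; rewrite big_seq1 mulr1; split=> // z.
by rewrite inE => /eqP ->.
Qed.

Lemma ideal_pow_exp x n : I x -> ideal_pow I n (x ^+ n).
Proof.
move=> hx; elim: n => [|n IH] //; rewrite exprS -add1n.
by apply: ideal_pow_add => //; exact: ideal_pow1.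
Qed.

Lemma ideal_powS_sub n x : ideal_pow I n.+1 x -> I x.
Proof.
move=> [s [hs ->]]; apply: (ideal_sum hI) => z /hs [h _].
exact: (ideal_mulr _ hI h).
Qed.

Lemma in_rees0 : in_rees I 0.
Proof. by move=> i; rewrite coef0; case: (ideal_pow_ideal i). Qed.

Lemma in_rees_polyC c : in_rees I c%:P.
Proof.
by move=> [|i]; rewrite coefC //=; case: (ideal_pow_ideal i.+1).
Qed.

Lemma in_reesD p q : in_rees I p -> in_rees I q -> in_rees I (p + q).
Proof. by move=> hp hq i; rewrite coefD; case: (ideal_pow_ideal i) => _ h _; apply: h. Qed.

Lemma in_reesM p q : in_rees I p -> in_rees I q -> in_rees I (p * q).
Proof.
move=> hp hq i; rewrite coefM; apply: (ideal_bigsum (ideal_pow_ideal i)) => j _.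
have hj : (j <= i)%N by rewrite -ltnS.
by rewrite -[X in ideal_pow I X](subnKC hj); apply: ideal_pow_add.
Qed.

Lemma in_reesZ c p : in_rees I p -> in_rees I (c *: p).
Proof. by move=> hp; rewrite -mul_polyC; apply: in_reesM => //; exact: in_rees_polyC. Qed.

Lemma in_reesN p : in_rees I p -> in_rees I (- p).
Proof. by move=> hp; rewrite -scaleN1r; exact: in_reesZ. Qed.

Lemma in_reesB p q : in_rees I p -> in_rees I q -> in_rees I (p - q).
Proof. by move=> hp hq; apply: in_reesD => //; exact: in_reesN. Qed.

Lemma in_rees_linear a : I a -> in_rees I (a *: 'X).
Proof.
move=> ha [|[|i]]; rewrite coefZ coefX /=.
- by [].
- by rewrite mulr1; exact: ideal_pow1.
- by rewrite mulr0; case: (ideal_pow_ideal i.+2).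
Qed.

Lemma in_rees_exp p n : in_rees I p -> in_rees I (p ^+ n).
Proof.
move=> hp; elim: n => [|n IH]; first exact: in_rees_polyC.
by rewrite exprS; exact: in_reesM.
Qed.

(** The reason why inverting an element of [I] turns the Rees algebra into a polynomial ring. *)
Lemma in_rees_clear u k p : I u -> (size p <= k.+1)%N -> in_rees I (u ^+ k *: p).
Proof.
move=> hu hp i; rewrite coefZ; have [hi|hi] := leqP i k.
  have -> : u ^+ k * p`_i = (u ^+ (k - i) * p`_i) * u ^+ i.
    by rewrite -{1}(subnK hi) exprD; ring.
  by case: (ideal_pow_ideal i) => _ _; apply; exact: ideal_pow_exp.
rewrite nth_default ?mulr0; last exact: leq_trans hp hi.
by case: (ideal_pow_ideal i).
Qed.

End ReesAlgebra.

(** * Prime chains above the kernel of a presentation *)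

Section Presentation.
Variables (R : idomainType) (d : nat) (I : R -> Prop).
Hypotheses (noethR : noetherian R) (hI : is_ideal I).
Hypothesis dimR : forall l (P Q : R -> Prop), pchain l P Q -> (l <= d)%N.

Lemma ideal_finitely_generated : exists s : seq R, (forall a, a \in s -> I a) /\
  forall x, I x -> forall D : R -> Prop, is_ideal D -> (forall a, a \in s -> D a) -> D x.
Proof.
pose span (s : seq R) x := forall D : R -> Prop, is_ideal D -> (forall a, a \in s -> D a) -> D x.
have span_ideal s : is_ideal (span s).
  split.
  - by move=> D [].
  - move=> a b ha hb D hD hi; case: (hD) => _ hDD _.
    by apply: hDD; [exact: ha | exact: hb].
  - by move=> a b hb D hD hi; case: (hD) => _ _; apply; exact: hb.
have [J [[s [hs ->]] _ hmax]] := noetherian_max noethR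
  (F := fun J => exists s, (forall a, a \in s -> I a) /\ J = span s)
  (J0 := span [::])
  (fun A h => let: ex_intro s (conj _ e) := h in eq_ind_r _ (span_ideal s) e)
  (ex_intro _ [::] (conj (fun a (h : a \in [::]) => False_ind _ (notF h)) erefl)).
exists s; split=> // x hx; apply: (hmax (span (x :: s))).
- by exists (x :: s); split=> // a; rewrite inE => /predU1P [->|/hs].
- by move=> y hy D hD h; apply: hy => // a ha; apply: h; rewrite inE ha orbT.
- by move=> D hD h; apply: h; rewrite inE eqxx.
Qed.

(** The last clause says that the image has dimension at most [d + 1], without forming the quotient
    by the kernel. *)
Definition presents (C : comNzRingType) (phi : {rmorphism C -> {poly R}}) :=
  [/\ noetherian C, forall c, in_rees I (phi c), forall r, exists c, phi c = r%:P &
    forall l (P Q : C -> Prop), pchain l P Q -> (forall c, phi c = 0 -> P c) -> (l <= d.+1)%N].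

Lemma presentation_step a0 a (C : comNzRingType) (phi : {rmorphism C -> {poly R}}) :
  a0 != 0 -> I a -> presents phi -> (exists c, phi c = a0 *: 'X) ->
  exists (C' : comNzRingType) (phi' : {rmorphism C' -> {poly R}}),
    [/\ presents phi', exists c, phi' c = a *: 'X &
      forall c, exists c', phi' c' = phi c].
Proof.
move=> ha0 ha [noethC hin hconst hdim] [x0 hx0].
pose u : {poly R} := a *: 'X.
have cu : commr_rmorph phi u by move=> c; exact: mulrC.
pose phi' : {rmorphism {poly C} -> {poly R}} := horner_morph cu.
exists {poly C}, phi'; split; last first.
- by move=> c; exists c%:P; exact: horner_morphC.
- by exists 'X; exact: horner_morphX.
split.
- exact: hilbert_basis.
- move=> f; rewrite /phi' /= /horner_morph horner_coef.
  apply: (big_ind (in_rees I)); [exact: in_rees0 | exact: in_reesD |].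
  move=> i _; apply: in_reesM => //; first by rewrite coef_map; exact: hin.
  by apply: in_rees_exp => //; exact: in_rees_linear.
- by move=> r; have [c hc] := hconst r; exists c%:P; rewrite -hc; exact: horner_morphC.
move=> l P Q hc hker.
pose q (f : {poly C}) : Prop := map_poly phi f = 0.
have hq : is_prime_ideal q.
  apply: (comap_prime (f := map_poly phi) _ _ _ _ (zero_prime {poly {poly R}})).
  - exact: rmorph0.
  - exact: rmorph1.
  - exact: rmorphD.
  - exact: rmorphM.
have hqP : ssub q P.
  split.
    by move=> f hf; apply: hker; rewrite /phi' /= /horner_morph hf horner0.
  have [c1 hc1] := hconst a0; have [c2 hc2] := hconst a.
  exists (c1%:P * 'X - (c2 * x0)%:P); split.
    apply: hker; rewrite rmorphB rmorphM /= horner_morphX !horner_morphC rmorphM /=.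
    by rewrite hc1 hc2 hx0 /u !mul_polyC !scalerA mulrC subrr.
  rewrite /q rmorphB rmorphM /= map_polyX !map_polyC /= hc1.
  move=> /(congr1 (fun f : {poly {poly R}} => f`_1)).
  rewrite coefB coefMX coefC /= coefC /= subr0 coef0 => /eqP.
  by rewrite polyC_eq0 (negbTE ha0).
have [l' [hl hc']] := pchain_contraction noethC (pchainS hq hqP hc).
apply: leq_trans (hdim _ _ _ hc' _); first by rewrite -ltnS.
by move=> c hc0; rewrite /contraction /q map_polyC /= hc0 polyC0.
Qed.

(** Starts with the variable for [a0 t], the only one that is allowed to raise the dimension; it
    then provides the relation used for all other generators. *)
Lemma presentation_list a0 (s : seq R) : a0 != 0 -> I a0 -> (forall a, a \in s -> I a) ->
  exists (C : comNzRingType) (phi : {rmorphism C -> {poly R}}),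
    [/\ presents phi, exists c, phi c = a0 *: 'X &
      forall a, a \in s -> exists c, phi c = a *: 'X].
Proof.
move=> ha0 hIa0; elim: s => [_|a s IH hs].
  exists {poly R}, (comp_poly (a0 *: 'X)); split=> //; last by exists 'X; exact: comp_polyX.
  split.
  - exact: hilbert_basis.
  - move=> f; rewrite /= comp_polyE; apply: (big_ind (in_rees I)).
    + exact: in_rees0.
    + exact: in_reesD.
    + move=> i _; apply: in_reesZ => //; apply: in_rees_exp => //; exact: in_rees_linear.
  - by move=> r; exists r%:P; exact: comp_polyC.
  - move=> l P Q hc _; have [l' [hl hc']] := pchain_contraction noethR hc.
    by apply: leq_trans hl _; rewrite ltnS; exact: dimR hc'.
have [|C [phi [hphi hx0 hphis]]] := IH.
  by move=> b hb; apply: hs; rewrite inE hb orbT.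
have ha : I a by apply: hs; rewrite inE eqxx.
have [C' [phi' [h1 h2 h3]]] := presentation_step ha0 ha hphi hx0.
exists C', phi'; split=> //.
  by have [c <-] := hx0; exact: h3.
by move=> b; rewrite inE => /predU1P [->|/hphis [c <-]].
Qed.

Lemma rees_presentation : exists (C : comNzRingType) (phi : {rmorphism C -> {poly R}}),
  presents phi /\ forall p, in_rees I p -> exists c, phi c = p.
Proof.
case: (EM (exists a, I a /\ a != 0)) => [[a0 [hIa0 ha0]]|h0]; last first.
  exists R, (polyC : {rmorphism R -> {poly R}}); split.
    split=> //.
    - exact: in_rees_polyC.
    - by move=> r; exists r.
    - by move=> l P Q hc _; apply: leqW; exact: dimR hc.
  move=> p hp; exists p`_0; apply/polyP => -[|i]; rewrite coefC //=.
  apply/esym/eqP; apply: contraT => hn; case: h0.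
  by exists p`_i.+1; split=> //; apply: ideal_powS_sub (hp i.+1).
have [s [hs hsI]] := ideal_finitely_generated.
have [C [phi [hphi _ hphis]]] := presentation_list ha0 hIa0 hs.
exists C, phi; split=> // p hp; case: (hphi) => _ _ hconst _.
pose im q := exists c, phi c = q.
have imD q1 q2 : im q1 -> im q2 -> im (q1 + q2).
  by move=> [c1 <-] [c2 <-]; exists (c1 + c2); rewrite rmorphD.
have imM q1 q2 : im q1 -> im q2 -> im (q1 * q2).
  by move=> [c1 <-] [c2 <-]; exists (c1 * c2); rewrite rmorphM.
have im0 : im 0 by exists 0; rewrite rmorph0.
have imZ r q : im q -> im (r *: q).
  by move=> hq; rewrite -mul_polyC; apply: imM => //; exact: hconst.
have imI x : I x -> im (x *: 'X).
  move=> hx; apply: (hsI x hx (fun x => im (x *: 'X))) => //.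
  split.
  - by rewrite scale0r.
  - by move=> y z hy hz; rewrite scalerDl; exact: imD.
  - by move=> y z hz; rewrite -scalerA; exact: imZ.
have imP i x : ideal_pow I i x -> im (x *: 'X^i).
  elim: i x => [|i IH] x.
    by move=> _; rewrite expr0 alg_polyC; exact: hconst.
  case=> t [ht ->]; rewrite scaler_suml big_seq.
  apply: (big_ind im) => // -[y z] /ht /= [h1 h2].
  have -> : (y * z) *: 'X^(i.+1) = (y *: 'X) * (z *: 'X^i) :> {poly R}.
    by rewrite exprS -scalerAl -scalerAr scalerA.
  by apply: imM; [exact: imI | exact: IH].
rewrite -[p]coefK poly_def; apply: (big_ind im) => // i _; exact: imP.
Qed.

End Presentation.

(** * Localizations of the Rees algebra at denominators from R *)

(** Bundled so that the localization becomes a type with a single parameter carrying its ring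
    structure. *)
Record rees_data (R : idomainType) := ReesData {
  rd_ideal : R -> Prop;
  rd_denom : R -> Prop;
  rd_ideal_ax : is_ideal rd_ideal;
  rd_mult_ax : mult_closed rd_denom;
  rd_nz_ax : ~ rd_denom 0 }.

Notation frac_poly := (map_poly (@tofrac _)).


Section LocalizedRees.
Variables (R : idomainType) (x : rees_data R).
Local Notation I := (rd_ideal x).
Local Notation W := (rd_denom x).
Local Notation K := {fraction R}.
Let hI := rd_ideal_ax x.

Lemma frac_poly_inj : injective (frac_poly : {poly R} -> {poly K}).
Proof. by apply: map_inj_poly; [move=> a b /eqP; rewrite tofrac_eq => /eqP | exact: tofrac0]. Qed.

Lemma frac_polyZ (c : R) (p : {poly R}) :
  frac_poly (c *: p) = c%:F *: (frac_poly p : {poly K}).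
Proof. by rewrite map_polyZ. Qed.

Definition rees_loc_pred : {pred {poly K}} :=
  fun f => `[< exists w p, [/\ W w, in_rees I p & w%:F *: f = frac_poly p] >].

Lemma rees_loc_subring : subring_closed rees_loc_pred.
Proof.
have [W1 WM] := rd_mult_ax x.
split.
- apply/asboolP; exists 1, 1%:P; split=> //; first exact: in_rees_polyC.
  by rewrite tofrac1 scale1r map_polyC /= tofrac1.
- move=> f g /asboolP [w [p [hw hp e]]] /asboolP [w' [p' [hw' hp' e']]].
  apply/asboolP; exists (w * w'), (w' *: p - w *: p'); split; first exact: WM.
    by apply: in_reesB => //; exact: in_reesZ.
  rewrite rmorphB /= !frac_polyZ -e -e' !scalerA -!tofracM scalerBr.
  by rewrite [w' * w]mulrC.
- move=> f g /asboolP [w [p [hw hp e]]] /asboolP [w' [p' [hw' hp' e']]].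
  apply/asboolP; exists (w * w'), (p * p'); split; [exact: WM | exact: in_reesM |].
  by rewrite [RHS]rmorphM /= -e -e' -scalerAl -scalerAr scalerA tofracM.
Qed.

HB.instance Definition _ := GRing.isSubringClosed.Build {poly K} rees_loc_pred rees_loc_subring.

Record rees_loc := ReesLoc { rees_val : {poly K}; rees_valP : rees_val \in rees_loc_pred }.

HB.instance Definition _ := [isSub for rees_val].
HB.instance Definition _ := [Choice of rees_loc by <:].
HB.instance Definition _ := [SubChoice_isSubComNzRing of rees_loc by <:].


Local Notation B := rees_loc.

Lemma rees_val_inj : injective rees_val. Proof. exact: val_inj. Qed.

Lemma rees_valD a b : rees_val (a + b) = rees_val a + rees_val b.
Proof. exact: (rmorphD (val : B -> {poly K})). Qed.

Lemma rees_valM a b : rees_val (a * b) = rees_val a * rees_val b.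
Proof. exact: (rmorphM (val : B -> {poly K})). Qed.

Lemma rees_val0 : rees_val 0 = 0.
Proof. exact: (rmorph0 (val : B -> {poly K})). Qed.

Lemma rees_val1 : rees_val 1 = 1.
Proof. exact: (rmorph1 (val : B -> {poly K})). Qed.

(** Takes the default value 0 where the polynomial is not in the localization, so the laws below
    carry membership hypotheses. *)
Definition to_rees_loc (p : {poly R}) : B := insubd 0 (frac_poly p).

Local Notation inB := to_rees_loc.

Lemma to_rees_loc_val p : in_rees I p -> rees_val (inB p) = frac_poly p.
Proof.
move=> hp; apply: insubdK; apply/asboolP; exists 1, p.
by rewrite tofrac1 scale1r; split=> //; case: (rd_mult_ax x).
Qed.

Lemma inB0 : inB 0 = 0.
Proof.
apply: rees_val_inj; rewrite to_rees_loc_val ?rees_val0 ?rmorph0 //.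
exact: in_rees0.
Qed.

Lemma inB1 : inB 1 = 1.
Proof.
apply: rees_val_inj; rewrite to_rees_loc_val ?rees_val1 ?rmorph1 //.
exact: in_rees_polyC.
Qed.

Lemma inBD p q : in_rees I p -> in_rees I q -> inB (p + q) = inB p + inB q.
Proof.
move=> hp hq; apply: rees_val_inj.
by rewrite rees_valD !to_rees_loc_val ?rmorphD //; exact: in_reesD.
Qed.

Lemma inBM p q : in_rees I p -> in_rees I q -> inB (p * q) = inB p * inB q.
Proof.
move=> hp hq; apply: rees_val_inj.
by rewrite rees_valM !to_rees_loc_val ?[RHS]rmorphM ?[LHS]rmorphM //; exact: in_reesM.
Qed.

Lemma denominator_unit w : W w -> exists v : B, v * inB w%:P = 1.
Proof.
move=> hw; have hw0 : w%:F != 0 :> K.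
  by rewrite tofrac_eq0; apply/eqP => e; apply: (rd_nz_ax (r := x)); rewrite -e.
have hv : (w%:F^-1)%:P \in rees_loc_pred.
  apply/asboolP; exists w, 1%:P; split=> //; first exact: in_rees_polyC.
  by rewrite -mul_polyC -polyCM mulfV // map_polyC /= tofrac1.
exists (ReesLoc hv); apply: rees_val_inj.
rewrite rees_valM rees_val1 to_rees_loc_val /=; last exact: in_rees_polyC.
by rewrite map_polyC /= -polyCM mulVf.
Qed.

Lemma numerator (b : B) : exists w p, [/\ W w, in_rees I p & inB w%:P * b = inB p].
Proof.
have /asboolP [w [p [hw hp e]]] := rees_valP b; exists w, p; split=> //.
apply: rees_val_inj; rewrite rees_valM !to_rees_loc_val //; last exact: in_rees_polyC.
by rewrite map_polyC /= mul_polyC.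
Qed.

Lemma denominator_cancel (J : B -> Prop) w b : is_ideal J -> W w -> J (inB w%:P * b) -> J b.
Proof.
move=> [_ _ hM] hw h; have [v hv] := denominator_unit hw.
by rewrite -[b]mul1r -hv -mulrA; exact: hM.
Qed.

Lemma prime_denominator (P : B -> Prop) w : is_prime_ideal P -> W w -> ~ P (inB w%:P).
Proof.
move=> [hP h1 _] hw hPw; apply: h1; apply: (denominator_cancel hP hw).
by rewrite mulr1.
Qed.

(** * Prime chains in the localizations *)

Section Dimension.
Variable d : nat.
Hypothesis noethR : noetherian R.
Hypothesis dimR : forall l (P Q : R -> Prop), pchain l P Q -> (l <= d)%N.

Variables (C : comNzRingType) (phi : {rmorphism C -> {poly R}}).
Hypothesis hphi : presents d I phi.
Hypothesis phi_surj : forall p, in_rees I p -> exists c, phi c = p.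

Let noethC : noetherian C. Proof. by case: hphi. Qed.
Let phi_in c : in_rees I (phi c). Proof. by case: hphi. Qed.

Local Notation f := (fun c : C => inB (phi c)).

Let f0 : f 0 = 0. Proof. by rewrite /= rmorph0 inB0. Qed.
Let f1 : f 1 = 1. Proof. by rewrite /= rmorph1 inB1. Qed.
Let fD : {morph f : a b / a + b}. Proof. by move=> a b; rewrite /= rmorphD inBD. Qed.
Let fM : {morph f : a b / a * b}. Proof. by move=> a b; rewrite /= rmorphM inBM. Qed.

(** An ideal of the localization is determined by its numerators, hence by its pullback to the
    Noetherian ring [C]. *)
Lemma rees_loc_noetherian : noetherian B.
Proof.
move=> J hJ hJS; have [||N hN] := noethC (Ik := fun k c => J k (f c)).
- by move=> k; exact: (comap_ideal f0 fD fM).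
- by move=> k c; exact: hJS.
exists N => k hk b; have [w [p [hw hp e]]] := numerator b.
have [c hc] := phi_surj hp.
have key k' : J k' b <-> J k' (f c).
  rewrite /= hc -e; split; last exact: denominator_cancel.
  by case: (hJ k') => _ _; apply.
by rewrite !key; exact: hN.
Qed.

Lemma pchain_pullback l (P Q : B -> Prop) : pchain l P Q ->
  pchain l (fun c => P (f c)) (fun c => Q (f c)).
Proof.
move=> hc; apply: (@pchain_map _ _ (fun P c => P (f c)) (fun=> True) _ _ _ _ _ _ hc) => //.
  by move=> P0 hP0 _; exact: (comap_prime f0 f1 fD fM).
move=> P1 P2 h1 h2 _ _ [h12 [b [hb hb1]]]; split; first by move=> c; exact: h12.
have [w [p [hw hp e]]] := numerator b; have [c ec] := phi_surj hp.
exists c; rewrite ec -e; split; first by case: h2 => -[_ _ hM] _ _; exact: hM.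
by move=> h; apply: hb1; apply: (denominator_cancel _ hw h); exact: prime_ideal.
Qed.

Lemma pchain_rees l (P Q : B -> Prop) : pchain l P Q -> (l <= d.+1)%N.
Proof.
move=> hc; case: hphi => _ _ _; apply; first exact: pchain_pullback hc.
by move=> c hc0; rewrite /= hc0 inB0; case: (pchain_first hc) => -[].
Qed.

Lemma pchain_rees_closed u l (P Q : B -> Prop) : u != 0 -> pchain l P Q -> P (inB u%:P) -> (l <= d)%N.
Proof.
move=> hu hc hPu; case: (hphi) => _ _ hconst hdim; rewrite -ltnS.
apply: (hdim l.+1 (fun c => phi c = 0) (fun c => Q (f c))) => //.
apply: (pchainS _ _ (pchain_pullback hc)).
  apply: (comap_prime _ _ _ _ (zero_prime {poly R})).
  - exact: rmorph0.
  - exact: rmorph1.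
  - exact: rmorphD.
  - exact: rmorphM.
split; first by move=> c ->; rewrite inB0; case: (pchain_first hc) => -[].
have [c ec] := hconst u; exists c; rewrite ec; split=> // /eqP.
by rewrite polyC_eq0 (negbTE hu).
Qed.

Section Open.
Variable u : R.
Hypotheses (Iu : I u).

(* The contraction to [R[t]] of the prime generated by [P] after inverting [u]. *)
Definition polar (P : B -> Prop) : {poly R} -> Prop :=
  fun p => exists k, in_rees I (u ^+ k *: p) /\ P (inB (u ^+ k *: p)).

Lemma inBZ k p : in_rees I p -> inB (u ^+ k *: p) = inB u%:P ^+ k * inB p.
Proof.
move=> hp; rewrite -mul_polyC inBM //; last exact: in_rees_polyC.
congr (_ * _); elim: k => [|k IH]; first by rewrite !expr0 inB1.
by rewrite !exprS polyCM inBM ?IH //; exact: in_rees_polyC.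
Qed.

(** The power of [u] is immaterial because [u] is outside [P]. *)
Lemma polarE P k p : is_prime_ideal P -> ~ P (inB u%:P) -> in_rees I (u ^+ k *: p) ->
  polar P p -> P (inB (u ^+ k *: p)).
Proof.
move=> hP hu hk [k' [hk' hPk']].
have hN : ~ P (inB u%:P ^+ k') by move=> /(prime_exp hP).
have : P (inB u%:P ^+ k' * inB (u ^+ k *: p)).
  rewrite -inBZ // scalerA mulrC -scalerA inBZ //.
  by case: hP => -[_ _ hM] _ _; exact: hM.
by case: hP => _ _ hM /hM [].
Qed.

Lemma polar_prime P : is_prime_ideal P -> ~ P (inB u%:P) -> is_prime_ideal (polar P).
Proof.
move=> hP hu; have hclear (p : {poly R}) : in_rees I (u ^+ size p *: p).
  by apply: in_rees_clear.
case: (hP) => -[h0 hD hM] h1 hp; split; first split.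
- by exists 0%N; rewrite scaler0; split; [exact: in_rees0 | rewrite inB0].
- move=> p q [k [h2 h3]] [k' [h4 h5]]; exists (k + k')%N.
  have e : u ^+ (k + k') *: (p + q) = u ^+ k' *: (u ^+ k *: p) + u ^+ k *: (u ^+ k' *: q).
    by rewrite !scalerA -!exprD [(k' + k)%N]addnC scalerDr.
  have a1 : in_rees I (u ^+ k' *: (u ^+ k *: p)) by exact: in_reesZ.
  have a2 : in_rees I (u ^+ k *: (u ^+ k' *: q)) by exact: in_reesZ.
  rewrite e; split; first exact: in_reesD.
  by rewrite inBD // (inBZ k' h2) (inBZ k h4); apply: hD; exact: hM.
- move=> p q [k [h2 h3]]; exists (size p + k)%N.
  have e : u ^+ (size p + k) *: (p * q) = (u ^+ size p *: p) * (u ^+ k *: q).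
    by rewrite -scalerAl -scalerAr scalerA exprD.
  rewrite e; split; first exact: in_reesM.
  by rewrite inBM //; exact: hM.
- move=> [k [h2]]; rewrite inBZ ?inB1 ?mulr1; last exact: in_rees_polyC.
  by move/(prime_exp hP).
- move=> p q hpq.
  have e : (u ^+ size p *: p) * (u ^+ size q *: q) = u ^+ (size p + size q) *: (p * q).
    by rewrite -scalerAl -scalerAr scalerA exprD.
  have a1 : in_rees I (u ^+ (size p + size q) *: (p * q)) by rewrite -e; exact: in_reesM.
  have := polarE hP hu a1 hpq; rewrite -e inBM // => /hp [h|h].
    by left; exists (size p).
  by right; exists (size q).
Qed.

Lemma polar_strict P P' : is_prime_ideal P -> is_prime_ideal P' -> ~ P (inB u%:P) ->
  ssub P P' -> ssub (polar P) (polar P').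
Proof.
move=> hP hP' hu [h [b [hb hb']]]; split.
  by move=> p [k [h1 h2]]; exists k; split=> //; exact: h.
have [w [p [hw hp e]]] := numerator b; exists p; split.
  exists 0%N; rewrite expr0 scale1r -e; split=> //.
  by case: hP' => -[_ _ hM] _ _; exact: hM.
have h0 : in_rees I (u ^+ 0 *: p) by rewrite expr0 scale1r.
move=> /(polarE hP hu h0); rewrite expr0 scale1r -e => h1.
by apply: hb'; apply: (denominator_cancel _ hw h1); exact: prime_ideal.
Qed.

(** Away from [u] the ring is polynomial, so the chain passes to R[t] and then to R with the loss of
    at most one step. The last clause keeps what is needed to prolong it there: the final
    contraction misses the denominators and, up to powers of [u], lies in [Q]. *)
Lemma pchain_rees_open l (P Q : B -> Prop) : pchain l P Q -> ~ Q (inB u%:P) ->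
  exists l' q, [/\ (l <= l'.+1)%N, pchain l' q (contraction (polar Q)) &
    forall c, contraction (polar Q) c -> ~ W c /\ exists k, Q (inB (u ^+ k * c)%:P)].
Proof.
move=> hc hQ.
have hc' : pchain l (polar P) (polar Q).
  apply: (@pchain_map _ _ polar (fun P => ~ P (inB u%:P)) _ _ _ _ _ _ hc hQ) => //.
  - by move=> P0; exact: polar_prime.
  - by move=> P1 P2 h1 h2 h3 _; exact: polar_strict.
  - by move=> P1 P2 h12 h2 /h12.
have [l' [hl hcl]] := pchain_contraction noethR hc'.
exists l', (contraction (polar P)); split=> // c [k [h1 h2]].
have hQp := pchain_last hc; rewrite -!mul_polyC -polyCM in h2; split; last by exists k.
move=> hw; apply: hQ; apply: (@prime_exp _ Q _ k) => //.
apply: (denominator_cancel (prime_ideal hQp) hw).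
move: h2; rewrite polyCM inBM; [| exact: in_rees_polyC..]; rewrite mulrC.
suff -> : inB (u ^+ k)%:P = inB u%:P ^+ k by [].
by rewrite -[LHS]mulr1 -[_%:P]mulr1 mul_polyC inBZ ?inB1 ?mulr1 //; exact: in_rees_polyC.
Qed.

End Open.
End Dimension.
End LocalizedRees.

(** * Stable range of the localizations *)

Section StableRangeBounds.
Variables (R : idomainType) (d : nat).
Hypothesis noethR : noetherian R.
Hypothesis dimR : forall l (P Q : R -> Prop), pchain l P Q -> (l <= d)%N.

Lemma stable_range_base : stable_range R d.+1.
Proof.
(* With [u = 0] the splitting of the spectrum is trivial, and the dimension bounds both kinds of
   chains. *)
apply: (@stable_range_of_chains R 0 d noethR) => [l P Q hc _|l P Q hc _];
  exact: dimR hc.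
Qed.

Lemma stable_range_rees (x : rees_data R) : stable_range (rees_loc x) d.+2.
Proof.
have [C [phi [hphi hs]]] := rees_presentation noethR (rd_ideal_ax x) dimR.
apply: (@stable_range_of_chains _ 0 d.+1 (rees_loc_noetherian hphi hs)) => l P Q hc _;
  exact: (pchain_rees hphi hs hc).
Qed.

(* Above [u] the chains lose the zero ideal; away from [u] they contract to chains of [R] that can
   still be prolonged by a maximal ideal containing [u]. *)
Lemma stable_range_near (x : rees_data R) u : rd_ideal x u -> u != 0 ->
  (forall r, rd_denom x (1 + u * r)) -> stable_range (rees_loc x) d.+1.
Proof.
move=> hu hu0 hW.
have [C [phi [hphi hs]]] := rees_presentation noethR (rd_ideal_ax x) dimR.
apply: (@stable_range_of_chains _ (to_rees_loc x u%:P) d (rees_loc_noetherian hphi hs)).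
  by move=> l P Q hc hP; exact: (pchain_rees_closed hphi hs hu0 hc hP).
move=> l P Q hc hQ.
have [l' [q [hl hc' hq]]] := pchain_rees_open noethR hu hc hQ.
have hqp := pchain_last hc'; have hqi := prime_ideal hqp.
have [||m [hm hqm]] := @prime_above _ noethR (adjoin (contraction (polar u Q)) u).
- exact: adjoin_ideal.
(* Were [1 = j + r * u], the contraction would contain the denominator [1 - u * r]. *)
- move=> [j [r [hj e]]]; have [hn _] := hq _ hj; apply: hn.
  have -> : j = 1 + u * (- r) by rewrite e; ring.
  exact: hW.
have hum : m u by apply: hqm; exact: adjoin_in.
have hc2 : pchain l'.+1 q m.
  apply: (pchain_rcons hc' hm); split.
    exact: psub_trans (@adjoin_sub _ _ _) hqm.
  exists u; split=> // /hq [_ [k]].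
  rewrite -exprSr -alg_polyC inBZ; last by rewrite -polyC1; exact: in_rees_polyC.
  by rewrite inB1 mulr1 => /(prime_exp (pchain_last hc)).
exact: leq_trans hl (dimR hc2).
Qed.

(** The localization is K[t]: no prime contains the unit [u], and every prime contracts to zero in
    R, so chains have length at most one. *)
Lemma stable_range_generic (x : rees_data R) u : rd_ideal x u -> u != 0 ->
  (forall w, w != 0 -> rd_denom x w) -> stable_range (rees_loc x) 2.
Proof.
move=> hu hu0 hW.
have [C [phi [hphi hs]]] := rees_presentation noethR (rd_ideal_ax x) dimR.
apply: (@stable_range_of_chains _ (to_rees_loc x u%:P) 1 (rees_loc_noetherian hphi hs)).
  move=> l P Q hc hP; case: (prime_denominator (pchain_first hc) (hW u hu0) hP).
move=> l P Q hc hQ.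
have [l' [q [hl hc' hq]]] := pchain_rees_open noethR hu hc hQ.
case: l' => [|l'] in hl hc'; first exact: hl.
inversion hc' as [|l1 P1 P2 Q1 h1 [_ [c [hc2 hc1]]] h3 e1 e2 e3]; subst.
case: hc1; have [hWc _] := hq c (pchain_sub h3 hc2).
case: (eqVneq c 0) => [->|/hW //]; by case: h1 => -[].
Qed.

End StableRangeBounds.

(** * Commutator and conjugation formulas for elementary matrices *)

Section ElementaryCalculus.
Variables (T : comNzRingType) (N : nat).
Implicit Types (i j k m p : 'I_N) (a b y f : T).

Lemma elm_mul i j k m a b : elm i j a *m elm k m b =
  1%:M + a *: delta_mx i j + b *: delta_mx k m + (a * b) *: (delta_mx i m *+ (j == k)).
Proof.
rewrite /elm mulmxDl mul1mx mulmxDr mulmx1 -scalemxAr -scalemxAl scalerA.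
by rewrite mul_delta_mx_cond addrACA addrA [b * a]mulrC.
Qed.

Lemma elm_mul0 i j k m a b : j != k -> elm i j a *m elm k m b =
  1%:M + a *: delta_mx i j + b *: delta_mx k m.
Proof. by move=> /negbTE h; rewrite elm_mul h mulr0n scaler0 addr0. Qed.

Lemma elm_comm i j k m a b : j != k -> m != i -> 
  elm i j a *m elm k m b = elm k m b *m elm i j a.
Proof. by move=> h1 h2; rewrite !elm_mul0 // addrAC. Qed.

Lemma elm_conj i j f A A' : i != j -> A *m elm i j f = elm i j f *m A' ->
  elm i j (- f) *m A *m elm i j f = A'.
Proof. by move=> hij e; rewrite -mulmxA e mulmxA elm_add // addNr elm0 mul1mx. Qed.

Lemma elm_conj_left i j k f y : i != j -> k != j -> k != i ->
  elm i j (- f) *m elm k i y *m elm i j f = elm k i y *m elm k j (y * f).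
Proof.
move=> hij hkj hki; apply: elm_conj => //.
have hik : i != k by rewrite eq_sym.
have hjk : j != k by rewrite eq_sym.
rewrite elm_mul eqxx mulr1n (elm_mul0 _ _ _ _ hik).
rewrite /elm mulmxDl mul1mx !mulmxDr mulmx1 -!scalemxAl -!scalemxAr.
rewrite !(@mul_delta_mx_0 _ _ _ _ _ _ _ _ hjk) // !scaler0 !addr0.
by rewrite -!addrA; congr (_ + _); congr (_ + _); rewrite addrC.
Qed.

Lemma elm_conj_right i j m f y : i != j -> m != i -> m != j ->
  elm i j (- f) *m elm j m y *m elm i j f = elm j m y *m elm i m (- (f * y)).
Proof.
move=> hij hmi hmj; apply: elm_conj => //.
have hji : j != i by rewrite eq_sym.
rewrite elm_mul0 // [elm j m y *m _]elm_mul0 //.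
rewrite /elm mulmxDl mul1mx !mulmxDr mulmx1 -!scalemxAl -!scalemxAr.
rewrite mul_delta_mx (@mul_delta_mx_0 _ _ _ _ _ _ _ _ hji) !scaler0 addr0.
rewrite scalerA scaleNr -!addrA; congr (_ + (_ + _)).
by rewrite [f *: _ + _]addrC addKr.
Qed.

Lemma elm_commutator i j p a b : i != j -> p != i -> p != j ->
  elm i j (a * b) = elm i p a *m elm p j b *m elm i p (- a) *m elm p j (- b).
Proof.
move=> hij hpi hpj.
have hji : j != i by rewrite eq_sym.
have hjp : j != p by rewrite eq_sym.
have hip : i != p by rewrite eq_sym.
have e : elm i p a *m elm p j b = elm i j (a * b) *m elm p j b *m elm i p a.
  rewrite elm_mul eqxx mulr1n (elm_mul0 _ _ _ _ hjp).
  rewrite /elm mulmxDr mulmx1 -!scalemxAr !mulmxDl mul1mx -!scalemxAl.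
  rewrite !(@mul_delta_mx_0 _ _ _ _ _ _ _ _ hji) !scaler0 !addr0.
  by rewrite [RHS]addrC -!addrA addrCA; congr (_ + (_ + _)); rewrite addrC.
rewrite e -!mulmxA [elm i p a *m _]mulmxA elm_add // subrr elm0 mul1mx.
by rewrite elm_add // subrr elm0 mulmx1.
Qed.

Lemma map_elm (T' : comNzRingType) (phi : {rmorphism T -> T'}) i j a :
  map_mx phi (elm i j a) = elm i j (phi a).
Proof. by rewrite /elm map_mxD map_mxZ map_delta_mx map_mx1. Qed.

Lemma Egen_map (T' : comNzRingType) (phi : {rmorphism T -> T'})
    (S : 'I_N -> 'I_N -> T -> Prop) (S' : 'I_N -> 'I_N -> T' -> Prop) A :
  (forall i j a, S i j a -> S' i j (phi a)) -> Egen S A -> Egen S' (map_mx phi A).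
Proof.
move=> h; elim=> [|A1 i j a _ IH hij ha]; first by rewrite map_mx1; exact: Egen1.
by rewrite map_mxM map_elm; apply: EgenM => //; exact: h.
Qed.

End ElementaryCalculus.

(** * The local-global principle *)

Section LocalGlobal.
Variables (R : idomainType) (I : R -> Prop) (n : nat).
Hypothesis n_ge3 : (2 < n)%N.
Local Notation K := {fraction R}.
Local Notation toK := (frac_poly : {poly R} -> {poly K}).

(** [den_rees w] allows the denominator [w], [multiple_rees w] demands the factor [w]; conjugation
    by the former uses up factors of the latter. *)
Definition den_rees (w : R) (f : {poly K}) := exists p, in_rees I p /\ w%:F *: f = toK p.

Definition multiple_rees (w : R) (f : {poly K}) := exists p, in_rees I p /\ f = toK (w *: p).

Local Notation E S := (Egen (fun _ _ : 'I_n => S)).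

Lemma multiple_reesN w f : multiple_rees w f -> multiple_rees w (- f).
Proof.
by move=> [p [hp ->]]; exists (- p); rewrite scalerN rmorphN; split=> //; exact: in_reesN.
Qed.

Lemma multiple_reesM w z y f : z != 0 -> multiple_rees (w * z) y -> den_rees z f ->
  multiple_rees w (y * f).
Proof.
move=> hz [p [hp ->]] [q [hq e]]; exists (p * q); split; first exact: in_reesM.
have eM : toK (p * q) = toK p * toK q by rewrite rmorphM.
by rewrite !frac_polyZ eM -e tofracM -scalerAl -scalerAr scalerA.
Qed.

Lemma multiple_rees_weaken w z y : multiple_rees (w * z) y -> multiple_rees w y.
Proof.
move=> [p [hp ->]]; exists (z *: p); rewrite scalerA; split=> //; exact: in_reesZ.
Qed.

Lemma third_index (i j : 'I_n) : exists p : 'I_n, p != i /\ p != j.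
Proof.
have h : (#|[set i; j]| < #|'I_n|)%N.
  by rewrite card_ord; apply: leq_ltn_trans n_ge3; rewrite cards2; case: (i != j).
have /subsetPn [p _ hp] : ~~ ([set: 'I_n] \subset [set i; j]).
  by apply: contraL h => /subset_leq_card; rewrite cardsT -leqNgt.
by exists p; move: hp; rewrite !inE negb_or => /andP.
Qed.

(** Excluded is only the position opposite to [(i, j)], where the conjugate is no product of one or
    two generators of the same shape. *)
Lemma conj_generator (w z : R) (i j k m : 'I_n) f y : z != 0 -> i != j -> k != m ->
  (j != k) || (m != i) -> den_rees z f -> multiple_rees (w * z) y ->
  E (multiple_rees w) (elm i j (- f) *m elm k m y *m elm i j f).
Proof.
move=> hz hij hkm hjk hf hy; have hwy := multiple_rees_weaken hy.
have hyf := multiple_reesM hz hy hf.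
have hE a b t : a != b -> multiple_rees w t -> E (multiple_rees w) (elm a b t).
  by move=> hab ht; apply: Egen_elm.
case: (eqVneq m i) hjk hkm => [->|hmi] /=.
  rewrite orbF => hjk hki; rewrite elm_conj_left //; last by rewrite eq_sym.
  by apply: Egen_mul; apply: hE => //; rewrite eq_sym.
case: (eqVneq j k) => [<- _ hjm|hjk _ hkm].
  rewrite elm_conj_right // 1?eq_sym //; apply: Egen_mul; apply: hE => //.
    by rewrite eq_sym.
  by apply: multiple_reesN; rewrite mulrC.
by rewrite (elm_conj hij (esym (elm_comm f y hjk hmi))); exact: hE.
Qed.

(** In the opposite position the entry, a multiple of [(w z)^2], is split into two multiples of
    [w z], and the generator becomes a commutator through a third index [p], whose factors
    [conj_generator] can handle. Hence the square in the hypothesis, and the need for n >= 3. *)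
Lemma conj_multiple (w z : R) (i j : 'I_n) f D : z != 0 -> i != j -> den_rees z f ->
  E (multiple_rees ((w * z) * (w * z))) D ->
  E (multiple_rees w) (elm i j (- f) *m D *m elm i j f).
Proof.
move=> hz hij hf; elim=> [|A k m y _ IH hkm hy].
  by rewrite mulmx1 elm_add // addNr elm0; exact: Egen1.
have -> : elm i j (- f) *m (A *m elm k m y) *m elm i j f =
    (elm i j (- f) *m A *m elm i j f) *m (elm i j (- f) *m elm k m y *m elm i j f).
  by rewrite !mulmxA -(mulmxA _ (elm i j f)) elm_add // subrr elm0 mulmx1.
apply: Egen_mul => //.
case: (boolP ((j != k) || (m != i))) => hjk.
  by apply: conj_generator hf (multiple_rees_weaken hy).
move: hjk; rewrite negb_or !negbK => /andP [/eqP ejk /eqP emi]; subst k m.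
have [p [hpi hpj]] := third_index i j.
have [q [hq ey]] := hy.
have ey' : y = toK ((w * z) *: q) * toK (w * z)%:P.
  by rewrite ey -[RHS]rmorphM [X in _ = _ X]mulrC mul_polyC scalerA.
have h1 : multiple_rees (w * z) (toK ((w * z) *: q)) by exists q.
have h2 : multiple_rees (w * z) (toK (w * z)%:P).
  by exists 1; split; [exact: in_rees_polyC | rewrite alg_polyC].
rewrite ey' (elm_commutator _ _ hkm hpj hpi).
set a := toK _ in h1 *; set b := toK _ in h2 *.
have conj4 (A1 A2 A3 A4 : 'M[{poly K}]_n) : elm i j (- f) *m (A1 *m A2 *m A3 *m A4) *m elm i j f =
  (elm i j (- f) *m A1 *m elm i j f) *m (elm i j (- f) *m A2 *m elm i j f) *m
  (elm i j (- f) *m A3 *m elm i j f) *m (elm i j (- f) *m A4 *m elm i j f).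
  have hU : elm i j f *m elm i j (- f) = 1%:M by rewrite elm_add // subrr elm0.
  by rewrite !mulmxA; do 3 (rewrite -[_ *m elm i j f *m elm i j (- f)]mulmxA hU mulmx1).
rewrite conj4; apply: Egen_mul; first apply: Egen_mul; first apply: Egen_mul.
- by apply: conj_generator hf h1; rewrite ?hpi ?orbT // eq_sym.
- by apply: conj_generator hf h2; rewrite // eq_sym hpj.
- by apply: conj_generator hf (multiple_reesN h1); rewrite ?hpi ?orbT // eq_sym.
- by apply: conj_generator hf (multiple_reesN h2); rewrite // eq_sym hpj.
Qed.

Definition dilation (a : R) : {rmorphism {poly K} -> {poly K}} := comp_poly (a%:F *: 'X).

Lemma coef_dilation a f i : (dilation a f)`_i = a%:F ^+ i * f`_i.
Proof.
rewrite /dilation /= comp_polyE coef_sum.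
under eq_bigr => j _ do rewrite exprZn scalerA coefZ coefXn.
have [hi|hi] := ltnP i (size f).
  rewrite (bigD1 (Ordinal hi)) //= eqxx mulr1 mulrC big1 ?addr0 // => j hj.
  by rewrite [i == j]eq_sym -val_eqE /= in hj *; rewrite (negbTE hj) mulr0.
rewrite nth_default // mulr0 big1 // => j _.
by rewrite [i == j]gtn_eqF ?mulr0 //; exact: leq_trans hi.
Qed.

Lemma dilation_den z a f : den_rees z f -> den_rees z (dilation a f).
Proof.
move=> [p [hp e]]; exists (\poly_(i < size p) (a ^+ i * p`_i)); split.
  move=> i; rewrite coef_poly; case: ifP => _; last by case: (ideal_pow_ideal I i).
  by case: (ideal_pow_ideal I i) => _ _; apply; exact: hp.
apply/polyP => i; rewrite coefZ coef_dilation coef_map coef_poly /=.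
have ei : z%:F * f`_i = (p`_i)%:F.
  by have := congr1 (fun g : {poly K} => g`_i) e; rewrite coefZ coef_map.
rewrite mulrCA ei; case: ltnP => hi; first by rewrite tofracM tofracXn.
by rewrite nth_default // tofrac0 mulr0.
Qed.

(** On coefficient [i] the difference is multiplication by [b ^+ i - a ^+ i], which is divisible by
    [b - a = w z c]: [z] cancels the denominator and [w] survives. *)
Lemma dilation_diff w z a c f : z != 0 -> den_rees z f ->
  multiple_rees w (dilation (a + w * z * c) f - dilation a f).
Proof.
move=> hz [p [hp e]]; set b := a + _.
pose s i := \sum_(j < i) b ^+ (i.-1 - j) * a ^+ j.
have hs i : b ^+ i - a ^+ i = (w * z * c) * s i.
  by rewrite subrXX (_ : b - a = w * z * c) // /b addrC addKr.
exists (\poly_(i < size p) (c * s i * p`_i)); split.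
  move=> i; rewrite coef_poly; case: ifP => _; last by case: (ideal_pow_ideal I i).
  by case: (ideal_pow_ideal I i) => _ _; apply; exact: hp.
apply/polyP => i; rewrite frac_polyZ coefB !coef_dilation coefZ coef_map coef_poly /=.
have ei : z%:F * f`_i = (p`_i)%:F.
  by have := congr1 (fun g : {poly K} => g`_i) e; rewrite coefZ coef_map.
rewrite -mulrBl -!tofracXn -tofracB hs.
have -> : (if (i < size p)%N then c * s i * p`_i else 0) = c * s i * p`_i.
  by case: ltnP => // hi; rewrite nth_default // mulr0.
rewrite !tofracM -ei; ring.
Qed.

Lemma dilation0 f : dilation 0 f = (f`_0)%:P.
Proof. by rewrite /dilation /= tofrac0 scale0r comp_poly0r. Qed.

Lemma dilation1 f : dilation 1 f = f.
Proof. by rewrite /dilation /= tofrac1 scale1r comp_polyXr. Qed.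

(** [N] is uniform in [a] and [c], so the dilation parameter may be moved from any starting
    point. *)
Lemma dilation_step (z : R) X : z != 0 -> E (den_rees z) X -> forall M, exists N, forall a c,
  exists D, E (multiple_rees (z ^+ M)) D /\
    map_mx (dilation (a + z ^+ N * c)) X = map_mx (dilation a) X *m D.
Proof.
move=> hz; elim=> [|A i j f _ IH hij hf] M.
  by exists 0%N => a c; exists 1%:M; rewrite !map_mx1 mulmx1; split=> //; exact: Egen1.
(* To keep the factor [z ^+ M] after conjugation by a generator with denominator [z],
   [conj_multiple] asks for [(z ^+ M * z)^2], that is the exponent [2 (M + 1)]. *)
have [N1 hN1] := IH (M.+1 + M.+1)%N; exists (N1 + M.+1)%N => a c.
have [D [hD eD]] := hN1 a (z ^+ M.+1 * c).
set b := a + _; have eb : b = a + z ^+ M * z * (z ^+ N1 * c).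
  by rewrite /b exprD exprS; ring.
have eb' : b = a + z ^+ N1 * (z ^+ M.+1 * c) by rewrite /b exprD; ring.
pose fa := dilation a f; pose fb := dilation b f.
exists ((elm i j (- fa) *m D *m elm i j fa) *m elm i j (fb - fa)); split.
  apply: Egen_mul.
    apply: (conj_multiple hz hij (dilation_den a hf)).
    by move: hD; rewrite exprD !exprSr.
  by apply: Egen_elm => //; rewrite /fb eb; exact: dilation_diff.
rewrite !map_mxM !map_elm {1}eb' eD -!mulmxA; congr (_ *m _).
have hU : elm i j fa *m elm i j (- fa) = 1%:M by rewrite elm_add // subrr elm0.
rewrite [RHS]mulmxA hU mul1mx; congr (_ *m _).
by rewrite elm_add // addrC subrK.
Qed.

Lemma comaximal_pow (u v : R) N N' : (exists a b, a * u + b * v = 1) ->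
  exists a b, a * u ^+ N + b * v ^+ N' = 1.
Proof.
have half (x y : R) k : (exists a b, a * x + b * y = 1) -> exists a b, a * x ^+ k + b * y = 1.
  move=> [a [b e]]; elim: k => [|k [a' [b' e']]].
    by exists 1, 0; rewrite expr0; ring.
  exists (a * a'), (b * (a' * x ^+ k + b' * y) + a * x * b').
  by rewrite -[RHS]mulr1 -{1}e -e' exprS; ring.
move=> /(half _ _ N) [a [b e]].
have [|b' [a' e']] := half v (u ^+ N) N'; first by exists b, a; rewrite addrC.
by exists a', b'; rewrite addrC.
Qed.

(** The parameter moves from 0 to [u ^+ N * a] by the factorization over [u], then on to
    [u ^+ N * a + v ^+ N' * b = 1] by the one over [v]; each move costs an elementary matrix over
    the Rees algebra. *)
Theorem local_global (u v : R) X : u != 0 -> v != 0 -> (exists a b, a * u + b * v = 1) ->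
  E (den_rees u) X -> E (den_rees v) X ->
  exists D, E (den_rees 1) D /\ X = map_mx (dilation 0) X *m D.
Proof.
move=> hu hv huv hXu hXv.
have [N hN] := dilation_step hu hXu 0; have [N' hN'] := dilation_step hv hXv 0.
have [a [b e]] := comaximal_pow N N' huv.
have [D1 [hD1 e1]] := hN 0 a; have [D2 [hD2 e2]] := hN' (u ^+ N * a) b.
exists (D1 *m D2); split.
  by apply: Egen_mul; [apply: Egen_mono hD1 | apply: Egen_mono hD2] => i j f _ [p [hp ->]];
    exists p; rewrite expr0 scale1r tofrac1 scale1r.
rewrite mulmxA -e1 add0r -e2.
have -> : u ^+ N * a + v ^+ N' * b = 1 by rewrite -e; ring.
by apply/matrixP => i j; rewrite mxE dilation1.
Qed.

End LocalGlobal.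

(** * The main theorem *)

Section Transport.
Variables (R : idomainType) (I : R -> Prop).
Hypothesis hI : is_ideal I.
Local Notation K := {fraction R}.
Local Notation toK := (frac_poly : {poly R} -> {poly K}).

Lemma rees_E_Egen n (A : 'M[{poly R}]_n) : rees_E I A <-> Egen (fun _ _ => in_rees I) A.
Proof.
split.
  elim=> [|A1 e _ IH [i [j [a [hij ha ->]]]]]; first exact: Egen1.
  exact: EgenM.
elim=> [|A1 i j a _ IH hij ha]; first exact: rees_E1.
by apply: rees_EM => //; exists i, j, a.
Qed.

Lemma map_mx_injective (A B : Type) (f : A -> B) m n : injective f ->
  injective (map_mx f : 'M_(m, n) -> 'M_(m, n)).
Proof.
move=> hf X Y /matrixP h; apply/matrixP => i j; apply: hf.
by have := h i j; rewrite !mxE.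
Qed.

Lemma Egen_descend n (Y : 'M[{poly K}]_n) : Egen (fun _ _ => den_rees I 1) Y ->
  exists y, rees_E I y /\ map_mx toK y = Y.
Proof.
elim=> [|A i j f _ [y [hy <-]] hij [p [hp e]]].
  by exists 1%:M; rewrite map_mx1; split=> //; exact: rees_E1.
exists (y *m elm i j p); split.
  by apply: rees_EM => //; exists i, j, p.
by rewrite map_mxM map_elm /= -e tofrac1 scale1r.
Qed.

Lemma rees_E_lift (x : rees_data R) n (A : 'M[{poly R}]_n) : rd_ideal x = I ->
  rees_E I A -> exists E : 'M[rees_loc x]_n, full_elementary E /\
    map_mx (val : rees_loc x -> {poly K}) E = map_mx toK A.
Proof.
move=> eI /rees_E_Egen; elim=> [|A1 i j a _ [E [hE e]] hij ha].
  by exists 1%:M; rewrite !map_mx1; split=> //; exact: Egen1.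
exists (E *m elm i j (to_rees_loc x a)); split; first exact: EgenM.
rewrite map_mxM [RHS]map_mxM e; congr (_ *m _).
by rewrite !map_elm /= to_rees_loc_val // eI.
Qed.


Lemma block_lift (A B : comNzRingType) (f : {rmorphism A -> B}) n m (E : 'M[A]_(n + m))
    (g : 'M[B]_n) : injective f -> map_mx f E = block_mx g 0 0 1%:M ->
  exists G : 'M[A]_n, E = block_mx G 0 0 1%:M /\ map_mx f G = g.
Proof.
move=> hf; rewrite -[E]submxK map_block_mx => /eq_block_mx [e1 e2 e3 e4].
exists (ulsubmx E); split=> //.
by congr block_mx; apply: (map_mx_injective hf); rewrite ?e2 ?e3 ?e4 ?map_mx0 ?map_mx1.
Qed.

Lemma common_denominator (x : rees_data R) n (X : 'M[{poly K}]_n) : rd_ideal x = I ->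
  Egen (fun _ _ f => f \in rees_loc_pred x) X ->
  exists w, rd_denom x w /\ Egen (fun _ _ => den_rees I w) X.
Proof.
move=> eI; have [W1 WM] := rd_mult_ax x.
elim=> [|A i j f _ [w [hw IH]] hij /asboolP [w' [p [hw' hp e]]]].
  by exists 1; split=> //; exact: Egen1.
rewrite eI in hp.
exists (w * w'); split; first exact: WM.
apply: EgenM => //.
  apply: Egen_mono IH => k l y _ [q [hq eq]]; exists (w' *: q); split; first exact: in_reesZ.
  by rewrite frac_polyZ -eq scalerA -tofracM mulrC.
exists (w *: p); split; first exact: in_reesZ.
by rewrite frac_polyZ -e scalerA -tofracM.
Qed.

Lemma local_elementary (x : rees_data R) n m (g : 'M[{poly R}]_n) : rd_ideal x = I ->
  (1 < n)%N -> stable_range (rees_loc x) n.-1 -> rees_E I (stab m g) ->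
  exists w, rd_denom x w /\ Egen (fun _ _ => den_rees I w) (map_mx toK g).
Proof.
move=> eI hn hs /(rees_E_lift eI) [E [hE e]].
have [||G [eE eG]] := @block_lift _ _ (val : rees_loc x -> {poly K}) n m E (map_mx toK g).
- exact: val_inj.
- by rewrite e /stab map_block_mx !map_mx0 map_mx1.
rewrite eE in hE; have hG := stable_injectivity hn hs hE.
apply: (common_denominator eI); rewrite -eG.
by apply: Egen_map hG => i j a _; exact: rees_valP.
Qed.

Lemma constant_elementary n m (g : 'M[{poly R}]_n) : (1 < n)%N -> stable_range R n.-1 ->
  rees_E I (stab m g) -> Egen (fun _ _ => den_rees I 1) (map_mx (dilation 0) (map_mx toK g)).
Proof.
move=> hn hs /rees_E_Egen hE.
pose ev : {rmorphism {poly R} -> R} := horner_eval 0.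
have h1 : full_elementary (map_mx ev (stab m g)) by exact: Egen_map hE.
have e1 : map_mx ev (stab m g) = block_mx (map_mx ev g) 0 0 1%:M.
  by rewrite /stab map_block_mx !map_mx0 map_mx1.
rewrite e1 in h1; have h2 := stable_injectivity hn hs h1.
have -> : map_mx (dilation 0) (map_mx toK g) = map_mx (toK \o polyC) (map_mx ev g).
  apply/matrixP => i j; rewrite !mxE dilation0 coef_map /= map_polyC /=.
  by rewrite /ev /= /horner_eval horner_coef0.
apply: Egen_map h2 => i j a _; exists a%:P.
by rewrite tofrac1 scale1r; split=> //; exact: in_rees_polyC.
Qed.

End Transport.

Lemma krull_dim_pchain (R : comNzRingType) d : krull_dim R d ->
  forall l (P Q : R -> Prop), pchain l P Q -> (l <= d)%N.
Proof. by move=> [_ h] l P Q /pchain_prime_chain [C [hC _]]; exact: h hC. Qed.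

Section MainTheorem.
Variables (R : idomainType) (d : nat) (I : R -> Prop).
Hypotheses (noethR : noetherian R) (dimR : krull_dim R d) (hI : is_ideal I).
Variable n : nat.
Hypothesis hn : (maxn 3 (d + 2) <= n)%N.
Let n3 : (2 < n)%N. Proof. by move: hn; rewrite geq_max => /andP []. Qed.
Let nd : (d.+1 < n)%N. Proof. by move: hn; rewrite geq_max addn2 => /andP []. Qed.
Let dimR' := krull_dim_pchain dimR.
Local Notation K := {fraction R}.
Local Notation toK := (frac_poly : {poly R} -> {poly K}).

Lemma rees_injectivity m (g : 'M[{poly R}]_n) : mx_over I g ->
  rees_E I (stab m g) -> rees_E I g.
Proof.
move=> hgI hg; have n1 : (1 < n)%N by exact: ltnW.
have hc : Egen (fun _ _ => den_rees I 1) (map_mx (dilation 0) (map_mx toK g)).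
  apply: constant_elementary hg => //.
  by apply: stable_range_leq (stable_range_base noethR dimR'); rewrite -ltnS prednK // ltnW.
suff [D [hD eD]] : exists D, Egen (fun _ _ => den_rees I 1) D /\
    map_mx toK g = map_mx (dilation 0) (map_mx toK g) *m D.
  have [|y [hy ey]] := @Egen_descend _ I n (map_mx toK g).
    by rewrite eD; exact: Egen_mul.
  by rewrite -(map_mx_injective (@frac_poly_inj R) ey).
case: (EM (exists a, I a /\ a != 0)) => [[a [ha ha0]]|h0]; last first.
  exists 1%:M; split; first exact: Egen1.
  rewrite mulmx1; apply/matrixP => i j; rewrite !mxE dilation0 coef_map /=.
  rewrite -[RHS]map_polyC /=; congr (map_poly _ _); apply/polyP => -[|k]; rewrite coefC //=.
  apply/eqP; apply: contraT => hk; case: h0; exists (g i j)`_k.+1; split=> //.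
  exact: ideal_powS_sub (hgI i j k.+1).
have mult1 : mult_closed (fun w : R => w <> 0).
  split; first by apply/eqP; exact: oner_neq0.
  by move=> x y /eqP hx /eqP hy; apply/eqP; rewrite mulf_neq0.
pose xK := ReesData hI mult1 (fun h => h erefl).
have hsK : stable_range (rees_loc xK) n.-1.
  have h2 : stable_range (rees_loc xK) 2.
    by apply: (stable_range_generic noethR dimR' (x := xK) ha ha0) => w /eqP.
  by apply: stable_range_leq h2; rewrite -ltnS prednK // ltnW // ltnW.
have [w [/eqP hw0 hw]] := local_elementary (x := xK) erefl n1 hsK hg.
(* The factor [a] brings the denominator into [I], as [stable_range_near] requires. *)
pose u := a * w; have hu : I u by exact: ideal_mulr.
have hu0 : u != 0 by rewrite mulf_neq0.
have hXu : Egen (fun _ _ => den_rees I u) (map_mx toK g).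
  apply: Egen_mono hw => i j f _ [p [hp e]]; exists (a *: p); split; first exact: in_reesZ.
  by rewrite frac_polyZ -e scalerA -tofracM.
(* If 0 has the form [1 + u * r], it cannot serve as a denominator; but then [u] is a unit,
   comaximal with itself, and the factorization over [u] alone suffices. *)
case: (EM (exists r, 1 + u * r = 0)) => [[r hr]|hr].
  apply: (local_global n3 hu0 hu0 _ hXu hXu); exists (- r), 0.
  by rewrite mul0r addr0 mulNr mulrC; apply/eqP; rewrite eq_sym -addr_eq0 hr.
have mult2 : mult_closed (fun v : R => exists r, v = 1 + u * r).
  split; first by exists 0; rewrite mulr0 addr0.
  by move=> _ _ [r ->] [s ->]; exists (r + s + u * r * s); ring.
pose xu := ReesData hI mult2 (fun h => hr (let: ex_intro r e := h in ex_intro _ r (esym e))).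
have hsu : stable_range (rees_loc xu) n.-1.
  have h2 : stable_range (rees_loc xu) d.+1.
    by apply: (stable_range_near noethR dimR' (x := xu) hu hu0) => r; exists r.
  by apply: stable_range_leq h2; rewrite -ltnS prednK // ltnW.
have [v [[r hv] hXv]] := local_elementary (x := xu) erefl n1 hsu hg.
apply: (local_global n3 hu0 _ _ hXu hXv).
  by apply/eqP => v0; apply: (hr); exists r; rewrite -hv.
by exists (- r), 1; rewrite hv mul1r mulNr [r * u]mulrC addrCA addNr addr0.
Qed.

Lemma rees_surjectivity m (h : 'M[{poly R}]_(n + m)) : rees_GL I h ->
  exists (g : 'M[{poly R}]_n) (e : 'M[{poly R}]_(n + m)),
    [/\ rees_GL I g, rees_E I e & h = stab m g *m e].
Proof.
move=> [hh [h' [hh' hhh' hh'h]]].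
(* With 1 as the only denominator, [rees_loc] is the Rees algebra itself, as a ring to which the
   stability theorems apply. *)
have mult1 : mult_closed (fun w : R => w = 1).
  by split=> // x y -> ->; rewrite mulr1.
have nz1 : ~ (0 : R) = 1 by apply/eqP; rewrite eq_sym oner_neq0.
pose x := ReesData hI mult1 nz1; pose B := rees_loc x.
pose valB : {rmorphism B -> {poly K}} := val.
have val_inB p : in_rees I p -> valB (to_rees_loc x p) = toK p by exact: (@to_rees_loc_val R x p).
have lift k l (A : 'M[{poly R}]_(k, l)) : mx_over I A ->
    map_mx valB (map_mx (to_rees_loc x) A) = map_mx toK A.
  by move=> hA; apply/matrixP => i j; rewrite !mxE val_inB.
have valB_inj : injective valB by exact: val_inj.
have hs : stable_range B n.
  by apply: (@stable_range_leq _ d.+2 n nd); exact: (@stable_range_rees _ _ noethR dimR' x).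
have [||G [G' [E [e1 e2 hE eH]]]] := @stable_surjectivity B n m
    (map_mx (to_rees_loc x) h) (map_mx (to_rees_loc x) h') hs.
- apply: (map_mx_injective valB_inj); rewrite map_mxM !lift // -map_mxM hhh' !map_mx1 //.
- apply: (map_mx_injective valB_inj); rewrite map_mxM !lift // -map_mxM hh'h !map_mx1 //.
have num (b : B) : exists p, in_rees I p /\ toK p = valB b.
  have /asboolP [w [p [-> hp e]]] := rees_valP b; exists p; split=> //.
  by rewrite -e tofrac1 scale1r.
have [f hf] := choice num.
have lower k l (A : 'M[B]_(k, l)) : mx_over I (map_mx f A) /\
    map_mx toK (map_mx f A) = map_mx valB A.
  split; first by move=> i j; rewrite mxE; case: (hf (A i j)).
  by apply/matrixP => i j; rewrite !mxE; case: (hf (A i j)).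
have [e [he ee]] : exists e, rees_E I e /\ map_mx toK e = map_mx valB E.
  apply: Egen_descend; apply: Egen_map hE => i j b _.
  by have [p [hp ep]] := num b; exists p; rewrite tofrac1 scale1r.
have [hG eG] := lower _ _ G; have [hG' eG'] := lower _ _ G'.
exists (map_mx f G), e; split=> //.
  split=> //; exists (map_mx f G'); split=> //; apply: (map_mx_injective (@frac_poly_inj R)).
    by rewrite map_mxM eG eG' -map_mxM e1 !map_mx1.
  by rewrite map_mxM eG eG' -map_mxM e2 !map_mx1.
apply: (map_mx_injective (@frac_poly_inj R)).
rewrite map_mxM ee -lift // eH map_mxM; congr (_ *m _).
by rewrite /stab !map_block_mx eG !map_mx0 !map_mx1.
Qed.

End MainTheorem.

Lemma mx_over_mul (R : comNzRingType) (I : R -> Prop) k l m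
    (A : 'M[{poly R}]_(k, l)) (B : 'M[{poly R}]_(l, m)) :
  mx_over I A -> mx_over I B -> mx_over I (A *m B).
Proof.
move=> hA hB i j; rewrite mxE.
apply: (big_ind (in_rees I)); [exact: in_rees0 | exact: in_reesD |].
by move=> t _; exact: in_reesM.
Qed.

Theorem theorem4p2 (R : idomainType) (d : nat) (I : R -> Prop) :
  noetherian R -> krull_dim R d -> is_ideal I ->
  forall n : nat, (maxn 3 (d + 2) <= n)%N ->
  (* surjectivity of GL_n/E_n -> K_1 : every class of GL_(n+m) comes from GL_n *)
  (forall (m : nat) (h : 'M[{poly R}]_(n + m)), rees_GL I h ->
     exists (g : 'M[{poly R}]_n) (e : 'M[{poly R}]_(n + m)),
       [/\ rees_GL I g, rees_E I e & h = stab m g *m e]) /\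
  (* injectivity : if g, g' become E-equivalent after stabilization,
     they are already E_n-equivalent *)
  (forall (g g' : 'M[{poly R}]_n), rees_GL I g -> rees_GL I g' ->
     forall (m : nat) (e : 'M[{poly R}]_(n + m)), rees_E I e ->
       stab m g' = stab m g *m e ->
     exists e0 : 'M[{poly R}]_n, rees_E I e0 /\ g' = g *m e0).
Proof.
move=> noethR dimR hI n hn; split; first by move=> m h; exact: (rees_surjectivity noethR dimR hI hn).
move=> g g' [hg [B [hB hgB hBg]]] [hg' _] m e he eg.
(* Injectivity on cosets reduces to a trivial kernel: [B] is the inverse of [g], and [B *m g']
   stabilizes to [e]. *)
exists (B *m g'); split; last by rewrite mulmxA hgB mul1mx.
apply: (rees_injectivity noethR dimR hI hn (m := m)); first exact: mx_over_mul.
suff -> : stab m (B *m g') = e by [].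
have -> : stab m (B *m g') = stab m B *m stab m g'.
  by rewrite /stab mulmx_block !mulmx0 !mul0mx !addr0 !add0r mulmx1.
rewrite eg mulmxA.
suff -> : stab m B *m stab m g = 1%:M by rewrite mul1mx.
by rewrite /stab mulmx_block !mulmx0 !mul0mx !addr0 !add0r mulmx1 hBg -scalar_mx_block.
Qed.
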